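(* Consider the active scalar equation on a torus $\mathbb{T}^n$ of any dimension $n\geq1$, $$\partial_t\theta+\partial_l(\theta u^l)=0,\qquad u^l=T^l[\theta],\qquad\partial_l u^l=0,$$ where $T^l$ is the Fourier multiplier operator with symbol $m^l$. Suppose that the image of the even part of the multiplier lies in a hyperplane perpendicular to some nonzero vector $\xi_{(0)}\in\mathbb{Z}^n$ in the dual lattice of $\mathbb{T}^n$, i.e. $\xi_{(0)}\cdot\left(m(\xi)+m(-\xi)\right)=0$ for all $\xi\neq0$. Then there exists a smooth, compactly supported, real-valued function $f\in C_0^\infty(\mathbb{R}\times\mathbb{T}^n)$ which satisfies the conservation law $\int_{\mathbb{T}^n}f(t,x)\,dx=0$ for all $t$, such that $f$ cannot be realized as a weak-* limit in $L^\infty$ of any sequence of bounded weak solutions to the active scalar equation.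
   Context: $\mathbb{T}^n=(\mathbb{R}/2\pi\mathbb{Z})^n$, with dual lattice $\widehat{\mathbb{T}^n}=\mathbb{Z}^n$; repeated indices are summed over $l=1,\dots,n$. The operator $T^l$, acting in the space variable, is defined by $\widehat{T^l[\theta]}(\xi)=m^l(\xi)\hat\theta(\xi)$. Standing assumptions on the symbol $m=(m^1,\dots,m^n)$, defined on $\mathbb{R}^n\setminus\{0\}$ with complex values: $m$ is homogeneous of degree $0$, smooth away from the origin, satisfies $m^l(-\xi)=\overline{m^l(\xi)}$, and $\xi\cdot m(\xi)=0$ for $\xi\neq0$. On the zero Fourier mode we use the convention $m(0)=0$. Scalars $\theta$ are real-valued. A bounded weak solution is a $\theta\in L^\infty(\mathbb{R}\times\mathbb{T}^n)$ for which the equations, with $u^l=T^l[\theta]$, hold in the sense of distributions on $\mathbb{R}\times\mathbb{T}^n$. *)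

(* Defs.v *)
From HB Require Import structures.
From mathcomp Require Import all_boot all_order all_algebra.
From mathcomp Require Import complex.
From mathcomp Require Import all_classical all_reals all_analysis.

Set Implicit Arguments.
Unset Strict Implicit.
Unset Printing Implicit Defensive.

Import Order.TTheory GRing.Theory Num.Theory.
Import numFieldNormedType.Exports.

Local Open Scope classical_set_scope.
Local Open Scope ring_scope.

(* Row vectors carry the sigma-algebra generated by the coordinates, exactly
   as the library does for tuples; over the reals it is the Borel one. *)
Definition measure_rV_display : measure_display -> measure_display.
Proof. exact. Qed.

Section measurable_rV.
Context {d} {T : measurableType d} (n : nat).

Let coords (i : 'I_n) (x : 'rV[T]_n) : T := x ord0 i.

Let rV_set0 : g_sigma_preimage coords set0.
Proof. exact: sigma_algebra0. Qed.

Let rV_setC A : g_sigma_preimage coords A -> g_sigma_preimage coords (~` A).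
Proof. exact: sigma_algebraC. Qed.

Let rV_bigcup (F : _^nat) : (forall i, g_sigma_preimage coords (F i)) ->
  g_sigma_preimage coords (\bigcup_i (F i)).
Proof. exact: sigma_algebra_bigcup. Qed.

HB.instance Definition _ := @isMeasurable.Build (measure_rV_display d)
  'rV[T]_n (g_sigma_preimage coords) rV_set0 rV_setC rV_bigcup.

End measurable_rV.

Lemma measurable_coord d (T : measurableType d) n (i : 'I_n) :
  measurable_fun [set: 'rV[T]_n] (fun x : 'rV[T]_n => x ord0 i).
Proof.
move=> _ Y mY; rewrite setTI; apply: sub_sigma_algebra => /=.
rewrite -bigcup_seq/=; exists i => /=; first by rewrite mem_index_enum.
by exists Y => //; rewrite setTI.
Qed.

Lemma measurable_fun_rV d1 d2 (T1 : measurableType d1) (T2 : measurableType d2)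
    n (f : T1 -> 'rV[T2]_n) :
  (forall i, measurable_fun [set: T1] (fun x => f x ord0 i)) ->
  measurable_fun [set: T1] f.
Proof.
move=> mf; pose c (i : 'I_n) (x : 'rV[T2]_n) := x ord0 i.
have prefS : g_sigma_preimage (fun i => c i \o f) `<=` measurable.
  apply: smallest_sub; first exact: sigma_algebra_measurable.
  apply: (big_ind (fun X : set (set T1) => X `<=` measurable)) => //.
    by move=> X Y mX mY A [/mX|/mY].
  by move=> i _ _ [A mA <-]; exact: mf.
move=> _ A mA; apply: prefS; rewrite g_sigma_preimage_comp.
by exists A.
Qed.

Definition rV_cons (T : Type) n (p : T * 'rV[T]_n) : 'rV[T]_n.+1 :=
  row_mx (const_mx p.1 : 'rV[T]_1) p.2.

Lemma measurable_rV_cons d (T : measurableType d) n :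
  measurable_fun setT (@rV_cons T n).
Proof.
apply: (@measurable_fun_rV _ _ _ _ n.+1) => i.
case: (splitP (i : 'I_(1 + n))) => j ij.
  have -> : (fun p => @rV_cons T n p ord0 i) = fst.
    apply/funext => p; have -> : i = lshift n j by exact/val_inj.
    by rewrite [LHS]row_mxEl mxE.
  exact: measurable_fst.
have -> : (fun p => @rV_cons T n p ord0 i) =
          (fun x : 'rV[T]_n => x ord0 j) \o snd.
  apply/funext => p; have -> : i = rshift 1 j by exact/val_inj.
  by rewrite [LHS]row_mxEr.
exact: measurableT_comp (measurable_coord j) measurable_snd.
Qed.

Section torus_measure.
Context {R : realType}.

Lemma lebesgue_circle_lty :
  ((@lebesgue_measure R) `[0%R, (2 * pi)%R[%classic < +oo)%E.
Proof. by rewrite lebesgue_measure_itv; case: ifP => _; exact: ltry. Qed.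

Definition circle_measure : {finite_measure set (measurableTypeR R) -> \bar R} :=
  @mfrestr _ (measurableTypeR R) R _ lebesgue_measure
    (measurable_itv `[0, (2 * pi)[) lebesgue_circle_lty.

Definition rV_cons_measure n (nu : {finite_measure set 'rV[R]_n -> \bar R})
  : set 'rV[R]_n.+1 -> \bar R :=
  pushforward (circle_measure \x nu)%E (@rV_cons R n).

Section rV_cons_measure_finite.
Variables (n : nat) (nu : {finite_measure set 'rV[R]_n -> \bar R}).
Let mcons : measurable_fun [set: measurableTypeR R * 'rV[R]_n] (@rV_cons R n).
Proof. exact: (@measurable_rV_cons _ R n). Qed.

Let map := rV_cons_measure nu.

Let map0 : map set0 = 0%E.
Proof. exact: measure0. Qed.

Let map_ge0 A : (0 <= map A)%E.
Proof. exact: measure_ge0. Qed.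

Let map_sigma_additive : semi_sigma_additive map.
Proof. exact: measure_semi_sigma_additive. Qed.

HB.instance Definition _ := isMeasure.Build _ _ _ map
  map0 map_ge0 map_sigma_additive.

Let map_finite : fin_num_fun map.
Proof.
apply: lty_fin_num_fun.
suff : ((circle_measure \x nu)%E (setT `*` setT) < +oo)%E by rewrite setXTT.
rewrite product_measure1E// lte_mul_pinfty//.
  exact: fin_num_measure.
by rewrite -ge0_fin_numE//; exact: fin_num_measure.
Qed.

HB.instance Definition _ := Measure_isFinite.Build _ _ _ map map_finite.

End rV_cons_measure_finite.

(* Lebesgue measure on the fundamental domain [0, 2 pi[^n of the torus *)
Fixpoint torus_measure n : {finite_measure set 'rV[R]_n -> \bar R} :=
  match n with
  | 0 => \d_(0 : 'rV[R]_0)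
  | n'.+1 => rV_cons_measure (torus_measure n')
  end.

End torus_measure.

Arguments torus_measure {R} n.

Definition spacetime_measure (R : realType) n :
    {measure set (measurableTypeR R * 'rV[R]_n) -> \bar R} :=
  ((@lebesgue_measure R) \x torus_measure n)%E.

Section smooth.
Context {R : realType} {E : normedModType R}.
Implicit Types (f : E -> R) (U : set E).

Definition iter_derive (vs : seq E) f : E -> R :=
  foldr (fun v g => 'D_v g) f vs.

(* f is C^infty on the open set U: all its iterated directional derivatives
   exist and are continuous at the points of U. *)
Definition smooth_on U f := forall (vs : seq E) (x : E), U x ->
  {for x, continuous (iter_derive vs f)} /\
  (forall v, derivable (iter_derive vs f) x v).

End smooth.

Section active_scalar.
Context {R : realType} {n : nat}.

(* Functions on R x T^n are functions on R x R^n that are 2 pi Z^n-periodic in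
   the second variable, and are integrated against spacetime_measure. *)
Local Notation E := (R * 'rV[R]_n)%type.
Local Notation mu := (spacetime_measure R n).

Definition dotv (K : pzRingType) (x y : 'rV[K]_n) : K :=
  \sum_l x ord0 l * y ord0 l.

Definition freq (k : 'rV[int]_n) : 'rV[R]_n := map_mx intr k.

Definition complexv (x : 'rV[R]_n) : 'rV[R[i]]_n := map_mx (real_complex R) x.

Definition space_periodic (f : E -> R) := forall (z : E) (k : 'rV[int]_n),
  f (z.1, z.2 + (2 * pi) *: freq k) = f z.

Definition dt (f : E -> R) : E -> R := 'D_((1, 0) : E) f.

Definition dx (l : 'I_n) (f : E -> R) : E -> R :=
  'D_((0, delta_mx ord0 l) : E) f.

Definition test_function (f : E -> R) :=
  [/\ smooth_on setT f, space_periodic f &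
      exists A : R, forall t x, A < `|t| -> f (t, x) = 0].

(* (2 pi)^-n times the integral over T^n of v(x) exp(- i k.x) *)
Definition fourier (v : 'rV[R]_n -> R) (k : 'rV[int]_n) : R[i] :=
  real_complex R ((2 * pi) ^- n) *
  Complex (\int[torus_measure n]_x (v x * cos (dotv (freq k) x)))
          (- \int[torus_measure n]_x (v x * sin (dotv (freq k) x))).

(* The value of m at 0 is irrelevant. *)
Definition multiplier_symbol (m : 'rV[R]_n -> 'rV[R[i]]_n) :=
  [/\ forall (a : R) xi, 0 < a -> xi != 0 -> m (a *: xi) = m xi,
      forall l, smooth_on [set xi | xi != 0] (fun xi => complex.Re (m xi ord0 l))
             /\ smooth_on [set xi | xi != 0] (fun xi => complex.Im (m xi ord0 l)),
      forall xi l, xi != 0 -> m (- xi) ord0 l = conjc (m xi ord0 l) &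
      forall xi, xi != 0 -> dotv (complexv xi) (m xi) = 0].

(* The symbol on the dual lattice, with m(0) = 0. *)
Definition lattice_symbol (m : 'rV[R]_n -> 'rV[R[i]]_n) (k : 'rV[int]_n) :=
  if k == 0 then 0 else m (freq k).

Definition locally_square_integrable (u : E -> R) :=
  measurable_fun setT u /\ forall A : R,
    (\int[mu]_(z in `[(- A)%R, A] `*` setT) ((u z) ^+ 2)%:E < +oo)%E.

(* u = T^l[theta]; since the symbol is bounded, T^l maps bounded functions to
   locally square integrable ones, so u exists and is unique a.e. *)
Definition is_multiplier_image (m : 'rV[R]_n -> 'rV[R[i]]_n) (l : 'I_n)
    (theta u : E -> R) :=
  [/\ locally_square_integrable u, space_periodic u &
      {ae (@lebesgue_measure R), forall t : R, forall k : 'rV[int]_n,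
        fourier (fun x => u (t, x)) k =
        lattice_symbol m k ord0 l * fourier (fun x => theta (t, x)) k}].

Definition bounded_weak_solution (m : 'rV[R]_n -> 'rV[R[i]]_n)
    (theta : E -> R) :=
  [/\ theta \in Lfun mu +oo%E, space_periodic theta &
      exists u : 'I_n -> E -> R,
      [/\ forall l, is_multiplier_image m l theta (u l),
          forall phi, test_function phi ->
            \int[mu]_z (theta z * dt phi z +
                        \sum_l theta z * u l z * dx l phi z) = 0 &
          forall phi, test_function phi ->
            \int[mu]_z (\sum_l u l z * dx l phi z) = 0]].

Definition weak_star_cvg (theta : nat -> E -> R) (f : E -> R) :=
  forall g : E -> R, g \in Lfun mu 1%E -> space_periodic g ->
    \int[mu]_z (theta j z * g z) @[j --> \oo] --> \int[mu]_z (f z * g z).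

End active_scalar.

(* Main.v *)
(** The limit is [f(t, x) = eta'(t) cos(xi0 . x)] for a bump function [eta].  Weak
    solutions [theta_j] converging weak-* to [f] are uniformly bounded, and testing
    the equation with [eta(t) cos(xi0 . x)] gives
      [int theta_j eta' cos(xi0 . x) = int eta(t) Q_j(t) dt],
      [Q_j(t) = int theta_j w_j sin(xi0 . x) dx],  [w_j = xi0 . u_j].
    By hypothesis [w_j] is the image of [theta_j] under a multiplier [i sigma] with
    [sigma] real, so by Parseval [Q_j(t)] is a sum over [k] of [sigma_k - sigma_(k + xi0)]
    times the correlation [a_k a_(k + xi0) + b_k b_(k + xi0)] of the cosine and sine
    coefficients of [theta_j(t)].  As [sigma] is homogeneous of degree [0], the
    differences tend to [0] at infinity, and only finitely many correlations matter.
    The coefficients of [theta_j] are Lipschitz in time uniformly in [j], so they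
    converge for almost every [t] to those of [f(t)], whose correlations at distance
    [xi0] all vanish.  Hence [Q_j -> 0], and in the limit
    [int eta'^2 cos^2(xi0 . x) = 0], which is absurd. *)

Require Import Defs.
From mathcomp Require Import all_boot all_order all_algebra.
From mathcomp Require Import complex.
From mathcomp Require Import all_classical all_reals all_analysis.
From mathcomp Require Import measurable_realfun.
From mathcomp Require Import ring lra zify.

Set Implicit Arguments.
Unset Strict Implicit.
Unset Printing Implicit Defensive.

Import Order.TTheory GRing.Theory Num.Theory.
Import numFieldNormedType.Exports.

Local Open Scope classical_set_scope.
Local Open Scope ring_scope.

(** * Smooth functions *)

(** Weak-* convergence does not pass to the quadratic flux, so compactness must come from elsewhere.
    In space it comes from antisymmetry: with a purely imaginary symbol, exchanging the two copies
    of [theta] turns the flux into differences of [sigma] at neighbouring frequencies; a real part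
    of [xi0 . m] would produce sums of symbols, with no decay. In time it comes from the equation:
    since the multiplier does not preserve boundedness, velocities are controlled only in L^2 of
    each time slice, which still bounds the flux in L^1 of the slice and hence the time derivative
    of every coefficient. The limit being known beforehand, mollification in time gives convergence
    of the whole sequence, with no extraction of subsequences. The time factor of the limit is a
    derivative so that testing against [eta] returns the square of [eta']. Fourier series are
    handled through real cosine and sine coefficients and finite sums. Completeness starts from
    indicators of rays on the circle, spreads by a monotone class argument, and reaches the torus by
    induction on the dimension. *)

Section smooth_calculus.
Context {R : realType} {E : normedModType R}.
Implicit Types (f g : E -> R) (S : set (E -> R)).

(** A single constructor covers sums and multiples; a pure multiple [c f] is obtained as
    [(c - 1) f + f]. *)
Inductive lin_span S : set (E -> R) :=
| lin_span_base f : S f -> lin_span S f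
| lin_span_comb (c : R) f g :
    lin_span S f -> lin_span S g -> lin_span S (fun x => c * f x + g x).

(** If differentiating a generator stays in the span, so do all iterated derivatives, and every
    member of the span is continuous and derivable. Each smoothness proof below thus reduces to
    finding a family closed under one differentiation. *)
Lemma smooth_lin_span S :
  (forall f, S f -> continuous f /\
     forall v, exists2 g, lin_span S g & forall x, is_derive x v f (g x)) ->
  forall f, lin_span S f -> smooth_on setT f.
Proof.
move=> HS.
have Hspan f : lin_span S f -> continuous f /\
     forall v, exists2 g, lin_span S g & forall x, is_derive x v f (g x).
  elim=> {f} [f /HS//|c f g _ [cf df] _ [cg dg]]; split.
    move=> x; apply: cvgD; last exact: cg.
    by apply: cvgM; [exact: cvg_cst|exact: cf].
  move=> v; have [f' Sf' df'] := df v; have [g' Sg' dg'] := dg v.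
  exists (fun x => c * f' x + g' x); first exact: lin_span_comb.
  by move=> x; apply: is_deriveD.
have Hiter vs f : lin_span S f -> lin_span S (iter_derive vs f).
  elim: vs f => // v vs IH f Sf /=.
  have [_ /(_ v)[g Sg dg]] := Hspan _ (IH _ Sf).
  by have -> : 'D_v (iter_derive vs f) = g by apply/funext => x; exact: derive_val.
move=> f Sf vs x _; have [c d] := Hspan _ (Hiter vs f Sf).
split; first exact: c.
by move=> v; have [g _ dg] := d v; exact: ex_derive.
Qed.

Lemma smooth_continuous f : smooth_on setT f -> continuous f.
Proof. by move=> sf x; exact: (sf [::] x I).1. Qed.

Lemma smooth_derivable f : smooth_on setT f -> forall x v, derivable f x v.
Proof. by move=> sf x v; exact: (sf [::] x I).2. Qed.

Lemma smooth_is_derive f : smooth_on setT f ->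
  forall x v, is_derive x v f ('D_v f x).
Proof. by move=> sf x v; apply: derivableP; exact: smooth_derivable. Qed.

Lemma smooth_derive f v : smooth_on setT f -> smooth_on setT ('D_v f).
Proof.
move=> sf vs x _.
have -> : iter_derive vs ('D_v f) = iter_derive (rcons vs v) f.
  by rewrite /iter_derive foldr_rcons.
exact: sf.
Qed.

Lemma smooth_cst (c : R) : smooth_on setT (fun _ : E => c).
Proof.
apply: (@smooth_lin_span [set f | exists c : R, f = fun=> c]).
  move=> _ [d ->]; split; first by move=> x; exact: cvg_cst.
  move=> v; exists (fun=> 0) => [|x]; last exact: is_derive_cst.
  by apply: lin_span_base; exists 0.
by apply: lin_span_base; exists c.
Qed.

Lemma smoothM f g : smooth_on setT f -> smooth_on setT g ->
  smooth_on setT (fun x => f x * g x).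
Proof.
pose S := [set h : E -> R | exists f g, [/\ smooth_on setT f, smooth_on setT g &
                                 h = fun x => f x * g x]].
move=> sf sg; apply: (@smooth_lin_span S); last first.
  by apply: lin_span_base; exists f, g.
move=> _ {f g sf sg} [f [g [sf sg ->]]]; split.
  by move=> x; apply: cvgM; exact: smooth_continuous.
move=> v; exists (fun x => 1 * (f x * 'D_v g x) + g x * 'D_v f x).
  apply: lin_span_comb; apply: lin_span_base.
    by exists f, ('D_v g); split; [exact: sf|exact: (smooth_derive v sg)|by []].
  by exists g, ('D_v f); split; [exact: sg|exact: (smooth_derive v sf)|by []].
move=> x; rewrite mul1r.
have df := smooth_is_derive sf x v; have dg := smooth_is_derive sg x v.
exact: is_deriveM.
Qed.

Lemma smooth_comb c f g : smooth_on setT f -> smooth_on setT g ->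
  smooth_on setT (fun x => c * f x + g x).
Proof.
move=> sf sg; apply: (@smooth_lin_span (smooth_on setT)); last first.
  by apply: lin_span_comb; exact: lin_span_base.
move=> {c g sg f sf} f sf; split; first exact: smooth_continuous.
move=> v; exists ('D_v f); first by apply: lin_span_base; exact: (smooth_derive v sf).
by move=> x; exact: smooth_is_derive.
Qed.

(** Inverses alone are not closed under differentiation; the family [g * f ^- n] with [g] smooth and
    [n] arbitrary is, up to sums. *)
Lemma smoothV f : (forall x, f x != 0) -> smooth_on setT f ->
  smooth_on setT (fun x => (f x)^-1).
Proof.
move=> f0 sf.
pose S := [set h : E -> R | exists g n, smooth_on setT g /\
                                 h = fun x => g x * (f x) ^- n].
apply: (@smooth_lin_span S); last first.
  apply: lin_span_base; exists (fun=> 1), 1%N; split; first exact: smooth_cst.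
  by apply/funext => x; rewrite mul1r.
have cV x : {for x, continuous (fun x => (f x)^-1)}.
  by apply: cvgV => //; exact: smooth_continuous.
have cX n x : {for x, continuous (fun x => (f x)^-n)}.
  elim: n => [|n IH]; first exact: cvg_cst.
  have -> : (fun x => (f x) ^- n.+1) = (fun x => (f x)^-n * (f x)^-1).
    by apply/funext => y; rewrite exprSr invfM.
  by apply: cvgM => //; exact: cV.
move=> _ [g [n [sg ->]]]; split.
  by move=> x; apply: cvgM; [exact: smooth_continuous|exact: cX].
move=> v; exists (fun x => 1 * ('D_v g x * (f x) ^- n) +
                   (- n%:R * (g x * 'D_v f x)) * (f x) ^- n.+1).
  apply: lin_span_comb; apply: lin_span_base.
    by exists ('D_v g), n; split; [exact: (smooth_derive v sg)|by []].
  eexists; exists n.+1; split; last reflexivity.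
  apply: smoothM; first exact: smooth_cst.
  by apply: smoothM; [exact: sg|exact: (smooth_derive v sf)].
move=> x.
have df := smooth_is_derive sf x v; have dg := smooth_is_derive sg x v.
have dfV : is_derive x v (fun x => (f x)^-1) (- (f x) ^- 2 * 'D_v f x).
  by apply: DeriveDef; [exact: derivableV|rewrite deriveV// -mulrA].
have dfX : is_derive x v (fun x => (f x)^-n) (- n%:R * (f x) ^- n.+1 * 'D_v f x).
  have -> : (fun x => (f x) ^- n) = (fun x => (f x)^-1) ^+ n.
    by apply/funext => y; rewrite fctE exprVn.
  case: n => [|n]; first by rewrite mulr0n oppr0 !mul0r expr0; exact: (is_derive_cst (1 : R)).
  have := @is_deriveX _ _ _ n.+1 x v _ dfV.
  congr is_derive.
  rewrite /GRing.scale/=.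
  rewrite exprVn /= !exprS expr0 !invfM invr1.
  set y := 'D_v f x; set n1 := n.+1%:R; set z := (f x)^-n; set u := (f x)^-1.
  by ring.
have := @is_deriveM _ _ _ _ x v _ _ dg dfX.
congr is_derive.
rewrite /GRing.scale/=.
set y := 'D_v f x; set y' := 'D_v g x; set z := (f x)^- n; set u := (f x)^-n.+1.
by ring.
Qed.

End smooth_calculus.

Section smooth_composition.
Context {R : realType} {E E' : normedModType R}.

(** For [l] affine with linear part [L], the difference quotients of [g \o l] along [v] are
    literally those of [g] along [L v], so no chain rule is involved. *)
Lemma smooth_comp_affine (l : E -> E') (L : E -> E') (g : E' -> R) :
  continuous l -> (forall h v z, l (h *: v + z) = h *: L v + l z) ->
  smooth_on setT g -> smooth_on setT (g \o l).
Proof.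
move=> cl lL sg.
apply: (@smooth_lin_span _ _ [set f | exists2 h, smooth_on setT h & f = h \o l]).
  move=> _ {g sg} [g sg ->]; split.
    by move=> x; apply: continuous_comp; [exact: cl|exact: smooth_continuous].
  move=> v; exists ('D_(L v) g \o l).
    by apply: lin_span_base; exists ('D_(L v) g); [exact: (smooth_derive (L v) sg)|by []].
  move=> x; have [dg <-] : is_derive (l x) (L v) g (('D_(L v) g \o l) x).
    exact: smooth_is_derive.
  have H : (fun h : R => h^-1 *: (((g \o l) \o shift x) (h *: v) - (g \o l) x)) =
         (fun h => h^-1 *: ((g \o shift (l x)) (h *: L v) - g (l x))).
    by apply/funext => h /=; rewrite lL.
  by apply: DeriveDef; rewrite /derivable /derive H.
by apply: lin_span_base; exists g.
Qed.

Lemma derive_comp_affine (l : E -> E') (L : E -> E') (g : E' -> R) v x :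
  (forall h v z, l (h *: v + z) = h *: L v + l z) ->
  'D_v (g \o l) x = 'D_(L v) g (l x).
Proof.
move=> lL; rewrite /derive; congr lim; apply: (congr1 (fun F : R -> R => F @ _)).
by apply/funext => h /=; rewrite lL.
Qed.

End smooth_composition.

(** * Smooth functions of one real variable *)

Section smooth_line.
Context {R : realType}.
Implicit Types (f g : R -> R).

Lemma is_derive_dir f x a v : is_derive x (1 : R) f a -> is_derive x v f (v * a).
Proof.
move=> [d1 <-]; have df : differentiable f x by exact/derivable1_diffP.
apply: DeriveDef; first exact: diff_derivable.
by rewrite !deriveE// -[v in LHS]mulr1 -[_ * 1]/(v *: (1 : R)) linearZ.
Qed.

Lemma smooth_lin_span1 (S : set (R -> R)) :
  (forall f, S f -> exists2 g, lin_span S g & forall x : R, is_derive x (1 : R) f (g x)) ->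
  forall f, lin_span S f -> smooth_on setT f.
Proof.
move=> HS; apply: smooth_lin_span => f /HS[g Sg dg]; split.
  move=> x; apply/differentiable_continuous/derivable1_diffP.
  exact: (@ex_derive _ _ _ _ _ _ _ (dg x)).
move=> v; exists (fun x => (v - 1) * g x + g x); first exact: lin_span_comb.
move=> x; have := is_derive_dir v (dg x); congr is_derive.
by rewrite mulrBl mul1r subrK.
Qed.

Lemma derive_dir f v x : smooth_on setT f -> 'D_v f x = v * 'D_1 f x.
Proof.
move=> sf; by case: (is_derive_dir v (smooth_is_derive sf x 1)).
Qed.

Lemma is_derive_cos_shift (c x : R) :
  is_derive x (1 : R) (fun x : R => cos (x + c)) (- sin (x + c)).
Proof.
have -> : (fun x : R => cos (x + c)) = cos \o shift c by apply/funext => y.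
have H := is_derive_cos (x + c).
apply: DeriveDef.
  apply/derivable1_diffP/differentiable_comp; first exact/derivable1_diffP.
  exact/derivable1_diffP.
have : derive1 (cos \o shift c) x = - sin (x + c).
  rewrite derive1_comp//.
  have -> : derive1 (shift c) x = 1.
    rewrite derive1E; exact: (@derive_val _ _ _ _ _ _ _ (is_derive_shift x 1 c)).
  rewrite derive1E mulr1; exact: (@derive_val _ _ _ _ _ _ _ H).
by rewrite derive1E.
Qed.

(** Differentiation shifts the phase by [pi / 2], so the shifted cosines form a closed family by
    themselves. *)
Lemma smooth_cos_shift (b : R) : smooth_on setT (fun x : R => cos (x + b)).
Proof.
apply: (@smooth_lin_span1 [set f : R -> R | exists c, f = fun x : R => cos (x + c)]); last first.
  by apply: lin_span_base; exists b.
move=> _ [c ->]; exists (fun x => cos (x + (c + pi / 2))).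
  by apply: lin_span_base; exists (c + pi / 2).
by move=> x; rewrite addrA cosDpihalf; exact: is_derive_cos_shift.
Qed.

(** The classical flat function exp(-1/t) with the negative powers of [t] that its derivatives
    create, extended by 0 to [t <= 0]. *)
Definition exp_inv_pow (n : nat) (t : R) : R :=
  if 0 < t then t ^- n * expR (- t^-1) else 0.

(** From the single term s^(n+1) / (n+1)! of the exponential series at s = 1/t. The factor [t] that
    remains gives differentiability at 0. *)
Lemma exp_inv_pow_le n t : 0 < t -> exp_inv_pow n t <= n.+1`!%:R * t.
Proof.
move=> t0; rewrite /exp_inv_pow t0.
have s0 : 0 < t^-1 by rewrite invr_gt0.
have := expR_ge1Dxn n (ltW s0).
have H : 0 < expR t^-1 by exact: expR_gt0.
move=> H1; rewrite expRN.
rewrite ler_pdivrMr// -exprVn.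
have H2 : t^-1 ^+ n.+1 / n.+1`!%:R <= expR t^-1 by apply: le_trans H1; rewrite lerDr.
rewrite ler_pdivrMr ?ltr0n ?fact_gt0// in H2.
have -> : t^-1 ^+ n = t * t^-1 ^+ n.+1 by rewrite exprS mulrA divff ?mul1r// gt_eqF.
by rewrite mulrAC [leRHS]mulrC ler_pM2l// (le_trans H2)// mulrC.
Qed.

Lemma is_derive_exp_inv_pow n x :
  is_derive x (1 : R) (exp_inv_pow n)
    (- n%:R * exp_inv_pow n.+1 x + exp_inv_pow n.+2 x).
Proof.
have [x0|x0|->] := ltgtP x 0.
- have -> : - n%:R * exp_inv_pow n.+1 x + exp_inv_pow n.+2 x = 0.
    by rewrite /exp_inv_pow ltNge (ltW x0)/= mulr0 addr0.
  have H : is_derive x (1 : R) (cst 0 : R -> R) 0 by exact: is_derive_cst.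
  apply: (near_eq_is_derive _ H).
  near=> y; rewrite /exp_inv_pow /cst ltNge (_ : y <= 0)//.
  by apply: ltW; near: y; exact: lt_nbhsl.
- have H : is_derive x (1 : R) (fun t => t ^- n * expR (- t^-1))
    (- n%:R * exp_inv_pow n.+1 x + exp_inv_pow n.+2 x).
    have xn0 : x != 0 by rewrite gt_eqF.
    have dV : is_derive x (1 : R) (fun t : R => t^-1) (- x ^- 2).
      apply: DeriveDef; first exact: derivableV.
      by rewrite deriveV// derive_id /GRing.scale/= mulr1.
    have dX : is_derive x (1 : R) (fun t : R => t ^- n) (- n%:R * x ^- n.+1).
      have -> : (fun t : R => t ^- n) = (fun t : R => t^-1) ^+ n.
        by apply/funext => y; rewrite fctE exprVn.
      have := @is_deriveX _ _ _ n x 1 _ dV.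
      congr is_derive; rewrite /GRing.scale/= exprVn.
      case: n => [|n]; first by rewrite !mul0r oppr0 mul0r.
      rewrite /= !exprS expr0 !invfM invr1.
      set z := x^- n; set u := x^-1; set n1 := n.+1%:R : R.
      by ring.
    have dN : is_derive x (1 : R) (fun t : R => - t^-1) (x ^- 2).
      by have := @is_deriveN _ _ _ _ _ _ _ dV; rewrite opprK.
    have dE : is_derive x (1 : R) (fun t : R => expR (- t^-1)) (x ^- 2 * expR (- x^-1)).
      apply: DeriveDef.
        apply/derivable1_diffP/(@differentiable_comp _ _ _ _ (fun t : R => - t^-1) expR).
          by apply/derivable1_diffP; exact: (@ex_derive _ _ _ _ _ _ _ dN).
        exact/derivable1_diffP.
      have : derive1 (expR \o (fun t : R => - t^-1)) x = x ^- 2 * expR (- x^-1).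
        rewrite derive1_comp//.
        rewrite !derive1E (@derive_val _ _ _ _ _ _ _ dN) mulrC.
        congr *%R; exact: derive_val.
      by rewrite derive1E.
    have := @is_deriveM _ _ _ _ x 1 _ _ dX dE.
    congr is_derive; rewrite /GRing.scale/= /exp_inv_pow x0.
    rewrite !exprS expr0 !invfM invr1.
    set e := expR _; set z := x^- n; set u := x^-1.
    by ring.
  apply: (near_eq_is_derive _ H).
  near=> y; rewrite /exp_inv_pow (_ : 0 < y)//.
  by near: y; exact: lt_nbhsr.
- have -> : - n%:R * exp_inv_pow n.+1 0 + exp_inv_pow n.+2 0 = 0 :> R.
    by rewrite /exp_inv_pow ltxx mulr0 addr0.
  have H : (fun h : R => h^-1 *: ((exp_inv_pow n \o shift 0) (h *: 1) - exp_inv_pow n 0))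
     @ 0^' --> (0 : R).
    (* For [h > 0] the quotient is [exp_inv_pow n.+1 h], so the linear bound with index [n.+1]
       applies. *)
    have b (h : R) : `|h^-1 *: ((exp_inv_pow n \o shift 0) (h *: 1) - exp_inv_pow n 0)|
      <= n.+2`!%:R * `|h|.
      rewrite /= addr0 /GRing.scale/= mulr1 {2}/exp_inv_pow ltxx subr0.
      have [h0|h0] := ltP 0 h; last first.
        by rewrite /exp_inv_pow ltNge h0/= mulr0 normr0 mulr_ge0.
      have -> : h^-1 * exp_inv_pow n h = exp_inv_pow n.+1 h.
        by rewrite /exp_inv_pow h0 exprS invfM mulrA.
      rewrite ger0_norm; last first.
        by rewrite /exp_inv_pow h0 mulr_ge0 ?expR_ge0// invr_ge0 exprn_ge0// ltW.
      by rewrite gtr0_norm// exp_inv_pow_le.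
    apply/norm_cvg0P; apply: (@squeeze_cvgr _ _ _ _ (fun=> 0) (fun h => n.+2`!%:R * `|h|)).
    - by near=> h; rewrite normr_ge0 b.
    - exact: cvg_cst.
    - rewrite [X in _ --> X](_ : 0 = n.+2`!%:R * `|0 : R|); last first.
        by rewrite normr0 mulr0.
      by apply: cvgMr; apply: cvg_norm; exact: cvg_within.
  by apply: DeriveDef; [exact: cvgP H|exact: cvg_lim H].
Unshelve. all: by end_near. Qed.

Lemma smooth_exp_inv_pow n : smooth_on setT (exp_inv_pow n).
Proof.
apply: (@smooth_lin_span1 [set f | exists n, f = exp_inv_pow n]); last first.
  by apply: lin_span_base; exists n.
move=> _ {n} [n ->]; eexists; last exact: is_derive_exp_inv_pow.
by apply: lin_span_comb; apply: lin_span_base; eexists.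
Qed.

End smooth_line.

(** * Bump and step functions *)

Section bump.
Context {R : realType}.

Definition exp_inv (t : R) := exp_inv_pow 0 t.

Lemma exp_inv_gt0 t : 0 < t -> 0 < exp_inv t.
Proof. by move=> t0; rewrite /exp_inv /exp_inv_pow t0 expr0 invr1 mul1r expR_gt0. Qed.

Lemma exp_inv_eq0 t : t <= 0 -> exp_inv t = 0.
Proof. by move=> t0; rewrite /exp_inv /exp_inv_pow ltNge t0. Qed.

Lemma exp_inv_ge0 t : 0 <= exp_inv t.
Proof.
by have [/exp_inv_gt0/ltW//|/exp_inv_eq0->] := ltP 0 t.
Qed.

Lemma smooth_affine (g : R -> R) (a b : R) : smooth_on setT g ->
  smooth_on setT (fun t => g (a * t + b)).
Proof.
move=> sg; apply: (@smooth_comp_affine _ _ _ (fun t : R => a * t + b) (fun t : R => a * t)) => //.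
  by move=> x; apply: cvgD; [apply: cvgMr; exact: cvg_id|exact: cvg_cst].
by move=> h v z; rewrite /GRing.scale/= mulrDr mulrCA addrA.
Qed.

Lemma derive_affine (g : R -> R) (a b x : R) : smooth_on setT g ->
  'D_1 (fun t : R => g (a * t + b)) x = a * 'D_1 g (a * x + b).
Proof.
move=> sg.
transitivity ('D_(a * 1) g (a * x + b)); last by rewrite derive_dir// mulr1.
apply: (@derive_comp_affine _ _ _ (fun t : R => a * t + b) (fun t : R => a * t)).
by move=> h v z; rewrite /GRing.scale/= mulrDr mulrCA addrA.
Qed.

Lemma smooth_expD : smooth_on setT (fun t : R => exp_inv (1 + t)).
Proof.
have -> : (fun t : R => exp_inv (1 + t)) = (fun t => exp_inv (1 * t + 1)).
  by apply/funext => t; rewrite mul1r addrC.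
by apply: smooth_affine; exact: smooth_exp_inv_pow.
Qed.

Lemma smooth_expB : smooth_on setT (fun t : R => exp_inv (1 - t)).
Proof.
have -> : (fun t : R => exp_inv (1 - t)) = (fun t => exp_inv (-1 * t + 1)).
  by apply/funext => t; rewrite mulN1r addrC.
by apply: smooth_affine; exact: smooth_exp_inv_pow.
Qed.

Definition bumpR (t : R) := exp_inv (1 + t) * exp_inv (1 - t).

Lemma smooth_bumpR : smooth_on setT bumpR.
Proof. exact: smoothM smooth_expD smooth_expB. Qed.

Lemma bumpR0_gt0 : 0 < bumpR 0.
Proof. by rewrite /bumpR addr0 subr0 mulr_gt0// exp_inv_gt0. Qed.

Lemma bumpR_eq0 t : 1 <= `|t| -> bumpR t = 0.
Proof.
move=> t1; rewrite /bumpR; have [t0|t0] := leP 0 t.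
  rewrite ger0_norm// in t1.
  by rewrite [X in _ * X]exp_inv_eq0 ?mulr0// subr_le0.
rewrite ltr0_norm// in t1.
rewrite [X in X * _]exp_inv_eq0 ?mul0r//; lra.
Qed.

Let expS_gt0 (t : R) : 0 < exp_inv (1 + t) + exp_inv (1 - t).
Proof.
have [t0|t0] := leP 0 t.
  by apply: ltr_pwDl; [apply: exp_inv_gt0; lra|exact: exp_inv_ge0].
by apply: ltr_wpDl; [exact: exp_inv_ge0|apply: exp_inv_gt0; lra].
Qed.

(** A smooth passage from 0 to 1 across [-1, 1]. Its derivative will be the mollifying kernel: its
    total mass is 1 by the fundamental theorem of calculus, so no normalising constant has to be
    computed. *)
Definition stepR (t : R) := exp_inv (1 + t) / (exp_inv (1 + t) + exp_inv (1 - t)).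

Lemma smooth_stepR : smooth_on setT stepR.
Proof.
apply: smoothM smooth_expD _; apply: smoothV.
  by move=> t; rewrite gt_eqF.
have -> : (fun t : R => exp_inv (1 + t) + exp_inv (1 - t)) =
          (fun t : R => 1 * exp_inv (1 + t) + exp_inv (1 - t)).
  by apply/funext => t; rewrite mul1r.
exact: smooth_comb smooth_expD smooth_expB.
Qed.

Lemma stepR_ge0 t : 0 <= stepR t.
Proof. by rewrite divr_ge0 ?exp_inv_ge0// ltW. Qed.

Lemma stepR_le1 t : stepR t <= 1.
Proof. by rewrite ler_pdivrMr// mul1r lerDl exp_inv_ge0. Qed.

Lemma stepR_eq0 t : t <= -1 -> stepR t = 0.
Proof. by move=> t1; rewrite /stepR exp_inv_eq0 ?mul0r//; lra. Qed.

Lemma stepR_eq1 t : 1 <= t -> stepR t = 1.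
Proof.
move=> t1; rewrite /stepR [exp_inv (1 - t)]exp_inv_eq0; last lra.
by rewrite addr0 divff// gt_eqF// exp_inv_gt0//; lra.
Qed.

Lemma derive_eq0_outside (f : R -> R) (c : R) (I : set R) x :
  open I -> I x -> (forall y, I y -> f y = c) -> 'D_1 f x = 0.
Proof.
move=> oI Ix fI; rewrite -[RHS](@derive_cst R R R c x 1).
apply: near_eq_derive; near=> y; apply: fI; near: y.
exact: open_nbhs_nbhs.
Unshelve. all: by end_near. Qed.

End bump.

(** * Plane waves as test functions *)

Section test_functions.
Context {R : realType} {n : nat}.
Local Notation E := (R * 'rV[R]_n)%type.
Implicit Types (g : R -> R) (k : 'rV[int]_n).

Lemma dotvDr (K : pzRingType) p (x y z : 'rV[K]_p) : dotv x (y + z) = dotv x y + dotv x z.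
Proof.
by rewrite /dotv -big_split; apply: eq_bigr => l _; rewrite mxE mulrDr.
Qed.

Lemma dotvZr (K : comPzRingType) p (a : K) (x y : 'rV[K]_p) : dotv x (a *: y) = a * dotv x y.
Proof.
by rewrite /dotv mulr_sumr; apply: eq_bigr => l _; rewrite mxE mulrCA.
Qed.

Lemma dotv_continuous (y : 'rV[R]_n) : continuous (dotv y).
Proof.
apply: (@continuous_big _ _ +%R 0 xpredT _ _ _ (fun (l : 'I_n) (x : 'rV[R]_n) => y ord0 l * x ord0 l)).
  exact: add_continuous.
by move=> l _ z; apply: continuousM; [exact: cst_continuous|exact: coord_continuous].
Qed.

(** The phase [b] covers cosines ([b = 0]) and sines ([b = - (pi / 2)]) at once. *)
Definition wave g k b (z : E) : R := g z.1 * cos (dotv (freq k) z.2 + b).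

Let affine_dot k h (v z : E) :
  dotv (freq k) (h *: v + z).2 = h *: dotv (freq k) v.2 + dotv (freq k) z.2 :> R.
Proof. by rewrite /= dotvDr dotvZr. Qed.

Let smooth_fst g : smooth_on setT g -> smooth_on setT (fun z : E => g z.1).
Proof.
by move=> sg; apply: (@smooth_comp_affine _ _ _ fst fst) => // z; exact: cvg_fst.
Qed.

Let smooth_cos k b : smooth_on setT (fun z : E => cos (dotv (freq k) z.2 + b)).
Proof.
apply: (@smooth_comp_affine _ _ _ (fun z : E => dotv (freq k) z.2)
  (fun z : E => dotv (freq k) z.2) (fun x : R => cos (x + b))).
- move=> z; apply: (@continuous_comp _ _ _ snd (dotv (freq k))); first exact: cvg_snd.
  exact: dotv_continuous.
- exact: affine_dot.
- exact: smooth_cos_shift.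
Qed.

Lemma wave_smooth g k b : smooth_on setT g -> smooth_on setT (wave g k b).
Proof. by move=> sg; apply: smoothM; [exact: smooth_fst|exact: smooth_cos]. Qed.

Lemma derive_wave g k b v : smooth_on setT g ->
  'D_v (wave g k b) = fun z => v.1 * 'D_1 g z.1 * cos (dotv (freq k) z.2 + b) -
                    dotv (freq k) v.2 * (g z.1 * sin (dotv (freq k) z.2 + b)).
Proof.
move=> sg; apply/funext => z.
have d1 : is_derive z v (fun z : E => g z.1) (v.1 * 'D_1 g z.1).
  have := smooth_is_derive (smooth_fst sg) z v; congr is_derive.
  transitivity ('D_v.1 g z.1); last by rewrite derive_dir.
  exact: (@derive_comp_affine _ _ _ fst fst).
have d2 : is_derive z v (fun z : E => cos (dotv (freq k) z.2 + b))
    (- (dotv (freq k) v.2 * sin (dotv (freq k) z.2 + b))).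
  have := smooth_is_derive (smooth_cos k b) z v; congr is_derive.
  transitivity ('D_(dotv (freq k) v.2) (fun x : R => cos (x + b)) (dotv (freq k) z.2)).
    exact: (@derive_comp_affine _ _ _ (fun z : E => dotv (freq k) z.2)
      (fun z : E => dotv (freq k) z.2) (fun x : R => cos (x + b)) v z (affine_dot k)).
  rewrite (derive_dir _ _ (smooth_cos_shift b)) -mulrN; congr *%R.
  exact: (@derive_val _ _ _ _ _ _ _ (is_derive_cos_shift b _)).
have [_ ->] := @is_deriveM _ _ _ _ _ _ _ _ d1 d2.
rewrite /GRing.scale/=.
set C := cos _; set S := sin _; set G := 'D_1 g _; set D := dotv _ v.2.
ring.
Qed.

Lemma cos_periodic_int (x : R) (j : int) : cos (x + 2 * pi * j%:~R) = cos x.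
Proof.
have P (m : nat) y : cos (y + 2 * pi * m%:R) = cos y :> R.
  rewrite mulr_natr [2 * pi]mulr_natl.
  by apply: periodicn; exact: cosD2pi.
case: j => m; first exact: P.
by rewrite NegzE mulrNz mulrN -{2}(subrK (2 * pi * m.+1%:R) x) P.
Qed.

Lemma wave_periodic g k b : space_periodic (wave g k b).
Proof.
move=> z q; rewrite /wave /= dotvDr dotvZr.
have -> : dotv (freq k) (freq q) = (dotv k q)%:~R :> R.
  rewrite /dotv rmorph_sum; apply: eq_bigr => l _.
  by rewrite !mxE rmorphM.
by rewrite addrAC cos_periodic_int.
Qed.

Lemma wave_test g k b A : smooth_on setT g -> (forall t, A < `|t| -> g t = 0) ->
  test_function (wave g k b).
Proof.
move=> sg gA; split; [exact: wave_smooth|exact: wave_periodic|].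
by exists A => t x tA; rewrite /wave/= gA// mul0r.
Qed.

Lemma dt_wave g k b : smooth_on setT g -> dt (wave g k b) = wave ('D_1 g) k b.
Proof.
move=> sg; rewrite /dt derive_wave//; apply/funext => z; rewrite /wave /= mul1r.
suff -> : dotv (freq k) 0 = 0 :> R by rewrite mul0r subr0.
by rewrite /dotv big1// => l _; rewrite [in X in _ * X]mxE mulr0.
Qed.

Lemma dx_wave g k b l : smooth_on setT g ->
  dx l (wave g k b) = fun z => - (k ord0 l)%:~R * (g z.1 * sin (dotv (freq k) z.2 + b)).
Proof.
move=> sg; rewrite /dx derive_wave//; apply/funext => z; rewrite /= !mul0r sub0r mulNr.
congr (- (_ * _)).
rewrite /dotv (bigD1 l)//= big1 ?addr0.
  by rewrite !mxE !eqxx mulr1.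
by move=> j jl; rewrite !mxE (negbTE jl) andbF mulr0.
Qed.

End test_functions.

(** * Real-valued integrals *)

Notation rintegrable mu f := (mu.-integrable setT (EFin \o (f : _ -> _))).

Section real_integrals.
Context {d} {T : measurableType d} {R : realType}.
Variable mu : {measure set T -> \bar R}.
Implicit Types f g : T -> R.

Lemma rintegrable_measurable f : rintegrable mu f -> measurable_fun setT f.
Proof. by move=> /integrableP[/measurable_EFinP]. Qed.

Lemma rintegrableD f g : rintegrable mu f -> rintegrable mu g ->
  rintegrable mu (fun x => f x + g x).
Proof. by move=> fi gi; exact: (integrableD measurableT fi gi). Qed.

Lemma rintegrableB f g : rintegrable mu f -> rintegrable mu g ->
  rintegrable mu (fun x => f x - g x).
Proof. by move=> fi gi; exact: (integrableB measurableT fi gi). Qed.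

Lemma rintegrableZ c f : rintegrable mu f -> rintegrable mu (fun x => c * f x).
Proof. by move=> fi; exact: (integrableZl measurableT c fi). Qed.

Lemma rintegrable_sum I (s : seq I) (h : I -> T -> R) :
  (forall i, rintegrable mu (h i)) -> rintegrable mu (fun x => \sum_(i <- s) h i x).
Proof.
move=> hi.
have -> : EFin \o (fun x => \sum_(i <- s) h i x) = (fun x => \sum_(i <- s) (EFin \o h i) x)%E.
  by apply/funext => x /=; rewrite sumEFin.
exact: integrable_sum.
Qed.

Lemma rintegrable_le f g : measurable_fun setT f -> (forall x, `|f x| <= g x) ->
  rintegrable mu g -> rintegrable mu f.
Proof.
move=> mf fg gi; apply: (le_integrable measurableT _ _ gi); first exact/measurable_EFinP.
by move=> x _ /=; rewrite lee_fin (le_trans (fg x))// ler_norm.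
Qed.

Lemma Rintegral_sum I (s : seq I) (h : I -> T -> R) :
  (forall i, rintegrable mu (h i)) ->
  \int[mu]_x (\sum_(i <- s) h i x) = \sum_(i <- s) \int[mu]_x h i x.
Proof.
move=> hi; elim: s => [|i s IH].
  under eq_Rintegral do rewrite big_nil.
  by rewrite big_nil Rintegral_cst// mul0r.
under eq_Rintegral do rewrite big_cons.
by rewrite big_cons RintegralD ?IH//; exact: rintegrable_sum.
Qed.

Lemma Rintegral_ae_eq f g : measurable_fun setT f -> measurable_fun setT g ->
  {ae mu, forall x, f x = g x} -> \int[mu]_x f x = \int[mu]_x g x.
Proof.
move=> mf mg fg; congr fine; apply: ae_eq_integral => //; try exact/measurable_EFinP.
by apply: filterS fg => x /= -> _.
Qed.

Lemma Rintegral_dominated (f_ : nat -> T -> R) f g :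
  (forall n, measurable_fun setT (f_ n)) -> measurable_fun setT f ->
  {ae mu, forall x, f_ n x @[n --> \oo] --> f x} ->
  rintegrable mu g -> {ae mu, forall x, forall n, `|f_ n x| <= g x} ->
  \int[mu]_x f_ n x @[n --> \oo] --> \int[mu]_x f x.
Proof.
move=> mf_ mf cf gi fg.
have [|||//||fi _ H] := @dominated_convergence _ T R mu setT measurableT
    (fun n => EFin \o f_ n) (EFin \o f) (EFin \o g).
- by move=> n; exact/measurable_EFinP.
- exact/measurable_EFinP.
- by apply: filterS cf => x cx _; apply: cvg_EFin => //; exact: nearW.
- by apply: filterS fg => x cx n _; rewrite /= lee_fin.
apply: fine_cvg; rewrite fineK//.
by apply: integrable_fin_num.
Qed.

End real_integrals.

Section square_integrable.
Context {d} {T : measurableType d} {R : realType}.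
Variable mu : {finite_measure set T -> \bar R}.
Implicit Types f g : T -> R.

Definition sqint f := measurable_fun setT f /\ rintegrable mu (fun x => f x ^+ 2).

Lemma rintegrable_bounded f c : measurable_fun setT f -> (forall x, `|f x| <= c) ->
  rintegrable mu f.
Proof.
move=> mf fc; apply: (rintegrable_le mf fc).
exact: finite_measure_integrable_cst.
Qed.

Lemma sqintM f g : sqint f -> sqint g -> rintegrable mu (fun x => f x * g x).
Proof.
move=> [mf fi] [mg gi]; apply: (@rintegrable_le _ _ _ _ _ (fun x => f x ^+ 2 + g x ^+ 2)).
- exact: measurable_funM.
- move=> x; rewrite ler_norml; apply/andP; split.
    have := sqr_ge0 (f x + g x); have := sqr_ge0 (f x); have := sqr_ge0 (g x); nra.
  have := sqr_ge0 (f x - g x); have := sqr_ge0 (f x); have := sqr_ge0 (g x); nra.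
- exact: rintegrableD.
Qed.

Lemma sqint_bounded f c : measurable_fun setT f -> (forall x, `|f x| <= c) -> sqint f.
Proof.
move=> mf fc; split=> //; apply: (@rintegrable_bounded _ (c ^+ 2)).
  exact: measurable_funX.
by move=> x; rewrite normrX lerXn2r// ?nnegrE// (le_trans _ (fc x)).
Qed.

Lemma sqint_cst c : sqint (fun=> c).
Proof. by apply: (@sqint_bounded _ `|c|). Qed.

Lemma sqint_rintegrable f : sqint f -> rintegrable mu f.
Proof.
move=> sf; have := sqintM sf (sqint_cst 1).
by under eq_fun do rewrite mulr1.
Qed.

Lemma sqintD f g : sqint f -> sqint g -> sqint (fun x => f x + g x).
Proof.
move=> sf sg; have [[mf fi] [mg gi]] := (sf, sg).
split; first exact: measurable_funD.
have -> : (fun x => (f x + g x) ^+ 2) =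
          (fun x => (f x ^+ 2 + 2 * (f x * g x)) + g x ^+ 2).
  by apply/funext => x; ring.
by apply: rintegrableD => //; apply: rintegrableD => //; apply: rintegrableZ; exact: sqintM.
Qed.

Lemma sqintZ c f : sqint f -> sqint (fun x => c * f x).
Proof.
move=> [mf fi]; split; first exact: measurable_funM.
by under eq_fun do rewrite exprMn; exact: rintegrableZ.
Qed.

Lemma sqintB f g : sqint f -> sqint g -> sqint (fun x => f x - g x).
Proof.
move=> sf sg; have := sqintD sf (sqintZ (-1) sg).
by under eq_fun do rewrite mulN1r.
Qed.

Lemma sqint_sum I (s : seq I) (h : I -> T -> R) :
  (forall i, sqint (h i)) -> sqint (fun x => \sum_(i <- s) h i x).
Proof.
move=> hi; elim: s => [|i s IH].
  by under eq_fun do rewrite big_nil; exact: sqint_cst.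
by under eq_fun do rewrite big_cons; exact: sqintD.
Qed.

Lemma sqint_le f g : measurable_fun setT f -> (forall x, `|f x| <= `|g x|) ->
  sqint g -> sqint f.
Proof.
move=> mf fg [mg gi]; split => //; apply: (rintegrable_le _ _ gi).
  exact: measurable_funX.
by move=> x; rewrite normrX -[g x ^+ 2](real_normK (num_real (g x))) lerXn2r// nnegrE.
Qed.

End square_integrable.

Section measurable_trigonometry.
Context {d} {T : measurableType d} {R : realType}.
Implicit Types f : T -> R.

Lemma measurable_cos f : measurable_fun setT f -> measurable_fun setT (fun x => cos (f x)).
Proof.
move=> mf; apply: measurableT_comp mf.
by apply: continuous_measurable_fun; exact: continuous_cos.
Qed.

Lemma measurable_sin f : measurable_fun setT f -> measurable_fun setT (fun x => sin (f x)).
Proof.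
move=> mf; apply: measurableT_comp mf.
by apply: continuous_measurable_fun; exact: continuous_sin.
Qed.

Variable mu : {finite_measure set T -> \bar R}.

Lemma sqint_cos f : measurable_fun setT f -> sqint mu (fun x => cos (f x)).
Proof.
move=> /measurable_cos mf; apply: (sqint_bounded mu mf) => x; exact: cos_max.
Qed.

Lemma sqint_sin f : measurable_fun setT f -> sqint mu (fun x => sin (f x)).
Proof.
move=> /measurable_sin mf; apply: (sqint_bounded mu mf) => x; exact: sin_max.
Qed.

End measurable_trigonometry.

(** * Bessel and Parseval for systems of phases *)

Section phases.
Context {d} {T : measurableType d} {R : realType}.
Variable mu : {finite_measure set T -> \bar R}.
Variables (K : eqType) (phi : K -> T -> R).
Implicit Types (v w : T -> R) (F : seq K).

Definition cosc v k := \int[mu]_x (v x * cos (phi k x)).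
Definition sinc v k := \int[mu]_x (v x * sin (phi k x)).
Definition mass := fine (mu setT).

(* The defect of Parseval's identity on a finite set of frequencies. *)
Definition defect F v w := \int[mu]_x (v x * w x) -
  mass^-1 * \sum_(k <- F) (cosc v k * cosc w k + sinc v k * sinc w k).

(** Orthogonality of the exponentials exp(i phi_k) in real form: the cosine and sine of
    [phi k - phi l] are the real and imaginary parts of exp(i phi_k) times the conjugate of exp(i
    phi_l). Phrased with products of cosines it would also involve [phi k + phi l]. *)
Definition orthogonal_phases := [/\ 0 < mass, forall k, measurable_fun setT (phi k),
  forall k l, \int[mu]_x cos (phi k x - phi l x) = if k == l then mass else 0 &
  forall k l, \int[mu]_x sin (phi k x - phi l x) = 0].

Hypothesis ophi : orthogonal_phases.

Let mphi k : measurable_fun setT (phi k). Proof. by case: ophi. Qed.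
Let mass_gt0 : 0 < mass. Proof. by case: ophi. Qed.

Let sq_cos k : sqint mu (fun x => cos (phi k x)). Proof. exact: sqint_cos. Qed.
Let sq_sin k : sqint mu (fun x => sin (phi k x)). Proof. exact: sqint_sin. Qed.

Lemma coscD v w k : sqint mu v -> sqint mu w ->
  cosc (fun x => v x + w x) k = cosc v k + cosc w k.
Proof.
move=> sv sw; rewrite /cosc -RintegralD//; try exact: sqintM.
by apply: eq_Rintegral => x _; rewrite mulrDl.
Qed.

Lemma sincD v w k : sqint mu v -> sqint mu w ->
  sinc (fun x => v x + w x) k = sinc v k + sinc w k.
Proof.
move=> sv sw; rewrite /sinc -RintegralD//; try exact: sqintM.
by apply: eq_Rintegral => x _; rewrite mulrDl.
Qed.

Lemma coscZ c v k : sqint mu v -> cosc (fun x => c * v x) k = c * cosc v k.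
Proof.
move=> sv; rewrite /cosc -RintegralZl//; last exact: sqintM.
by apply: eq_Rintegral => x _; rewrite mulrA.
Qed.

Lemma sincZ c v k : sqint mu v -> sinc (fun x => c * v x) k = c * sinc v k.
Proof.
move=> sv; rewrite /sinc -RintegralZl//; last exact: sqintM.
by apply: eq_Rintegral => x _; rewrite mulrA.
Qed.

Lemma defectC F v w : defect F v w = defect F w v.
Proof.
rewrite /defect; congr (_ - _ * _).
  by apply: eq_Rintegral => x _; rewrite mulrC.
by apply: eq_bigr => k _; ring.
Qed.

Lemma defectDl F v1 v2 w : sqint mu v1 -> sqint mu v2 -> sqint mu w ->
  defect F (fun x => v1 x + v2 x) w = defect F v1 w + defect F v2 w.
Proof.
move=> s1 s2 sw; rewrite /defect.
have -> : \int[mu]_x ((v1 x + v2 x) * w x) = \int[mu]_x (v1 x * w x) + \int[mu]_x (v2 x * w x).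
  rewrite -RintegralD//; try exact: sqintM.
  by apply: eq_Rintegral => x _; rewrite mulrDl.
rewrite addrACA -opprD -mulrDr -big_split; congr (_ - _ * _).
by apply: eq_bigr => k _; rewrite coscD// sincD//=; ring.
Qed.

Lemma defectZl F c v w : sqint mu v -> sqint mu w ->
  defect F (fun x => c * v x) w = c * defect F v w.
Proof.
move=> sv sw; rewrite /defect mulrBr [c * (_ * _)]mulrCA [c * \sum_(_ <- _) _]mulr_sumr.
congr (_ - _ * _).
  rewrite -RintegralZl//; last exact: sqintM.
  by apply: eq_Rintegral => x _; rewrite mulrA.
by apply: eq_bigr => k _; rewrite coscZ// sincZ//=; ring.
Qed.

Lemma defect_comb F c v w : sqint mu v -> sqint mu w ->
  defect F (fun x => v x + c * w x) (fun x => v x + c * w x) =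
  defect F v v + 2 * c * defect F v w + c ^+ 2 * defect F w w.
Proof.
move=> sv sw; have scw := sqintZ c sw; have svw := sqintD sv scw.
rewrite defectDl// [defect _ v _]defectC [defect _ (fun=> c * _) _]defectC.
rewrite !defectDl// ![defect _ _ (fun=> c * _)]defectC !defectZl//.
have -> : defect F w (fun x => c * w x) = c * defect F w w by rewrite defectC defectZl.
by rewrite [defect F w v]defectC; ring.
Qed.

Lemma bessel F v : uniq F -> sqint mu v -> 0 <= defect F v v.
Proof.
move=> uF sv.
pose a := cosc v; pose b := sinc v; pose S := \sum_(k <- F) (a k * a k + b k * b k).
(* [P + i Q] is the orthogonal projection of [v] on the span of exp(i phi_k), [k] in [F]. As [F]
   need not be symmetric, the imaginary part [Q] may be nonzero. The integral of the squared modulus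
   of [v - P - i Q] is the defect. *)
pose P x := mass^-1 * \sum_(k <- F) (a k * cos (phi k x) + b k * sin (phi k x)).
pose Q x := mass^-1 * \sum_(k <- F) (a k * sin (phi k x) - b k * cos (phi k x)).
have scs (c e : K -> R) k : sqint mu (fun x => c k * cos (phi k x) + e k * sin (phi k x)).
  by apply: sqintD; exact: sqintZ.
have sP : sqint mu P by apply: sqintZ; apply: sqint_sum.
have sQ : sqint mu Q.
  by apply: sqintZ; apply: sqint_sum => k; apply: sqintB; exact: sqintZ.
have vP : \int[mu]_x (v x * P x) = mass^-1 * S.
  transitivity (\int[mu]_x (mass^-1 * \sum_(k <- F) (a k * (v x * cos (phi k x)) + b k * (v x * sin (phi k x))))).
    apply: eq_Rintegral => x _; rewrite mulrCA; congr (_ * _); rewrite mulr_sumr.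
    by apply: eq_bigr => k _; ring.
  have I1 k : rintegrable mu (fun x => a k * (v x * cos (phi k x))).
    by apply: rintegrableZ; exact: sqintM.
  have I2 k : rintegrable mu (fun x => b k * (v x * sin (phi k x))).
    by apply: rintegrableZ; exact: sqintM.
  rewrite RintegralZl//; last by apply: rintegrable_sum => k; exact: rintegrableD.
  rewrite Rintegral_sum; last by move=> k; exact: rintegrableD.
  congr (_ * _); apply: eq_bigr => k _.
  by rewrite RintegralD// !RintegralZl//; exact: sqintM.
have mphiB k l : measurable_fun setT (fun x => phi k x - phi l x).
  by apply: measurable_funB.
have Ic k l : rintegrable mu (fun x => cos (phi k x - phi l x)).
  exact: sqint_rintegrable (sqint_cos mu (mphiB k l)).
have Is k l : rintegrable mu (fun x => sin (phi k x - phi l x)).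
  exact: sqint_rintegrable (sqint_sin mu (mphiB k l)).
have PQ : \int[mu]_x (P x ^+ 2 + Q x ^+ 2) = mass^-1 * S.
  transitivity (\int[mu]_x (mass^-2 * \sum_(k <- F) \sum_(l <- F)
      ((a k * a l + b k * b l) * cos (phi k x - phi l x) +
       (b k * a l - a k * b l) * sin (phi k x - phi l x)))).
    apply: eq_Rintegral => x _; rewrite /P /Q !exprMn -mulrDr exprVn; congr (_ * _).
    rewrite !expr2 !mulr_suml -big_split; apply: eq_bigr => k _ /=.
    rewrite !mulr_sumr -big_split; apply: eq_bigr => l _ /=.
    by rewrite cosB sinB; ring.
  have I1 k l : rintegrable mu (fun x => (a k * a l + b k * b l) * cos (phi k x - phi l x)).
    exact: rintegrableZ.
  have I2 k l : rintegrable mu (fun x => (b k * a l - a k * b l) * sin (phi k x - phi l x)).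
    exact: rintegrableZ.
  rewrite RintegralZl//; last first.
    by do 2 (apply: rintegrable_sum => ?); exact: rintegrableD.
  rewrite Rintegral_sum; last first.
    by move=> k; apply: rintegrable_sum => l; exact: rintegrableD.
  rewrite expr2 invfM -mulrA; congr (_ * _); rewrite mulr_sumr; rewrite big_seq [RHS]big_seq.
  apply: eq_bigr => k kF; rewrite Rintegral_sum; last by move=> l; exact: rintegrableD.
  case: ophi => _ _ oc os.
  rewrite (bigD1_seq k)//= [X in _ + X]big1 ?addr0; last first.
    move=> l lk; rewrite RintegralD// !RintegralZl// oc os eq_sym (negbTE lk).
    by rewrite !mulr0 addr0.
  rewrite RintegralD// !RintegralZl// oc os eqxx mulr0 addr0 mulrC -mulrA divff ?mulr1//.
  by rewrite gt_eqF.
have : 0 <= \int[mu]_x ((v x - P x) ^+ 2 + Q x ^+ 2).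
  by apply: Rintegral_ge0 => x _; rewrite addr_ge0 ?sqr_ge0.
have -> : \int[mu]_x ((v x - P x) ^+ 2 + Q x ^+ 2) =
  \int[mu]_x ((v x * v x - 2 * (v x * P x)) + (P x ^+ 2 + Q x ^+ 2)).
  by apply: eq_Rintegral => x _; ring.
have IvP : rintegrable mu (fun x => 2 * (v x * P x)).
  by apply: rintegrableZ; exact: sqintM.
rewrite RintegralD//; last 2 first.
- by apply: rintegrableB => //; exact: sqintM.
- by apply: rintegrableD; [case: sP|case: sQ].
rewrite RintegralB//; last exact: sqintM.
rewrite RintegralZl//; last exact: sqintM.
by rewrite vP PQ /defect -/a -/b -/S; set m := mass^-1; set X := \int[_]_x _; lra.
Qed.

Lemma defect_antitone F F' v : uniq F -> uniq F' -> {subset F <= F'} ->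
  defect F' v v <= defect F v v.
Proof.
move=> uF uF' FF'; rewrite /defect lerD2l lerN2 ler_pM2l ?invr_gt0//.
have p : perm_eq F' (F ++ [seq k <- F' | k \notin F]).
  apply: uniq_perm => //.
    rewrite cat_uniq uF filter_uniq// andbT.
    by apply/hasPn => k; rewrite mem_filter => /andP[].
  move=> k; rewrite mem_cat mem_filter; have [/FF'->//|/=] := boolP (k \in F).
  by [].
rewrite (perm_big _ p) big_cat/= lerDl sumr_ge0// => k _.
by rewrite -!expr2 addr_ge0 ?sqr_ge0.
Qed.

(** Bessel's inequality makes the defect a positive semidefinite quadratic form; this is its
    parallelogram law with the term of [v - w] dropped. *)
Lemma defectD_le F v w : uniq F -> sqint mu v -> sqint mu w ->
  defect F (fun x => v x + w x) (fun x => v x + w x) <=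
  2 * defect F v v + 2 * defect F w w.
Proof.
move=> uF sv sw.
have := defect_comb F 1 sv sw; have := defect_comb F (-1) sv sw.
have := bessel uF (sqintD sv (sqintZ (-1) sw)).
have -> : (fun x => v x + 1 * w x) = (fun x => v x + w x).
  by apply/funext => x; rewrite mul1r.
by move=> H E1 ->; rewrite E1 in H; nra.
Qed.

(** Semidefiniteness at [v + w] and [v - w]. It lets Parseval for two functions follow from Parseval
    for each. *)
Lemma defect_polar F v w : uniq F -> sqint mu v -> sqint mu w ->
  `|defect F v w| <= defect F v v + defect F w w.
Proof.
move=> uF sv sw.
have := defect_comb F 1 sv sw; have := defect_comb F (-1) sv sw.
have := bessel uF (sqintD sv (sqintZ (-1) sw)); have := bessel uF (sqintD sv (sqintZ 1 sw)).
have := bessel uF sv; have := bessel uF sw.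
move=> v0 w0 H1 H2 E1 E2; rewrite E1 in H2; rewrite E2 in H1.
by rewrite ler_norml; apply/andP; split; nra.
Qed.

(** Parseval's identity without infinite sums: the defect decreases as [F] grows, so one good finite
    set suffices for each tolerance and every larger set is as good. *)
Definition parseval_fun v := sqint mu v /\
  forall e, 0 < e -> exists2 F, uniq F & defect F v v <= e.

Definition complete_phases := forall v, sqint mu v -> parseval_fun v.

Lemma parseval_fun_comb c v w : parseval_fun v -> parseval_fun w ->
  parseval_fun (fun x => c * v x + w x).
Proof.
move=> [sv pv] [sw pw]; split; first exact/sqintD/sw/sqintZ.
(* Chosen so that [2 c^2 e1 + 2 e1 = e], the bound given by [defectD_le] on a common set of
   frequencies. *)
move=> e e0; pose e1 := e / (2 * (c ^+ 2 + 1)).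
have e10 : 0 < e1 by rewrite divr_gt0// mulr_gt0// ltr_wpDl// sqr_ge0.
have [F1 u1 d1] := pv _ e10; have [F2 u2 d2] := pw _ e10.
exists (undup (F1 ++ F2)); first exact: undup_uniq.
have uF := undup_uniq (F1 ++ F2); set F := undup _ in uF *.
have {}d1 : defect F v v <= e1.
  apply: le_trans d1; apply: defect_antitone => // k kF.
  by rewrite mem_undup mem_cat kF.
have {}d2 : defect F w w <= e1.
  apply: le_trans d2; apply: defect_antitone => // k kF.
  by rewrite mem_undup mem_cat kF orbT.
apply: le_trans (defectD_le uF (sqintZ c sv) sw) _.
rewrite defectZl// ?[defect _ v _]defectC ?defectZl//; last exact: sqintZ.
have -> : e = 2 * (c * (c * e1)) + 2 * e1.
  rewrite /e1; field; apply/eqP; have := sqr_ge0 c; lra.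
by move: (ler_wpM2l (sqr_ge0 c) d1); rewrite expr2; lra.
Qed.

(** The defect of [v - w] is at most its squared L^2 norm, so the Parseval property is closed in
    L^2. *)
Lemma parseval_fun_lim v : sqint mu v ->
  (forall e, 0 < e -> exists2 w, parseval_fun w & \int[mu]_x (v x - w x) ^+ 2 <= e) ->
  parseval_fun v.
Proof.
move=> sv H; split=> // e e0.
have e40 : 0 < e / 4 by rewrite divr_gt0.
have [w [sw pw] vw] := H _ e40.
have [F uF dF] := pw _ e40; exists F => //.
have := defectD_le uF (sqintB sv sw) sw.
have -> : (fun x => v x - w x + w x) = v by apply/funext => x; rewrite subrK.
move=> /le_trans; apply.
have : defect F (fun x => v x - w x) (fun x => v x - w x) <= e / 4.
  apply: le_trans vw; rewrite /defect lerBlDr -lerBlDl.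
  have -> : \int[mu]_x ((v x - w x) * (v x - w x)) = \int[mu]_x (v x - w x) ^+ 2.
    by apply: eq_Rintegral => x _; rewrite expr2.
  rewrite subrr mulr_ge0 ?invr_ge0 ?(ltW mass_gt0)// sumr_ge0// => k _.
  by rewrite -!expr2 addr_ge0 ?sqr_ge0.
lra.
Qed.

Lemma parseval_fun_cvg v (w_ : nat -> T -> R) g : sqint mu v ->
  (forall n, parseval_fun (w_ n)) -> {ae mu, forall x, w_ n x @[n --> \oo] --> v x} ->
  rintegrable mu g -> {ae mu, forall x n, (v x - w_ n x) ^+ 2 <= g x} ->
  parseval_fun v.
Proof.
move=> sv pw wv gi vg; apply: parseval_fun_lim => // e e0.
have [mv _] := sv.
have mw n : measurable_fun setT (w_ n) by case: (pw n) => -[].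
have : \int[mu]_x (v x - w_ n x) ^+ 2 @[n --> \oo] --> \int[mu]_x (0 : R).
  apply: (Rintegral_dominated (g := g)) => //.
  - by move=> n; apply: measurable_funX; exact: measurable_funB.
  - apply: filterS wv => x wvx.
    rewrite [X in _ --> X](_ : 0 = (v x - v x) ^+ 2); last by rewrite subrr expr0n.
    rewrite expr2; under eq_fun do rewrite expr2.
    by apply: cvgM; apply: cvgB => //; exact: cvg_cst.
  - by apply: filterS vg => x + n => /(_ n); rewrite ger0_norm// sqr_ge0.
rewrite Rintegral_cst// mul0r => /cvgrPdist_le/(_ _ e0)[N _ /(_ N (leqnn N))].
rewrite sub0r normrN => H; exists (w_ N) => //.
exact: le_trans (ler_norm _) H.
Qed.

Lemma parseval_fun_indic_lambda :
  parseval_fun (fun=> 1) ->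
  lambda_system setT [set A | measurable A /\ parseval_fun (\1_A : T -> R)].
Proof.
move=> p1; split => //.
- by split=> //; rewrite indicT.
- move=> A B BA [mA pA] [mB pB]; split; first exact: measurableD.
  have -> : \1_(A `\` B) = (fun x => -1 * \1_B x + \1_A x) :> (T -> R).
    apply/funext => x; rewrite !indicE in_setD.
    have [/set_mem/BA/mem_set->|_] := boolP (x \in B); last by rewrite andbT mulr0 add0r.
    by rewrite mulr1 addNr.
  exact: parseval_fun_comb.
- move=> F ndF HF.
  have mU : measurable (\bigcup_n F n) by apply: bigcupT_measurable => n; case: (HF n).
  split => //.
  apply: (@parseval_fun_cvg _ (fun n => \1_(F n)) (fun=> 1)).
  + apply: (@sqint_bounded _ _ _ _ _ 1) => // x.
    by rewrite ger0_norm// indicE; case: (_ \in _).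
  + by move=> n; case: (HF n).
  + apply: aeW => x; apply: (@cvg_trans _ ((\1_(\bigcup_n F n) x : R) @[n --> \oo])); last exact: cvg_cst.
    apply: near_eq_cvg.
    have [[n _ Fnx]|nx] := pselect ((\bigcup_n F n) x).
      (* At each point the indicators of an increasing sequence of sets are eventually equal to that
         of the union. *)
      near=> m; rewrite !indicE !mem_set//; last by exists n.
      suff /subsetP : (F n `<=` F m)%classic by move=> H; apply/set_mem/H/mem_set.
      by apply/subsetPset/ndF; near: m; exact: nbhs_infty_ge.
    apply: nearW => m; rewrite !indicE !memNset// => Fmx; apply: nx; by exists m.
  + exact: finite_measure_integrable_cst.
  + apply: aeW => x n; rewrite !indicE.
    by case: (_ \in _); case: (_ \in _); rewrite ?subrr ?subr0 ?sub0r ?sqrrN ?expr1n ?expr0n.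
Unshelve. all: by end_near. Qed.

Import HBNNSimple.

Lemma parseval_fun_nnsfun (h : {nnsfun T >-> R}) :
  (forall A, measurable A -> parseval_fun (\1_A : T -> R)) -> parseval_fun h.
Proof.
move=> HA.
have -> : (h : T -> R) = (fun x => \sum_(y <- finmap.enum_fset (fset_set (range h))) y * \1_(h @^-1` [set y]) x).
  by apply/funext => x; rewrite fimfunE fsbig_finite.
elim: (finmap.enum_fset _) => [|y s IH].
  have -> : (fun x => \sum_(y <- [::]) y * \1_(h @^-1` [set y]) x) = \1_set0 :> (T -> R).
    by apply/funext => x; rewrite big_nil indicE in_set0.
  exact: HA.
have -> : (fun x => \sum_(z <- y :: s) z * \1_(h @^-1` [set z]) x) =
   (fun x => y * \1_(h @^-1` [set y]) x + \sum_(z <- s) z * \1_(h @^-1` [set z]) x) :> (T -> R).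
  by apply/funext => x; rewrite big_cons.
by apply: parseval_fun_comb => //; exact: HA.
Qed.

(** Dynkin's theorem carries Parseval from a generating family stable under intersections to all
    measurable sets. Linear combinations give simple functions, dominated convergence nonnegative
    functions, and positive and negative parts the rest. *)
Lemma parseval_monotone_class (G : set (set T)) : setI_closed G ->
  measurable = <<s G >> -> parseval_fun (fun=> 1) ->
  (forall A, G A -> parseval_fun (\1_A : T -> R)) -> complete_phases.
Proof.
move=> IG mG p1 pG.
have HA A : measurable A -> parseval_fun (\1_A : T -> R).
  move=> mA.
  have := @lambda_system_subset _ _ IG setT _ (parseval_fun_indic_lambda p1).
  have GH : G `<=` [set A | measurable A /\ parseval_fun (\1_A : T -> R)].
    by move=> B GB; split; [rewrite mG; exact: sub_sigma_algebra|exact: pG].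
  move=> /(_ GH (fun X _ => subsetT X)); rewrite -mG.
  by move=> /(_ A mA)[].
have pos v : sqint mu v -> (forall x, 0 <= v x) -> parseval_fun v.
  move=> sv v0; have [mv iv] := sv.
  have mv' : measurable_fun setT (EFin \o v) by exact/measurable_EFinP.
  pose g_ n := nnsfun_approx measurableT mv' n.
  have g0 x : setT x -> (0 <= (EFin \o v) x)%E by rewrite lee_fin.
  apply: (@parseval_fun_cvg _ (fun n => g_ n) (fun x => v x ^+ 2)) => //.
  + by move=> n; exact: parseval_fun_nnsfun.
  + apply: aeW => x; have := cvg_nnsfun_approx measurableT mv' (fun x => g0 x) I.
    by move=> /(_ x)/fine_cvgP[].
  + apply: aeW => x n; have gv : g_ n x <= v x.
      by rewrite -lee_fin /g_ nnsfun_approxE; exact: le_approx.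
    have gn0 : 0 <= g_ n x by [].
    by have := v0 x; nra.
move=> v sv; have [mv iv] := sv.
have -> : v = (fun x => -1 * Num.max (- v x) 0 + Num.max (v x) 0).
  by apply/funext => x; rewrite /Num.max; case: ltP => ?; case: ltP => ?; lra.
have mm : measurable_fun setT (fun x => Num.max (v x) 0) by exact: measurable_maxr.
have mn : measurable_fun setT (fun x => Num.max (- v x) 0).
  by apply: measurable_maxr => //; exact: measurableT_comp.
apply: parseval_fun_comb; apply: pos.
- apply: (sqint_le mn _ sv) => x; rewrite /Num.max; case: ltP => ?.
    by rewrite normr0.
  by rewrite normrN.
- by move=> x; rewrite le_max lexx orbT.
- apply: (sqint_le mm _ sv) => x; rewrite /Num.max; case: ltP => // ?.
  by rewrite normr0.
- by move=> x; rewrite le_max lexx orbT.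
Qed.

End phases.

(** * Parseval on the circle and on the torus *)

Section circle.
Context {R : realType}.
Local Notation leb := (@lebesgue_measure R).
Local Notation circle := (@circle_measure R).
Implicit Types (f : R -> R) (k l : int).

Let twopi_gt0 : 0 < 2 * pi :> R. Proof. by rewrite mulr_gt0// pi_gt0. Qed.

(** The points 0 and [b] are left out because the approximations of the indicator of a ray used
    below are not claimed to converge there. *)
Lemma circle_ae (b : R) (P : R -> Prop) :
  (forall x, 0 < x < 2 * pi -> x != b -> P x) -> {ae circle, forall x, P x}.
Proof.
move=> HP; exists (~` (`]0, (2 * pi)[%classic `\ b)); split.
- by apply: measurableC; apply: measurableD.
- rewrite /= /mfrestr /mrestr; apply: (@subset_measure0 _ _ _ leb _ ([set 0] `|` [set b])).
  + by apply: measurableI => //; apply: measurableC; exact: measurableD.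
  + exact: measurableU.
  + move=> x [/= H]; rewrite in_itv/= => /andP[x0 x1].
    have [->|xb] := eqVneq x b; first by right.
    left; apply/eqP; rewrite eq_le x0 andbT leNgt; apply/negP => xp.
    apply: H; split; first by rewrite /= in_itv/= xp.
    exact/eqP.
  + apply/eqP; rewrite eq_le measure_ge0 andbT.
    apply: (le_trans (measureU2 _ _ _)) => //.
    by rewrite -[X in (_ <= X)%E]adde0; apply: leeD;
      rewrite le_eqVlt; apply/orP; left; apply/eqP; exact: lebesgue_measure_set1.
- move=> x /= nPx [] /=; rewrite in_itv/= => /HP H /eqP/H.
  exact: nPx.
Qed.

Lemma circle_Rintegral f : rintegrable circle f ->
  \int[circle]_x f x = \int[leb]_(x in `[0%R, (2 * pi)%R[) f x.
Proof.
move=> fi; congr fine.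
have mD : measurable (`[0%R, (2 * pi)%R[%classic : set (measurableTypeR R)).
  exact: measurable_itv.
rewrite (@negligible_integral _ _ _ circle setT (~` `[0%R, (2 * pi)%R[%classic))//; last 2 first.
- exact: measurableC.
- by rewrite /= /mfrestr /mrestr setICl measure0.
rewrite setTD setCK; apply: eq_measure_integral => A mA AD.
by rewrite /= /mfrestr /mrestr setIidl.
Qed.

Lemma circle_FTC f (F : R -> R) (c : R) : continuous f -> (forall x, `|f x| <= c) ->
  (forall x : R, is_derive x (1 : R) F (f x)) -> \int[circle]_x f x = F (2 * pi) - F 0.
Proof.
move=> cf fc dF.
have mf : measurable_fun [set: measurableTypeR R] f by exact: continuous_measurable_fun.
have cF : continuous F.
  move=> x; apply/differentiable_continuous/derivable1_diffP.
  exact: (@ex_derive _ _ _ _ _ _ _ (dF x)).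
have fi := rintegrable_bounded circle mf fc.
rewrite circle_Rintegral//.
rewrite /Rintegral.
rewrite integral_itv_bndo_bndc//; last first.
  by apply/measurable_EFinP; exact: measurable_funS mf.
rewrite (@continuous_FTC2 _ f F)//.
- exact: continuous_subspaceT.
- split.
  + by move=> x _; exact: (@ex_derive _ _ _ _ _ _ _ (dF x)).
  + by apply: cvg_at_right_filter; exact: cF.
  + by apply: cvg_at_left_filter; exact: cF.
- by move=> x _; rewrite derive1E; exact: (@derive_val _ _ _ _ _ _ _ (dF x)).
Qed.

Lemma circle_mass : mass circle = 2 * pi.
Proof.
rewrite /mass /= /mfrestr /mrestr setTI lebesgue_measure_itv/= lte_fin.
by rewrite twopi_gt0 oppr0 adde0.
Qed.

Lemma smooth_cos : smooth_on setT (cos : R -> R).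
Proof.
have -> : cos = (fun x : R => cos (x + 0)) by apply/funext => x; rewrite addr0.
exact: smooth_cos_shift.
Qed.

Lemma is_derive_cos_scale (c b x : R) :
  is_derive x (1 : R) (fun x : R => cos (c * x + b)) (- (c * sin (c * x + b))).
Proof.
have := smooth_is_derive (smooth_affine c b smooth_cos) x 1; congr is_derive.
rewrite derive_affine; last exact: smooth_cos.
by rewrite -mulrN; congr *%R; exact: derive_val.
Qed.

Lemma circle_cos k (b : R) : k != 0 -> \int[circle]_x cos (k%:~R * x + b) = 0.
Proof.
move=> k0; pose K : R := k%:~R; have K0 : K != 0 by rewrite intr_eq0.
transitivity (K^-1 * cos (K * (2 * pi) + (b - pi / 2)) - K^-1 * cos (K * 0 + (b - pi / 2))).
  apply: (@circle_FTC _ (fun x => K^-1 * cos (K * x + (b - pi / 2))) 1).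
  - move=> x; apply: (@continuous_comp _ _ _ (fun x : R => K * x + b)); last exact: continuous_cos.
    by apply: cvgD; [apply: cvgMr; exact: cvg_id|exact: cvg_cst].
  - by move=> x; exact: cos_max.
  - move=> x; have := is_deriveZ K^-1 (is_derive_cos_scale K (b - pi / 2) x).
    congr is_derive; rewrite /GRing.scale/= mulrN mulrA mulVf// mul1r addrA.
    by rewrite sinBpihalf opprK.
rewrite mulr0 add0r -mulrBr -[X in cos X - _]addrC [K * _]mulrC.
by rewrite cos_periodic_int subrr mulr0.
Qed.

Definition circle_phase k (x : R) : R := k%:~R * x.

Lemma circle_orthogonal : orthogonal_phases circle circle_phase.
Proof.
have ck (c : R) : continuous (fun x : R => c * x).
  by move=> x; apply: cvgMr; exact: cvg_id.
have phiB k l x : circle_phase k x - circle_phase l x = (k - l)%:~R * x.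
  by rewrite /circle_phase rmorphB/= mulrBl.
split.
- by rewrite circle_mass.
- by move=> k; apply: continuous_measurable_fun; exact: ck.
- move=> k l; under eq_Rintegral do rewrite phiB.
  have [->|kl] := eqVneq k l.
    under eq_Rintegral do rewrite subrr mul0r cos0.
    by rewrite Rintegral_cst// mul1r.
  under eq_Rintegral do rewrite -[X in cos X]addr0.
  by apply: circle_cos; rewrite subr_eq0.
- move=> k l; under eq_Rintegral do rewrite phiB -cosBpihalf.
  have [->|kl] := eqVneq k l.
    under eq_Rintegral do rewrite subrr mul0r cosBpihalf sin0.
    by rewrite Rintegral_cst// mul0r.
  by apply: circle_cos; rewrite subr_eq0.
Qed.

Let wave_set : set (R -> R) := [set f | exists k b, f = fun x => cos (k%:~R * x + b)].

Lemma trig_cst c : lin_span wave_set (fun=> c).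
Proof.
have -> : (fun=> c) = (fun x => (c - 1) * cos (0%:~R * x + 0) + cos (0%:~R * x + 0)) :> (R -> R).
  by apply/funext => x; rewrite mul0r addr0 cos0 mulr1 subrK.
by apply: lin_span_comb; apply: lin_span_base; exists 0, 0.
Qed.

Lemma trigZ c f : lin_span wave_set f -> lin_span wave_set (fun x => c * f x).
Proof.
move=> Tf; have -> : (fun x => c * f x) = (fun x => (c - 1) * f x + f x).
  by apply/funext => x; rewrite mulrBl mul1r subrK.
exact: lin_span_comb.
Qed.

(** Product-to-sum formulas make the span of shifted cosines an algebra, so a polynomial in a
    trigonometric polynomial is again one. *)
Lemma trigM f g : lin_span wave_set f -> lin_span wave_set g ->
  lin_span wave_set (fun x => f x * g x).
Proof.
move=> Tf; elim=> {g} [_ [k [b ->]]|c g h _ Tg _ Th]; last first.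
  have -> : (fun x => f x * (c * g x + h x)) = (fun x => c * (f x * g x) + f x * h x).
    by apply/funext => x; ring.
  exact: lin_span_comb.
elim: Tf => {f} [_ [l [a ->]]|c f h _ Tf _ Th]; last first.
  have -> : (fun x => (c * f x + h x) * cos (k%:~R * x + b)) =
     (fun x => c * (f x * cos (k%:~R * x + b)) + h x * cos (k%:~R * x + b)).
    by apply/funext => x; ring.
  exact: lin_span_comb.
have -> : (fun x => cos (l%:~R * x + a) * cos (k%:~R * x + b)) =
  (fun x => 2^-1 * cos ((l + k)%:~R * x + (a + b)) + 2^-1 * cos ((l - k)%:~R * x + (a - b))) :> (R -> R).
  apply/funext => x; rewrite -mulrDr rmorphD rmorphB/=.
  have -> : (l%:~R + k%:~R) * x + (a + b) = (l%:~R * x + a) + (k%:~R * x + b) by ring.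
  have -> : (l%:~R - k%:~R) * x + (a - b) = (l%:~R * x + a) - (k%:~R * x + b) by ring.
  by rewrite (cosD (_ + a)) (cosB (_ + a)); lra.
by apply: lin_span_comb; [|apply: trigZ]; apply: lin_span_base; do 2 eexists.
Qed.

Lemma trigX f n : lin_span wave_set f -> lin_span wave_set (fun x => f x ^+ n).
Proof.
move=> Tf; elim: n => [|n IH]; first by under eq_fun do rewrite expr0; exact: trig_cst.
by under eq_fun do rewrite exprS; exact: trigM.
Qed.

Lemma circle_Rint_cos k (b : R) :
  \int[circle]_x cos (k%:~R * x + b) = 2 * pi * cos b * (k == 0)%:R.
Proof.
have [->|k0] := eqVneq k 0; last by rewrite circle_cos// mulr0.
under eq_Rintegral do rewrite mul0r add0r.
by rewrite Rintegral_cst// mulr1 [X in _ * X]circle_mass mulrC.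
Qed.

Let icos k (b : R) : rintegrable circle (fun x => cos (k%:~R * x + b)).
Proof.
apply: (@rintegrable_bounded _ _ _ _ _ 1); last by move=> x; exact: cos_max.
apply: continuous_measurable_fun => x.
apply: (@continuous_comp _ _ _ (fun x : R => k%:~R * x + b)); last exact: continuous_cos.
by apply: cvgD; [apply: cvgMr; exact: cvg_id|exact: cvg_cst].
Qed.

Let prod_cos k l (a b : R) :
  \int[circle]_x (cos (k%:~R * x + a) * cos (l%:~R * x + b)) =
  pi * (cos (a + b) * (k == - l)%:R + cos (a - b) * (k == l)%:R).
Proof.
transitivity (\int[circle]_x (2^-1 * cos ((k + l)%:~R * x + (a + b)) +
                              2^-1 * cos ((k - l)%:~R * x + (a - b)))).
  apply: eq_Rintegral => x _; rewrite rmorphD rmorphB/=.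
  have -> : (k%:~R + l%:~R) * x + (a + b) = (k%:~R * x + a) + (l%:~R * x + b) by ring.
  have -> : (k%:~R - l%:~R) * x + (a - b) = (k%:~R * x + a) - (l%:~R * x + b) by ring.
  by rewrite (cosD (_ + a)) (cosB (_ + a)); lra.
rewrite RintegralD//; try (apply: rintegrableZ; exact: icos).
rewrite !RintegralZl//; try exact: icos.
rewrite !circle_Rint_cos addr_eq0 subr_eq0 !mulrA mulVf ?pnatr_eq0// mul1r.
by rewrite mulrDr !mulrA.
Qed.

Lemma cos_parseval k b : parseval_fun circle circle_phase (fun x => cos (k%:~R * x + b)).
Proof.
have oc := circle_orthogonal.
split.
  apply: (@sqint_bounded _ _ _ _ _ 1); last by move=> x; exact: cos_max.
  exact: rintegrable_measurable (icos k b).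
have C l : cosc circle circle_phase (fun x => cos (k%:~R * x + b)) l =
    pi * cos b * ((k == - l)%:R + (k == l)%:R).
  transitivity (\int[circle]_x (cos (k%:~R * x + b) * cos (l%:~R * x + 0))).
    by apply: eq_Rintegral => x _; rewrite addr0.
  by rewrite prod_cos addr0 subr0 -mulrDr mulrA.
have S l : sinc circle circle_phase (fun x => cos (k%:~R * x + b)) l =
    pi * sin b * ((k == - l)%:R - (k == l)%:R).
  transitivity (\int[circle]_x (cos (k%:~R * x + b) * cos (l%:~R * x + (- (pi / 2))))).
    by apply: eq_Rintegral => x _; rewrite cosBpihalf.
  by rewrite prod_cos opprK cosBpihalf cosDpihalf mulNr -mulrBr mulrA.
(* A wave only has the frequencies [k] and [- k], so its defect on them is exactly 0; [undup] merges
   the two when [k = 0]. *)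
move=> e e0; exists (undup [:: k; - k]); first exact: undup_uniq.
rewrite /defect prod_cos circle_mass subrr cos0 eqxx.
have pi0 : pi != 0 :> R by rewrite gt_eqF// pi_gt0.
have cs : cos b ^+ 2 = 1 - sin b ^+ 2 by rewrite cos2sin2.
have kk : (k == - k) = (k == 0).
  by rewrite -subr_eq0 opprK -mulr2n mulrn_eq0.
rewrite /= inE kk; have [k0|k0] := eqVneq k 0.
  rewrite /= big_seq1 !C !S opprK !eqxx kk k0 eqxx.
  suff -> : pi * (cos (b + b) * 1%:R + 1 * 1%:R) =
    (2 * pi)^-1 * (pi * cos b * (1%:R + 1%:R) * (pi * cos b * (1%:R + 1%:R)) +
      pi * sin b * (1%:R - 1%:R) * (pi * sin b * (1%:R - 1%:R))) :> R by rewrite subrr ltW.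
  rewrite cosD; have -> : sin b * sin b = 1 - cos b * cos b by rewrite -!expr2 cs; ring.
  by move: (pi : R) pi0 => p p0; field.
rewrite /= big_cons big_seq1 !C !S opprK !eqxx kk (negbTE k0).
suff -> : pi * (cos (b + b) * 0%:R + 1 * 1%:R) =
  (2 * pi)^-1 * (pi * cos b * (0%:R + 1%:R) * (pi * cos b * (0%:R + 1%:R)) +
   pi * sin b * (0%:R - 1%:R) * (pi * sin b * (0%:R - 1%:R)) +
   (pi * cos b * (1%:R + 0%:R) * (pi * cos b * (1%:R + 0%:R)) +
   pi * sin b * (1%:R - 0%:R) * (pi * sin b * (1%:R - 0%:R)))) :> R by rewrite subrr ltW.
transitivity (pi * (cos b ^+ 2 + sin b ^+ 2)); last by move: (pi : R) pi0 => p p0; field.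
by rewrite cs; ring.
Qed.

Lemma trig_parseval f : lin_span wave_set f -> parseval_fun circle circle_phase f.
Proof.
have oc := circle_orthogonal.
elim=> {f} [_ [k [b ->]]|c f g _ pf _ pg]; last exact: parseval_fun_comb.
exact: cos_parseval.
Qed.

(** Bernoulli's inequality for [(1 + z) ^+ m], together with [(1 - z) (1 + z) <= 1]. *)
Lemma exp_one_sub_le (z : R) m : 0 <= z <= 1 -> (1 - z) ^+ m * (m%:R * z) <= 1.
Proof.
move=> /andP[z0 z1].
have B : 1 + m%:R * z <= (1 + z) ^+ m.
  elim: m => [|m IH]; first by rewrite mul0r addr0 expr0.
  rewrite exprS; apply: le_trans (ler_wpM2l _ IH); last by rewrite addr_ge0.
  by rewrite -natr1; have := ler0n R m; nra.
have z1' : 0 <= 1 - z by lra.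
apply: (@le_trans _ _ ((1 - z) ^+ m * (1 + z) ^+ m)).
  by rewrite ler_wpM2l ?exprn_ge0// (le_trans _ B)// lerDr.
by rewrite -exprMn exprn_ile1//; nra.
Qed.

Lemma exp_one_sub_ge (z : R) m : 0 <= z <= 1 -> 1 - m%:R * z <= (1 - z) ^+ m.
Proof.
move=> /andP[z0 z1]; elim: m => [|m IH]; first by rewrite mul0r subr0 expr0.
rewrite exprS; apply: le_trans (ler_wpM2l _ IH); last lra.
by rewrite -natr1; have := ler0n R m; nra.
Qed.

(* Brosowski-Deutsch polynomials: [(1 - y^n)^m] with [m ~ t^-n] is close to
   the indicator of [y < t] on [0, 1]. *)
Definition threshold (t : R) n (y : R) : R := (1 - y ^+ n) ^+ (Num.truncn (t ^- n)).+1.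

Lemma threshold01 t n y : 0 <= y <= 1 -> 0 <= threshold t n y <= 1.
Proof.
move=> /andP[y0 y1]; have yn0 := exprn_ge0 n y0; have yn1 : y ^+ n <= 1 by exact: exprn_ile1.
by rewrite exprn_ge0 ?exprn_ile1//; lra.
Qed.

(** The exponent lies between [t ^- n] and [t ^- n + 1]. The two Bernoulli bounds then make the
    error at most [(y / t) ^+ n + y ^+ n] below [t] and [(t / y) ^+ n] above it. *)
Lemma threshold_cvg t y : 0 < t < 1 -> 0 <= y <= 1 -> y != t ->
  threshold t n y @[n --> \oo] --> (if y < t then 1 else 0 : R).
Proof.
move=> /andP[t0 t1] /andP[y0 y1] yt.
have yn01 n : 0 <= y ^+ n <= 1 by rewrite exprn_ge0// exprn_ile1.
have tn0 n : 0 <= t ^- n by rewrite invr_ge0 exprn_ge0// ltW.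
have [lo hi] : (forall n, t ^- n <= (Num.truncn (t ^- n)).+1%:R) /\
               (forall n, (Num.truncn (t ^- n)).+1%:R <= t ^- n + 1).
  split=> n; have /andP[a b] := truncn_itv (tn0 n); first exact: ltW.
  by rewrite -natr1 lerD2r.
case: ltP => yt'.
  have q1 : `|y / t| < 1.
    by rewrite ger0_norm ?divr_ge0 ?(ltW t0)// ltr_pdivrMr// mul1r.
  have yl1 : `|y| < 1 by rewrite ger0_norm// (lt_trans yt').
  apply: (@squeeze_cvgr _ _ _ _ (fun n => 1 - ((y / t) ^+ n + y ^+ n)) (fun=> 1)).
  - near=> n; have /andP[_ ->] := threshold01 t n (introT andP (conj y0 y1)).
    rewrite andbT; apply: le_trans (exp_one_sub_ge _ (yn01 n)).
    have -> : (y / t) ^+ n + y ^+ n = (t ^- n + 1) * y ^+ n.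
      by rewrite expr_div_n mulrDl mul1r mulrC.
    rewrite lerD2l lerN2.
    by apply: ler_wpM2r => //; case/andP: (yn01 n).
  - rewrite -[X in _ --> X]subr0 -[X in 1 - X]addr0.
    by apply: cvgB; [exact: cvg_cst|apply: cvgD; exact: cvg_expr].
  - exact: cvg_cst.
have {}yt' : t < y by rewrite lt_neqAle eq_sym yt.
have q1 : `|t / y| < 1.
  rewrite ger0_norm ?divr_ge0 ?(ltW t0)// ltr_pdivrMr ?mul1r//.
  exact: lt_trans yt'.
have yp : 0 < y by exact: lt_trans yt'.
apply: (@squeeze_cvgr _ _ _ _ (fun=> 0) (fun n => (t / y) ^+ n)).
- near=> n; have /andP[-> _] := threshold01 t n (introT andP (conj y0 y1)).
  have := exp_one_sub_le (Num.truncn (t ^- n)).+1 (yn01 n); rewrite -/(threshold t n y).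
  have ty : 0 < t ^- n * y ^+ n by rewrite mulr_gt0 ?invr_gt0 ?exprn_gt0.
  move=> H; have {}H : threshold t n y * (t ^- n * y ^+ n) <= 1.
    apply: le_trans H; apply: ler_wpM2l.
      by have /andP[] := threshold01 t n (introT andP (conj y0 y1)).
    by apply: ler_wpM2r => //; case/andP: (yn01 n).
  rewrite -ler_pdivlMr// in H; apply: le_trans H _.
  by rewrite expr_div_n div1r invfM invrK.
- exact: cvg_cst.
- exact: cvg_expr.
Unshelve. all: by end_near. Qed.

Lemma ray_parseval b : parseval_fun circle circle_phase (\1_`]-oo, b[ : R -> R).
Proof.
have oc := circle_orthogonal.
have m1 : measurable_fun [set: measurableTypeR R] (\1_`]-oo, b[ : R -> R).
  exact: measurable_indic.
have i01 x : 0 <= (\1_`]-oo, b[ : R -> R) x <= 1.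
  by rewrite indicE; case: (_ \in _); rewrite ?lexx ?ler01.
have s1 : sqint circle (\1_`]-oo, b[ : R -> R).
  apply: (@sqint_bounded _ _ _ _ _ 1) => // x.
  by have /andP[a0 a1] := i01 x; rewrite ger0_norm.
have lim (w : nat -> R -> R) : (forall n, lin_span wave_set (w n)) ->
    (forall n x, 0 <= w n x <= 1) ->
    (forall x, 0 < x < 2 * pi -> x != b -> w n x @[n --> \oo] --> (\1_`]-oo, b[ : R -> R) x) ->
    parseval_fun circle circle_phase (\1_`]-oo, b[ : R -> R).
  move=> Tw w01 wl; apply: (@parseval_fun_cvg _ _ _ _ _ _ oc _ w (fun=> 1)) => //.
  - by move=> n; exact: trig_parseval.
  - exact: (@circle_ae b).
  - exact: finite_measure_integrable_cst.
  - apply: aeW => x n; have /andP[a0 a1] := i01 x; have /andP[c0 c1] := w01 n x.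
    by rewrite expr2; nra.
have i1 x : x < b -> (\1_`]-oo, b[ : R -> R) x = 1.
  by move=> xb; rewrite indicE mem_set//= in_itv/=.
have i0 x : b <= x -> (\1_`]-oo, b[ : R -> R) x = 0.
  by move=> xb; rewrite indicE memNset//= in_itv/= ltNge xb.
(* On [0, 2 pi[ a ray starting outside the period has a constant indicator, up to a null set; only
   [0 < b < 2 pi] needs the threshold polynomials. *)
have [b0|b0] := leP b 0.
  apply: (lim (fun=> fun=> 0)) => [n|n x|x /andP[x0 _] _]; first exact: trig_cst.
    by rewrite lexx ler01.
  rewrite i0; [exact: cvg_cst|exact/ltW/(le_lt_trans b0)].
have [b1|b1] := leP (2 * pi) b.
  apply: (lim (fun=> fun=> 1)) => [n|n x|x /andP[_ x1] _]; first exact: trig_cst.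
    by rewrite lexx ler01.
  rewrite i1; [exact: cvg_cst|exact/(lt_le_trans x1)].
(* [y] measures the distance to the midpoint [b / 2] of the arc ]0, b[, and [t] is its value at both
   ends. On the period, the arc is thus the sublevel set [y < t], which the threshold polynomials
   detect. *)
pose y (x : R) := (1 - cos (x - b / 2)) / 2; pose t : R := (1 - cos (b / 2)) / 2.
have y01 x : 0 <= y x <= 1.
  by have := cos_geN1 (x - b / 2); have := cos_le1 (x - b / 2); rewrite /y; lra.
have t01 : 0 < t < 1.
  have : cos (b / 2) < cos 0 by rewrite ltr_cos ?in_itv/= ?lexx ?pi_ge0//; lra.
  have : cos pi < cos (b / 2) :> R by rewrite ltr_cos ?in_itv/= ?lexx ?pi_ge0//; lra.
  by rewrite cos0 cospi /t; lra.
have Ty : lin_span wave_set y.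
  have -> : y = (fun x => - 2^-1 * cos (1%:~R * x + (- (b / 2))) + 2^-1).
    by apply/funext => x; rewrite /y mul1r; lra.
  by apply: lin_span_comb; [apply: lin_span_base; do 2 eexists|exact: trig_cst].
apply: (lim (fun n x => threshold t n (y x))).
- move=> n; apply: trigX.
  have -> : (fun x => 1 - y x ^+ n) = (fun x => -1 * y x ^+ n + 1).
    by apply/funext => x; rewrite mulN1r addrC.
  by apply: lin_span_comb; [exact: trigX|exact: trig_cst].
- by move=> n x; exact: threshold01.
move=> x /andP[x0 x1] xb.
(* For [0 < x < 2 pi] the first factor is positive and the second has the sign of [x - b]. *)
have yt : y x - t = sin (x / 2) * sin ((x - b) / 2).
  have e1 : x - b / 2 = x / 2 + (x - b) / 2 by lra.
  have e2 : b / 2 = x / 2 - (x - b) / 2 by lra.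
  have c1 : cos (x - b / 2) = cos (x / 2) * cos ((x - b) / 2) - sin (x / 2) * sin ((x - b) / 2).
    by rewrite e1 cosD.
  have c2 : cos (b / 2) = cos (x / 2) * cos ((x - b) / 2) + sin (x / 2) * sin ((x - b) / 2).
    by rewrite {1}e2 cosB.
  by rewrite /y /t c1 c2; lra.
have sx : 0 < sin (x / 2) by apply: sin_gt0_pi; lra.
have [xb'|xb'] := ltP x b.
  have sb : sin ((x - b) / 2) < 0.
    by rewrite -oppr_gt0 -sinN; apply: sin_gt0_pi; lra.
  have lt : y x < t by rewrite -subr_lt0 yt pmulr_rlt0.
  have := threshold_cvg t01 (y01 x); rewrite lt lt_eqF// i1//; exact.
have {}xb' : b < x by rewrite lt_neqAle eq_sym xb.
have sb : 0 < sin ((x - b) / 2) by apply: sin_gt0_pi; lra.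
have lt : t < y x by rewrite -subr_gt0 yt mulr_gt0.
have := threshold_cvg t01 (y01 x); rewrite ltNge (ltW lt)/= gt_eqF// i0 ?(ltW xb')//; exact.
Qed.

Lemma circle_complete : complete_phases circle circle_phase.
Proof.
have oc := circle_orthogonal.
apply: (@parseval_monotone_class _ _ _ _ _ _ oc (@RGenInftyO.G R)).
- move=> _ _ [a ->] [b ->]; exists (Num.min a b).
  by apply/seteqP; split=> x /=; rewrite !in_itv/= lt_min => /andP.
- exact: RGenInftyO.measurableE.
- by apply: trig_parseval; exact: trig_cst.
- by move=> _ [b ->]; exact: ray_parseval.
Qed.

End circle.

(** * From dimension n to dimension n + 1 *)

Section torus_coordinates.
Context {R : realType} {n : nat}.
Local Notation circle := (@circle_measure R).

Definition rV_head (x : 'rV[R]_n.+1) : R := x ord0 ord0.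

Definition rV_tail (x : 'rV[R]_n.+1) : 'rV[R]_n := \row_i x ord0 (lift ord0 i).

Lemma rV_head_cons (p : R * 'rV[R]_n) : rV_head (rV_cons p) = p.1.
Proof.
rewrite /rV_head; have -> : ord0 = lshift n ord0 :> 'I_(1 + n) by apply/val_inj.
by rewrite [LHS]row_mxEl mxE.
Qed.

Lemma rV_tail_cons (p : R * 'rV[R]_n) : rV_tail (rV_cons p) = p.2.
Proof.
apply/rowP => i; rewrite mxE; have -> : lift ord0 i = rshift 1 i :> 'I_(1 + n) by apply/val_inj.
exact: row_mxEr.
Qed.

Lemma measurable_rV_head : measurable_fun setT rV_head.
Proof. exact: measurable_coord. Qed.

Lemma measurable_rV_tail : measurable_fun setT rV_tail.
Proof.
apply: measurable_fun_rV => i; under eq_fun do rewrite mxE.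
exact: measurable_coord.
Qed.

(** Fubini, transported along [rV_cons], by which the measure in dimension [n.+1] is pushed forward
    from a product. *)
Lemma torus_tensor (a : R -> R) (b : 'rV[R]_n -> R) (ca cb : R) :
  measurable_fun [set: measurableTypeR R] a -> measurable_fun setT b ->
  (forall x, `|a x| <= ca) -> (forall y, `|b y| <= cb) ->
  \int[torus_measure n.+1]_x (a (rV_head x) * b (rV_tail x)) =
  \int[circle]_x a x * \int[torus_measure n]_y b y.
Proof.
move=> ma mb aca bcb.
have ia := rintegrable_bounded circle ma aca.
have ib := rintegrable_bounded (torus_measure n) mb bcb.
have mab : measurable_fun setT (fun z : 'rV[R]_n.+1 => (a (rV_head z) * b (rV_tail z))).
  by apply: measurable_funM; apply: measurableT_comp => //;
    [exact: measurable_rV_head|exact: measurable_rV_tail].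
have mab' : measurable_fun setT (fun z : measurableTypeR R * 'rV[R]_n => a z.1 * b z.2).
  by apply: measurable_funM; apply: measurableT_comp.
have E : (fun z : 'rV[R]_n.+1 => (a (rV_head z) * b (rV_tail z))%:E) \o (@rV_cons R n) =
    (fun z => (a z.1 * b z.2)%:E).
  by apply/funext => z /=; rewrite rV_head_cons rV_tail_cons.
have iab : (circle \x torus_measure n)%E.-integrable setT
    (fun z : measurableTypeR R * 'rV[R]_n => (a z.1 * b z.2)%:E).
  have fin : ((circle \x torus_measure n)%E [set: R * 'rV[R]_n] < +oo)%E.
    rewrite -setXTT product_measure1E// lte_mul_pinfty//; first exact: fin_num_measure.
    by rewrite -ge0_fin_numE//; exact: fin_num_measure.
  apply: (@measurable_bounded_integrable _ _ _ _ (fun z : measurableTypeR R * 'rV[R]_n => a z.1 * b z.2)) => //.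
  exists (ca * cb); split; first exact: num_real.
  move=> M cM z _ /=; apply: le_trans (ltW cM).
  by rewrite normrM ler_pM.
transitivity (fine (\int[(circle \x torus_measure n)%E]_z (a z.1 * b z.2)%:E)).
  rewrite /Rintegral integral_pushforward//; last 3 first.
  - exact: (@measurable_rV_cons _ R n).
  - exact/measurable_EFinP.
  - by rewrite E.
  congr fine; rewrite preimage_setT; apply: eq_integral => z _ /=.
  by rewrite rV_head_cons rV_tail_cons.
rewrite -integral12_prod_meas1//=.
have -> : (fun x => \int[torus_measure n]_y (a x * b y)%:E)%E =
   (fun x => (\int[torus_measure n]_y (b y)%:E) * (a x)%:E)%E.
  apply/funext => x; rewrite muleC -integralZl//.
rewrite -(fineK (integrable_fin_num measurableT ib)) integralZl//.
by rewrite -(fineK (integrable_fin_num measurableT ia)) /= mulrC.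
Qed.

Definition rectangles : set (set 'rV[R]_n.+1) :=
  [set C | exists A B, [/\ measurable (A : set (measurableTypeR R)), measurable B &
     C = rV_head @^-1` A `&` rV_tail @^-1` B]].

Lemma rectangles_setI : setI_closed rectangles.
Proof.
move=> _ _ [A [B [mA mB ->]]] [A' [B' [mA' mB' ->]]].
exists (A `&` A'), (B `&` B'); split; [exact: measurableI|exact: measurableI|].
by apply/seteqP; split=> x /=; [move=> [[? ?] [? ?]]|move=> [[? ?] [? ?]]].
Qed.

Lemma rectangles_measurable : measurable = <<s rectangles >>.
Proof.
apply/seteqP; split; last first.
  apply: smallest_sub; first exact: sigma_algebra_measurable.
  move=> _ [A [B [mA mB ->]]]; apply: measurableI.
    by rewrite -[X in measurable X]setTI; exact: measurable_rV_head.
  by rewrite -[X in measurable X]setTI; exact: measurable_rV_tail.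
apply: smallest_sub; first exact: smallest_sigma_algebra.
apply: (big_ind (fun X : set (set 'rV[R]_n.+1) => X `<=` <<s rectangles >>)) => //.
  by move=> X Y mX mY A [/mX|/mY].
move=> i _ _ [A mA <-]; rewrite setTI; apply: sub_sigma_algebra.
case: (unliftP ord0 i) => [j ->|->]; last first.
  by exists A, setT; split => //; rewrite preimage_setT setIT.
exists setT, ((fun x : 'rV[R]_n => x ord0 j) @^-1` A); split => //.
  by rewrite -[X in measurable X]setTI; exact: measurable_coord.
rewrite preimage_setT setTI -comp_preimage; congr (_ @^-1` A).
by apply/funext => x; rewrite /= mxE.
Qed.

Definition torus_phase p (k : 'rV[int]_p) (x : 'rV[R]_p) : R := dotv (freq k) x.

Definition int_head (k : 'rV[int]_n.+1) : int := k ord0 ord0.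

Definition int_tail (k : 'rV[int]_n.+1) : 'rV[int]_n := \row_i k ord0 (lift ord0 i).

Definition int_cons (k : int) (l : 'rV[int]_n) : 'rV[int]_n.+1 :=
  \row_i (if unlift ord0 i is Some j then l ord0 j else k).

Lemma int_consK k : int_cons (int_head k) (int_tail k) = k.
Proof. by apply/rowP => i; rewrite mxE; case: unliftP => [j|] -> //; rewrite mxE. Qed.

Lemma int_head_cons k l : int_head (int_cons k l) = k.
Proof. by rewrite /int_head mxE unlift_none. Qed.

Lemma int_tail_cons k l : int_tail (int_cons k l) = l.
Proof. by apply/rowP => i; rewrite !mxE liftK. Qed.

Lemma torus_phaseS (k : 'rV[int]_n.+1) (x : 'rV[R]_n.+1) :
  torus_phase k x = circle_phase (int_head k) (rV_head x) + torus_phase (int_tail k) (rV_tail x).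
Proof.
rewrite /torus_phase /dotv big_ord_recl mxE; congr (_ + _).
by apply: eq_bigr => i _; rewrite !mxE.
Qed.

Let torus := @torus_measure R.
Hypothesis on : orthogonal_phases (torus n) (@torus_phase n).
Hypothesis cn : complete_phases (torus n) (@torus_phase n).
Let oc := @circle_orthogonal R.

Let bnd_cos (U : Type) (f : U -> R) x : `|cos (f x)| <= 1. Proof. exact: cos_max. Qed.
Let bnd_sin (U : Type) (f : U -> R) x : `|sin (f x)| <= 1. Proof. exact: sin_max. Qed.

Let itensor (a : R -> R) (b : 'rV[R]_n -> R) (ca cb : R) :
  measurable_fun [set: measurableTypeR R] a -> measurable_fun setT b ->
  (forall x, `|a x| <= ca) -> (forall y, `|b y| <= cb) ->
  rintegrable (torus n.+1) (fun x => a (rV_head x) * b (rV_tail x)).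
Proof.
move=> ma mb aca bcb; apply: (@rintegrable_bounded _ _ _ _ _ (ca * cb)).
  by apply: measurable_funM; apply: measurableT_comp => //;
    [exact: measurable_rV_head|exact: measurable_rV_tail].
by move=> x; rewrite normrM ler_pM.
Qed.

Lemma torus_massS : mass (torus n.+1) = mass (@circle_measure R) * mass (torus n).
Proof.
have H : \int[torus_measure n.+1]__ (1 * 1) =
    \int[@circle_measure R]__ 1 * \int[torus_measure n]__ (1 : R).
  by apply: (@torus_tensor (fun=> 1) (fun=> 1) 1 1) => // x; rewrite normr1.
by rewrite !Rintegral_cst// !mul1r in H.
Qed.

Lemma torus_orthogonalS : orthogonal_phases (torus n.+1) (@torus_phase n.+1).
Proof.
have [mc mphic occ ocs] := oc; have [mn mphin onc ons] := on.
have phB k l x : torus_phase k x - torus_phase l x =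
   (circle_phase (int_head k) (rV_head x) - circle_phase (int_head l) (rV_head x)) +
   (torus_phase (int_tail k) (rV_tail x) - torus_phase (int_tail l) (rV_tail x)).
  by rewrite !torus_phaseS; ring.
have m1 k l : measurable_fun [set: measurableTypeR R]
    (fun x : R => circle_phase k x - circle_phase l x) by exact: measurable_funB.
have m2 (k l : 'rV[int]_n) : measurable_fun setT (fun x => torus_phase k x - torus_phase l x :> R).
  by apply: measurable_funB; exact: mphin.
split.
- by rewrite torus_massS mulr_gt0.
- move=> k.
  have -> : torus_phase k = (fun x =>
      circle_phase (int_head k) (rV_head x) + torus_phase (int_tail k) (rV_tail x)) :> (_ -> R).
    by apply/funext => x; rewrite torus_phaseS.
  apply: measurable_funD; apply: measurableT_comp.
  + exact: mphic.
  + exact: measurable_rV_head.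
  + exact: mphin.
  + exact: measurable_rV_tail.
- move=> k l; under eq_Rintegral do rewrite phB cosD.
  rewrite RintegralB//; last 2 first.
  + exact: (itensor (measurable_cos (m1 _ _)) (measurable_cos (m2 _ _)) (bnd_cos _) (bnd_cos _)).
  + exact: (itensor (measurable_sin (m1 _ _)) (measurable_sin (m2 _ _)) (bnd_sin _) (bnd_sin _)).
  rewrite (torus_tensor (measurable_cos (m1 _ _)) (measurable_cos (m2 _ _)) (bnd_cos _) (bnd_cos _)).
  rewrite (torus_tensor (measurable_sin (m1 _ _)) (measurable_sin (m2 _ _)) (bnd_sin _) (bnd_sin _)).
  rewrite occ onc ocs mul0r subr0 torus_massS.
  have -> : (k == l) = (int_head k == int_head l) && (int_tail k == int_tail l).
    apply/eqP/andP => [->|[/eqP h /eqP t]]; first by rewrite !eqxx.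
    by rewrite -[k]int_consK -[l]int_consK h t.
  by case: eqP => _; case: eqP => _; rewrite ?mulr0 ?mul0r.
- move=> k l; under eq_Rintegral do rewrite phB sinD.
  rewrite RintegralD//; last 2 first.
  + exact: (itensor (measurable_sin (m1 _ _)) (measurable_cos (m2 _ _)) (bnd_sin _) (bnd_cos _)).
  + exact: (itensor (measurable_cos (m1 _ _)) (measurable_sin (m2 _ _)) (bnd_cos _) (bnd_sin _)).
  rewrite (torus_tensor (measurable_cos (m1 _ _)) (measurable_sin (m2 _ _)) (bnd_cos _) (bnd_sin _)).
  rewrite (torus_tensor (measurable_sin (m1 _ _)) (measurable_cos (m2 _ _)) (bnd_sin _) (bnd_cos _)).
  by rewrite ocs ons mul0r mulr0 addr0.
Qed.

(** Complex Fourier coefficients of a tensor product multiply, and so do their squared moduli. On a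
    product of frequency sets the partial sum of energies is therefore the product of the two
    partial sums. *)
Lemma tensor_parseval (a : R -> R) (b : 'rV[R]_n -> R) (ca cb : R) :
  measurable_fun [set: measurableTypeR R] a -> measurable_fun setT b ->
  (forall x, `|a x| <= ca) -> (forall y, `|b y| <= cb) ->
  parseval_fun (torus n.+1) (@torus_phase n.+1) (fun x => a (rV_head x) * b (rV_tail x)).
Proof.
move=> ma mb aca bcb.
have [mc mphic _ _] := oc; have [mn mphin _ _] := on.
have mv : measurable_fun setT (fun x : 'rV[R]_n.+1 => a (rV_head x) * b (rV_tail x)).
  by apply: measurable_funM; apply: measurableT_comp => //;
    [exact: measurable_rV_head|exact: measurable_rV_tail].
split.
  by apply: (@sqint_bounded _ _ _ _ _ (ca * cb)) => // x; rewrite normrM ler_pM.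
have bM (U : Type) (g h : U -> R) c : (forall x, `|g x| <= c) -> (forall x, `|h x| <= 1) ->
    forall x, `|g x * h x| <= c.
  by move=> gc h1 x; rewrite normrM -[c]mulr1 ler_pM.
have mac k : measurable_fun [set: measurableTypeR R] (fun x => a x * cos (circle_phase k x)).
  by apply: measurable_funM => //; apply: measurable_cos.
have mas k : measurable_fun [set: measurableTypeR R] (fun x => a x * sin (circle_phase k x)).
  by apply: measurable_funM => //; apply: measurable_sin.
have mbc k : measurable_fun setT (fun x => b x * cos (torus_phase k x)).
  by apply: measurable_funM => //; apply: measurable_cos.
have mbs k : measurable_fun setT (fun x => b x * sin (torus_phase k x)).
  by apply: measurable_funM => //; apply: measurable_sin.
have bac k := bM _ _ _ _ aca (bnd_cos (circle_phase k)).
have bas k := bM _ _ _ _ aca (bnd_sin (circle_phase k)).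
have bbc (k : 'rV[int]_n) := bM _ _ _ _ bcb (bnd_cos (torus_phase k)).
have bbs (k : 'rV[int]_n) := bM _ _ _ _ bcb (bnd_sin (torus_phase k)).
pose A := cosc (@circle_measure R) (@circle_phase R) a.
pose A' := sinc (@circle_measure R) (@circle_phase R) a.
pose B := cosc (torus n) (@torus_phase n) b.
pose B' := sinc (torus n) (@torus_phase n) b.
pose v (x : 'rV[R]_n.+1) := a (rV_head x) * b (rV_tail x).
have C k : cosc (torus n.+1) (@torus_phase n.+1) v k =
    A (int_head k) * B (int_tail k) - A' (int_head k) * B' (int_tail k).
  rewrite /cosc.
  rewrite -(torus_tensor (mac _) (mbc _) (bac _) (bbc _)) -(torus_tensor (mas _) (mbs _) (bas _) (bbs _)).
  rewrite -RintegralB//; last 2 first.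
    exact: (itensor (mac _) (mbc _) (bac _) (bbc _)).
    exact: (itensor (mas _) (mbs _) (bas _) (bbs _)).
  by apply: eq_Rintegral => x _; rewrite torus_phaseS cosD /v; ring.
have S k : sinc (torus n.+1) (@torus_phase n.+1) v k =
    A' (int_head k) * B (int_tail k) + A (int_head k) * B' (int_tail k).
  rewrite /sinc.
  rewrite -(torus_tensor (mas _) (mbc _) (bas _) (bbc _)) -(torus_tensor (mac _) (mbs _) (bac _) (bbs _)).
  rewrite -RintegralD//; last 2 first.
    exact: (itensor (mas _) (mbc _) (bas _) (bbc _)).
    exact: (itensor (mac _) (mbs _) (bac _) (bbs _)).
  by apply: eq_Rintegral => x _; rewrite torus_phaseS sinD /v; ring.
have sa := sqint_bounded circle ma aca; have sb := sqint_bounded (torus n) mb bcb.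
pose X := \int[circle]_x (a x * a x); pose Y := \int[torus n]_x (b x * b x).
have X0 : 0 <= X by apply: Rintegral_ge0 => x _; rewrite -expr2 sqr_ge0.
have Y0 : 0 <= Y by apply: Rintegral_ge0 => x _; rewrite -expr2 sqr_ge0.
have XY : \int[torus n.+1]_x (v x * v x) = X * Y.
  have b2 (U : Type) (g : U -> R) c : (forall x, `|g x| <= c) -> forall x, `|g x * g x| <= c * c.
    by move=> gc x; rewrite normrM ler_pM.
  rewrite -(torus_tensor (measurable_funM ma ma) (measurable_funM mb mb) (b2 _ _ _ aca) (b2 _ _ _ bcb)).
  by apply: eq_Rintegral => x _; rewrite /v /=; ring.
(* The final bound is [(X + Y) e']; the added 1 keeps the denominator positive when both norms
   vanish. *)
move=> e e0; pose e' := e / (X + Y + 1).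
have e'0 : 0 < e' by rewrite divr_gt0// ltr_wpDl// addr_ge0.
have [_ /(_ _ e'0)[F1 u1 d1]] := circle_complete sa.
have [_ /(_ _ e'0)[F2 u2 d2]] := cn sb.
have d10 := bessel oc u1 sa; have d20 := bessel on u2 sb.
exists [seq int_cons k l | k <- F1, l <- F2].
  apply: allpairs_uniq => // -[k l] [k' l'] _ _ /= H.
  have := congr1 int_tail H; have := congr1 int_head H.
  by rewrite !int_head_cons !int_tail_cons => -> ->.
rewrite /defect XY big_allpairs_dep /= torus_massS.
have -> : \sum_(k <- F1) \sum_(l <- F2)
     (cosc (torus n.+1) (@torus_phase n.+1) v (int_cons k l) * cosc (torus n.+1) (@torus_phase n.+1) v (int_cons k l) +
      sinc (torus n.+1) (@torus_phase n.+1) v (int_cons k l) * sinc (torus n.+1) (@torus_phase n.+1) v (int_cons k l)) =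
   (\sum_(k <- F1) (A k * A k + A' k * A' k)) * (\sum_(l <- F2) (B l * B l + B' l * B' l)).
  rewrite mulr_suml; apply: eq_bigr => k _; rewrite mulr_sumr; apply: eq_bigr => l _.
  by rewrite C S int_head_cons int_tail_cons; ring.
rewrite /defect -/A -/A' -/X in d1 d10; rewrite /defect -/B -/B' -/Y in d2 d20.
set S1 := \sum_(k <- F1) _ in d1 d10 *; set S2 := \sum_(k <- F2) _ in d2 d20 *.
rewrite invfM mulrACA; set X' := _ * S1 in d1 d10 *; set Y' := _ * S2 in d2 d20 *.
have eE : e = e' * (X + Y + 1) by rewrite /e' divfK// gt_eqF// ltr_wpDl// addr_ge0.
(* The right side exceeds [X Y - X' Y'] by [(X - X') (Y - Y')], which is nonnegative by Bessel in
   each factor. *)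
apply: (@le_trans _ _ (X * (Y - Y') + Y * (X - X'))).
  have := mulr_ge0 d10 d20; lra.
have := ler_wpM2l X0 d2; have := ler_wpM2l Y0 d1; rewrite eE; lra.
Qed.

Lemma torus_completeS : complete_phases (torus n.+1) (@torus_phase n.+1).
Proof.
have oS' := torus_orthogonalS.
have i1 (U : Type) (A : set U) x : `|\1_A x : R| <= 1.
  by rewrite indicE; case: (_ \in _); rewrite ?normr1 ?normr0.
apply: (parseval_monotone_class oS' rectangles_setI rectangles_measurable).
  have := @tensor_parseval (fun=> 1) (fun=> 1) 1 1.
  rewrite mulr1; apply => //; move=> x; by rewrite normr1.
move=> _ [A [B [mA mB ->]]].
have -> : \1_(rV_head @^-1` A `&` rV_tail @^-1` B) =
  (fun x : 'rV[R]_n.+1 => (\1_A (rV_head x) : R) * \1_B (rV_tail x)).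
  by apply/funext => x; rewrite indicI /= !indicE.
by apply: (@tensor_parseval _ _ 1 1); [exact: measurable_indic|exact: measurable_indic|exact: i1|exact: i1].
Qed.

End torus_coordinates.

Lemma torus_orthogonal_complete (R : realType) n :
  orthogonal_phases (@torus_measure R n) (@torus_phase R n) /\
  complete_phases (@torus_measure R n) (@torus_phase R n).
Proof.
elim: n => [|n [on cn]]; last first.
  by split; [exact: torus_orthogonalS|exact: torus_completeS].
(* In dimension 0 the torus is a point carrying a unit mass, and 0 is the only frequency. *)
have e0 (x : 'rV[R]_0) : x = 0 by apply/rowP => -[].
have ph k (x : 'rV[R]_0) : torus_phase k x = 0 by rewrite /torus_phase /dotv big_ord0.
have cst (f : 'rV[R]_0 -> R) : f = fun=> f 0 by apply/funext => x; rewrite (e0 x).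
have m1 : mass (@torus_measure R 0) = 1 by apply: (@congr1 _ _ fine _ 1%E); exact: diracT.
have I (f : 'rV[R]_0 -> R) : \int[torus_measure 0]_x f x = f 0.
  by rewrite [f]cst Rintegral_cst// -/(mass _) m1 mulr1.
split.
  split.
  - by rewrite m1.
  - by move=> k; rewrite [torus_phase k]cst.
  - move=> k l; rewrite I !ph subrr cos0 m1 (_ : k == l)//.
    by apply/eqP/rowP => -[].
  - by move=> k l; rewrite I !ph subrr sin0.
move=> v sv; split => // e e1; exists [:: 0] => //.
rewrite /defect big_seq1 /cosc /sinc !I !ph cos0 sin0 m1.
by rewrite invr1 !mulr1 !mulr0 addr0 mul1r subrr ltW.
Qed.

Definition torus_orthogonal R n := (torus_orthogonal_complete R n).1.
Definition torus_complete R n := (torus_orthogonal_complete R n).2.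

(** * Multipliers and commutators on the torus *)

Lemma ler_sum_subset (R : numDomainType) (K : eqType) (A B : seq K) (g : K -> R) :
  uniq A -> uniq B -> {subset A <= B} -> (forall k, 0 <= g k) ->
  \sum_(k <- A) g k <= \sum_(k <- B) g k.
Proof.
move=> uA uB AB g0.
have p : perm_eq B (A ++ [seq k <- B | k \notin A]).
  apply: uniq_perm => //.
    rewrite cat_uniq uA filter_uniq// andbT.
    by apply/hasPn => k; rewrite mem_filter => /andP[].
  by move=> k; rewrite mem_cat mem_filter; have [/AB->|] := boolP (k \in A).
by rewrite (perm_big _ p) big_cat/= lerDl sumr_ge0.
Qed.

Lemma sum_subset_indicator (R : pzRingType) (K : eqType) (A B : seq K) (g : K -> R) :
  uniq A -> uniq B -> {subset A <= B} ->
  \sum_(k <- A) g k = \sum_(k <- B) (k \in A)%:R * g k.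
Proof.
move=> uA uB AB.
have p : perm_eq A [seq k <- B | k \in A].
  apply: uniq_perm => //; first exact: filter_uniq.
  by move=> k; rewrite mem_filter; have [/AB->|] := boolP (k \in A).
rewrite (perm_big _ p) big_filter big_mkcond; apply: eq_bigr => k _.
by case: ifP; rewrite ?mul1r ?mul0r.
Qed.

Section torus_multipliers.
Context {R : realType} {n : nat}.
Local Notation mu := (@torus_measure R n).
Local Notation ph := (@torus_phase R n).
Local Notation cosc := (cosc mu ph).
Local Notation sinc := (sinc mu ph).
Local Notation V := (mass mu).
Implicit Types (k xi : 'rV[int]_n) (F : seq 'rV[int]_n).

Let on := @torus_orthogonal R n.
Let cn := @torus_complete R n.

Lemma torus_mass_gt0 : 0 < V. Proof. by case: on. Qed.

Lemma torus_phaseD k xi x : ph (k + xi) x = ph k x + ph xi x.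
Proof.
rewrite /torus_phase /dotv -big_split; apply: eq_bigr => l _ /=.
by rewrite !mxE rmorphD mulrDl.
Qed.

Lemma torus_phaseN k x : ph (- k) x = - ph k x.
Proof.
rewrite /torus_phase /dotv -sumrN; apply: eq_bigr => l _ /=.
by rewrite !mxE rmorphN mulNr.
Qed.

Definition energy (v : 'rV[R]_n -> R) k := cosc v k ^+ 2 + sinc v k ^+ 2.

Lemma defectE F v : defect mu ph F v v =
  \int[mu]_x (v x ^+ 2) - V^-1 * \sum_(k <- F) energy v k.
Proof. by []. Qed.

Lemma bessel_sum F v : uniq F -> sqint mu v ->
  \sum_(k <- F) energy v k <= V * \int[mu]_x (v x ^+ 2).
Proof.
move=> uF sv; have := bessel on uF sv; rewrite defectE subr_ge0.
by rewrite ler_pdivrMl// torus_mass_gt0.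
Qed.

(** Bessel on the disjoint union [F ++ H]: energy outside [F] can only come out of the defect on
    [F]. *)
Lemma bessel_tail F H v e : uniq F -> uniq H -> (forall k, k \in H -> k \notin F) ->
  sqint mu v -> defect mu ph F v v <= e -> \sum_(k <- H) energy v k <= V * e.
Proof.
move=> uF uH FH sv dF.
have u : uniq (F ++ H).
  rewrite cat_uniq uF uH andbT /=; apply/hasPn => k kH; exact: FH.
have := bessel_sum u sv; rewrite big_cat/=.
have -> : \sum_(k <- F) energy v k = V * (\int[mu]_x (v x ^+ 2) - defect mu ph F v v).
  rewrite defectE opprB addrC subrK mulrA divff ?mul1r// gt_eqF//; exact: torus_mass_gt0.
rewrite mulrBr => H1; have := ler_wpM2l (ltW torus_mass_gt0) dF; lra.
Qed.

Lemma parseval_near v e : sqint mu v -> 0 < e ->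
  exists2 F0, uniq F0 & forall F, uniq F -> {subset F0 <= F} -> defect mu ph F v v <= e.
Proof.
move=> sv e0; have [_ /(_ _ e0)[F0 u0 d0]] := cn sv.
exists F0 => // F uF F0F; apply: le_trans d0.
exact: (defect_antitone on).
Qed.

(** Parseval for [u] up to an arbitrary error, then Bessel for [v] on the same finite set. *)
Lemma multiplier_bound (C : R) v u : sqint mu v -> sqint mu u ->
  (forall k, energy u k <= C ^+ 2 * energy v k) ->
  \int[mu]_x (u x ^+ 2) <= C ^+ 2 * \int[mu]_x (v x ^+ 2).
Proof.
move=> sv su uv; apply/ler_addgt0Pr => e e0.
have [F uF /(_ F uF (fun _ => id))] := parseval_near su e0.
rewrite defectE lerBlDr => /le_trans; apply.
rewrite addrC lerD2r ler_pdivrMl ?torus_mass_gt0//.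
apply: (@le_trans _ _ (C ^+ 2 * \sum_(k <- F) energy v k)).
  by rewrite mulr_sumr; apply: ler_sum => k _.
rewrite mulrCA; apply: ler_wpM2l; first exact: sqr_ge0.
exact: bessel_sum.
Qed.

(** With [c_k = cosc v k - i sinc v k], this is the real part of [c_k] times the conjugate of
    [c_(k + xi)]. *)
Definition correlation v xi k := cosc v k * cosc v (k + xi) + sinc v k * sinc v (k + xi).

Lemma correlation_le v xi k :
  `|correlation v xi k| <= 2^-1 * (energy v k + energy v (k + xi)).
Proof.
rewrite /correlation /energy ler_norml.
set a := cosc v k; set b := sinc v k; set c := cosc v _; set d := sinc v _.
have := sqr_ge0 (a - c); have := sqr_ge0 (a + c); have := sqr_ge0 (b - d); have := sqr_ge0 (b + d).
by move=> *; apply/andP; split; nra.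
Qed.

Lemma sum_correlation_le H v xi e :
  \sum_(k <- H) energy v k <= e -> \sum_(k <- [seq k + xi | k <- H]) energy v k <= e ->
  \sum_(k <- H) `|correlation v xi k| <= e.
Proof.
rewrite big_map => h1 h2.
apply: (@le_trans _ _ (\sum_(k <- H) 2^-1 * (energy v k + energy v (k + xi)))).
  by apply: ler_sum => k _; exact: correlation_le.
by rewrite -mulr_sumr big_split/=; lra.
Qed.

(** * The commutator estimate *)

Section commutator.
Variables (theta w : 'rV[R]_n -> R) (sigma : 'rV[int]_n -> R) (xi : 'rV[int]_n).
Variables (C e : R) (Fe : seq 'rV[int]_n).
Hypotheses (st : sqint mu theta) (sw : sqint mu w).
(** In complex form the coefficients of [w] are [i sigma k] times those of [theta]. *)
Hypotheses (wc : forall k, cosc w k = sigma k * sinc theta k)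
           (ws : forall k, sinc w k = - sigma k * cosc theta k).
Hypotheses (sC : forall k, `|sigma k| <= C) (e0 : 0 <= e) (uFe : uniq Fe).
Hypothesis se : forall k, k \notin Fe -> `|sigma k - sigma (k + xi)| <= e.

Let G := correlation theta xi.
Let v x := theta x * sin (ph xi x).

Let mph k : measurable_fun setT (ph k). Proof. by case: on. Qed.

Let sqcos k : sqint mu (fun x => cos (ph k x)). Proof. exact: sqint_cos. Qed.
Let sqsin k : sqint mu (fun x => sin (ph k x)). Proof. exact: sqint_sin. Qed.
Let msin k : measurable_fun setT (fun x => sin (ph k x)). Proof. by case: (sqsin k). Qed.

Let sv : sqint mu v.
Proof.
have [mt _] := st; apply: (sqint_le _ _ st); first exact: measurable_funM.
by move=> x; rewrite normrM ler_piMr// sin_max.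
Qed.

Let vc k : cosc v k = 2^-1 * (sinc theta (k + xi) - sinc theta (k - xi)).
Proof.
rewrite /cosc /sinc -RintegralB//; try exact: sqintM.
rewrite -RintegralZl//; last by apply: rintegrableB; exact: sqintM.
apply: eq_Rintegral => x _; rewrite /v !torus_phaseD torus_phaseN sinD sinB.
by set s := sin (ph xi x); set s' := sin (ph k x); set c := cos (ph xi x); set c' := cos (ph k x); lra.
Qed.

Let vs k : sinc v k = 2^-1 * (cosc theta (k - xi) - cosc theta (k + xi)).
Proof.
rewrite /cosc /sinc -RintegralB//; try exact: sqintM.
rewrite -RintegralZl//; last by apply: rintegrableB; exact: sqintM.
apply: eq_Rintegral => x _; rewrite /v !torus_phaseD torus_phaseN cosB cosD.
by set s := sin (ph xi x); set s' := sin (ph k x); set c := cos (ph xi x); set c' := cos (ph k x); lra.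
Qed.

Let C0 : 0 <= C. Proof. exact: le_trans (sC 0). Qed.

(** Summation by parts on a finite set leaves boundary terms. The three summands of the bound are:
    pairs [k], [k + xi] with [k] in [Fe], where only boundedness of [sigma] is used; interior pairs
    outside [Fe], where [sigma] varies by at most [e]; and boundary pairs, which avoid [F0] and are
    absorbed by the Bessel tail of [theta]. *)
Let sum_bound F0 F d : uniq F0 -> defect mu ph F0 theta theta <= d -> uniq F ->
  {subset F0 <= F} -> {subset [seq k + xi | k <- F0] <= F} ->
  {subset [seq k - xi | k <- F0] <= F} ->
  `|\sum_(k <- F) sigma k * (G k - G (k - xi))| <=
  2 * C * \sum_(k <- Fe) `|G k| + e * (V * \int[mu]_x (theta x ^+ 2)) + C * (V * d).
Proof.
move=> u0 d0 uF s0 s1 s2.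
have ui : injective (fun k => k - xi) by exact: addIr.
have ui' : injective (fun k => k + xi) by exact: addIr.
pose F' := undup (F ++ [seq k - xi | k <- F]).
have uF' : uniq F' by exact: undup_uniq.
have inF k : k \in F -> k \in F' by rewrite mem_undup mem_cat => ->.
have inFs k : k + xi \in F -> k \in F'.
  move=> kF; rewrite mem_undup mem_cat; apply/orP; right.
  by apply/mapP; exists (k + xi); rewrite // addrK.
have uFs : uniq [seq k - xi | k <- F] by rewrite map_inj_uniq.
have memFs k : (k \in [seq k - xi | k <- F]) = (k + xi \in F).
  by rewrite -{1}[k](addrK xi) (mem_map ui).
have memF0 k : (k - xi \in F0) -> k \in F.
  by move=> kF; apply: s1; rewrite -[k](subrK xi) (map_f (fun k => k + xi)).
have memF0' k : (k + xi \in F0) -> k \in F.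
  by move=> kF; apply: s2; rewrite -[k](addrK xi) (map_f (fun k => k - xi)).
(* Indicators of [F] and of its translate allow both halves of the difference to be summed over the
   one set [F']. *)
pose t k := ((k \in F)%:R * sigma k - (k + xi \in F)%:R * sigma (k + xi)) * G k.
have -> : \sum_(k <- F) sigma k * (G k - G (k - xi)) = \sum_(k <- F') t k.
  under eq_bigr do rewrite mulrBr.
  rewrite big_split/= sumrN.
  have -> : \sum_(k <- F) sigma k * G (k - xi) =
            \sum_(k <- [seq k - xi | k <- F]) sigma (k + xi) * G k.
    by rewrite big_map; apply: eq_bigr => k _; rewrite subrK.
  rewrite (sum_subset_indicator _ uF uF')//.
  rewrite (sum_subset_indicator _ uFs uF'); last by move=> k; rewrite memFs; exact: inFs.
  rewrite -sumrN -big_split; apply: eq_bigr => k _ /=.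
  by rewrite /t memFs; ring.
pose H := [seq k <- F' | (k \notin F0) && (k + xi \notin F0)].
have uH : uniq H by exact: filter_uniq.
have tk k : `|t k| <= (k \in Fe)%:R * (2 * C * `|G k|) + e * `|G k| +
    (if (k \notin F0) && (k + xi \notin F0) then C * `|G k| else 0).
  rewrite /t normrM.
  have cg : 0 <= C * `|G k| by rewrite mulr_ge0.
  have eg : 0 <= e * `|G k| by rewrite mulr_ge0.
  have fg : 0 <= (k \in Fe)%:R * (2 * C * `|G k|) by rewrite !mulr_ge0.
  have ig : 0 <= (if (k \notin F0) && (k + xi \notin F0) then C * `|G k| else 0).
    by case: ifP.
  (* [F] contains [F0] and both of its translates by [xi], so a pair that leaves [F] at one end
     misses [F0] at both. *)
  have out : (k \notin F) || (k + xi \notin F) -> (k \notin F0) && (k + xi \notin F0).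
    case/orP => kF; apply/andP; split.
    - by apply: contra kF; exact: s0.
    - by apply: contra kF; exact: memF0'.
    - by apply: contra kF => kF; apply: memF0; rewrite addrK.
    - by apply: contra kF; exact: s0.
  have [kF|kF] := boolP (k \in F); have [lF|lF] := boolP (k + xi \in F).
  - rewrite !mul1r; have [kFe|kFe] := boolP (k \in Fe).
      apply: (@le_trans _ _ (2 * C * `|G k|)); last by rewrite mul1r -addrA lerDl addr_ge0.
      apply: ler_wpM2r => //; apply: le_trans (ler_normB _ _) _.
      by have := sC k; have := sC (k + xi); lra.
    apply: (@le_trans _ _ (e * `|G k|)); last by rewrite mul0r add0r lerDl.
    by apply: ler_wpM2r => //; exact: se.
  - rewrite out ?lF ?orbT// mul1r mul0r subr0.
    apply: (@le_trans _ _ (C * `|G k|)); first exact: ler_wpM2r.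
    by rewrite lerDr addr_ge0.
  - rewrite out ?kF// mul1r mul0r sub0r normrN.
    apply: (@le_trans _ _ (C * `|G k|)); first exact: ler_wpM2r.
    by rewrite lerDr addr_ge0.
  - by rewrite !mul0r subrr normr0 mul0r !addr_ge0.
apply: le_trans (ler_norm_sum _ _ _) _.
apply: (@le_trans _ _ (\sum_(k <- F') ((k \in Fe)%:R * (2 * C * `|G k|) + e * `|G k| +
    (if (k \notin F0) && (k + xi \notin F0) then C * `|G k| else 0)))).
  by apply: ler_sum => k _; exact: tk.
rewrite !big_split/=; apply: lerD; first apply: lerD.
- have -> : \sum_(k <- F') (k \in Fe)%:R * (2 * C * `|G k|) =
            \sum_(k <- [seq k <- F' | k \in Fe]) 2 * C * `|G k|.
    rewrite big_filter [RHS]big_mkcond; apply: eq_bigr => k _.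
    by case: ifP; rewrite ?mul1r ?mul0r.
  rewrite mulr_sumr; apply: ler_sum_subset => //; first exact: filter_uniq.
    by move=> k; rewrite mem_filter => /andP[].
  by move=> k; rewrite !mulr_ge0.
- rewrite -mulr_sumr; apply: ler_wpM2l => //; apply: sum_correlation_le.
    exact: bessel_sum.
  by apply: bessel_sum => //; rewrite map_inj_uniq.
- rewrite -big_mkcond -big_filter -mulr_sumr; apply: ler_wpM2l => //.
  apply: sum_correlation_le; apply: (bessel_tail u0 _ _ st d0) => //.
  + by move=> k; rewrite mem_filter => /andP[/andP[]].
  + by rewrite map_inj_uniq.
  + by move=> _ /mapP[k + ->]; rewrite mem_filter => /andP[/andP[]].
Qed.

(* By Parseval the integral is [(2 V)^-1 sum_k sigma_k (G_k - G_(k - xi))], with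
   [G] the correlation of [theta]; summation by parts moves the difference onto
   [sigma], which varies slowly outside [Fe]. *)
Lemma commutator_bound :
  `|\int[mu]_x (theta x * w x * sin (ph xi x))| <=
  V^-1 * C * \sum_(k <- Fe) `|correlation theta xi k| + e * \int[mu]_x (theta x ^+ 2).
Proof.
have Vp := torus_mass_gt0; have V0 : V != 0 by rewrite gt_eqF.
(* [2 d'] pays for the defect between [v] and [w], and [C d'] for the boundary terms. *)
apply/ler_addgt0Pr => d d0; pose d' := d / (2 + C).
have C2 : 0 < 2 + C by rewrite ltr_wpDr.
have d'0 : 0 < d' by rewrite divr_gt0.
have [F0 u0 D0] := parseval_near st d'0.
have [F1 u1 D1] := parseval_near sv d'0.
have [F2 u2 D2] := parseval_near sw d'0.
pose F := undup (F0 ++ F1 ++ F2 ++ [seq k + xi | k <- F0] ++ [seq k - xi | k <- F0]).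
have uF : uniq F by exact: undup_uniq.
have sub (D : seq 'rV[int]_n) : {subset D <= F0 ++ F1 ++ F2 ++ [seq k + xi | k <- F0] ++ [seq k - xi | k <- F0]} ->
    {subset D <= F}.
  by move=> H k /H; rewrite mem_undup.
have s0 : {subset F0 <= F} by apply: sub => k kF; rewrite !mem_cat kF.
have s1 : {subset F1 <= F} by apply: sub => k kF; rewrite !mem_cat kF !orbT.
have s2 : {subset F2 <= F} by apply: sub => k kF; rewrite !mem_cat kF !orbT.
have s3 : {subset [seq k + xi | k <- F0] <= F} by apply: sub => k kF; rewrite !mem_cat kF !orbT.
have s4 : {subset [seq k - xi | k <- F0] <= F} by apply: sub => k kF; rewrite !mem_cat kF !orbT.
have B := sum_bound u0 (D0 _ u0 (fun _ => id)) uF s0 s3 s4.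
have P := defect_polar on uF sv sw.
have {}P : `|defect mu ph F v w| <= 2 * d'.
  by have := D1 _ uF s1; have := D2 _ uF s2; lra.
have E : \int[mu]_x (theta x * w x * sin (ph xi x)) = defect mu ph F v w +
    V^-1 * 2^-1 * \sum_(k <- F) sigma k * (G k - G (k - xi)).
  rewrite /defect -mulrA.
  have -> : \sum_(k <- F) (cosc v k * cosc w k + sinc v k * sinc w k) =
     2^-1 * \sum_(k <- F) sigma k * (G k - G (k - xi)).
    rewrite mulr_sumr; apply: eq_bigr => k _; rewrite vc vs wc ws /G /correlation subrK; ring.
  rewrite subrK; apply: eq_Rintegral => x _; rewrite /v; ring.
rewrite E; apply: le_trans (ler_normD _ _) _.
have V2 : 0 < V^-1 * 2^-1 by rewrite mulr_gt0 ?invr_gt0.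
rewrite [X in _ + X]normrM (gtr0_norm V2).
have := ler_wpM2l (ltW V2) B.
set S := \sum_(k <- Fe) _; set S' := `|\sum_(k <- F) _|; set J := Rintegral _ _ _.
have -> : V^-1 * 2^-1 * (2 * C * S + e * (V * J) + C * (V * d')) =
   V^-1 * C * S + 2^-1 * (e * J) + 2^-1 * (C * d') by field.
have J0 : 0 <= J by apply: Rintegral_ge0 => x _; exact: sqr_ge0.
have eJ := mulr_ge0 e0 J0.
have -> : d = 2 * d' + C * d' by rewrite -mulrDl /d' mulrC divfK// gt_eqF.
have := mulr_ge0 C0 (ltW d'0); lra.
Qed.

End commutator.
End torus_multipliers.

(** * Regularity in time *)

Section line_integrals.
Context {R : realType}.
Local Notation leb := (@lebesgue_measure R).
Implicit Types (g a : R -> R).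

Lemma rintegrable_itv_bounded g c p q : measurable_fun [set: measurableTypeR R] g ->
  (forall x, `|g x| <= c) -> (forall x, x \notin `[p, q] -> g x = 0) ->
  rintegrable leb g.
Proof.
move=> mg gc g0.
have gE : g = g \_ `[p, q].
  apply/funext => x; rewrite patchE; case: ifP => // /negbT.
  by rewrite notin_setE => xpq; apply: g0; apply/negP.
have -> : EFin \o g = (EFin \o g) \_ `[p, q].
  by apply/funext => x; rewrite patchE /=; case: ifP => // H; rewrite {1}gE patchE H.
have mD : measurable (`[p, q]%classic : set (measurableTypeR R)) by exact: measurable_itv.
apply/(@integrable_mkcond _ _ _ leb _ (EFin \o g) mD).
apply: measurable_bounded_integrable => //.
- exact: compact_finite_measure (@segment_compact _ p q).
- exact: measurable_funTS.
- exists c; split; first exact: num_real.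
  by move=> M cM x _; exact: le_trans (gc x) (ltW cM).
Qed.

Lemma Rintegral_support g p q : (forall x, x \notin `[p, q] -> g x = 0) ->
  \int[leb]_x g x = \int[leb]_(x in `[p, q]) g x.
Proof.
move=> g0; rewrite [RHS]Rintegral_mkcond; apply: eq_Rintegral => x _.
rewrite patchE; case: ifP => // /negbT.
by rewrite notin_setE => xpq; apply: g0; apply/negP.
Qed.

Lemma smooth_measurable g : smooth_on setT g -> measurable_fun [set: measurableTypeR R] g.
Proof. by move=> sg; apply: continuous_measurable_fun; exact: smooth_continuous. Qed.

Lemma Rintegral_derive g p q : smooth_on setT g -> p < q ->
  (forall x, x \notin `[p, q] -> 'D_1 g x = 0) -> \int[leb]_x 'D_1 g x = g q - g p.
Proof.
move=> sg pq g0; rewrite (Rintegral_support g0) /Rintegral.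
have cg := smooth_continuous sg.
rewrite (@continuous_FTC2 _ ('D_1 g) g)//.
- by apply: continuous_subspaceT; apply: smooth_continuous; exact: smooth_derive.
- split.
  + by move=> x _; exact: smooth_derivable.
  + by apply: cvg_at_right_filter; exact: cg.
  + by apply: cvg_at_left_filter; exact: cg.
- by move=> x _; rewrite derive1E.
Qed.

Definition compactly_supported g := exists A : R, forall t, A < `|t| -> g t = 0.

Lemma compactly_supported_bounded g : continuous g -> compactly_supported g ->
  exists c, forall t, `|g t| <= c.
Proof.
move=> cg [A gA].
have A0 : - `|A| <= `|A| by rewrite lerNl (le_trans _ (normr_ge0 _))// oppr_le0.
have cn : {within `[- `|A|, `|A|], continuous (fun x => `|g x|)}.
  by apply: continuous_subspaceT => x; apply: cvg_norm; exact: cg.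
have [c _ Hc] := EVT_max A0 cn.
exists (Num.max `|g c| 0) => t; rewrite le_max.
have [At|At] := ltP `|A| `|t|.
  by rewrite gA ?normr0 ?lexx ?orbT// (le_lt_trans (ler_norm A)).
by rewrite Hc// in_itv/= -ler_norml.
Qed.

Lemma compactly_supported_derive g : compactly_supported g -> compactly_supported ('D_1 g).
Proof.
move=> [A gA]; exists A => t At.
apply: (@derive_eq0_outside _ _ 0 [set t | A < `|t|]) => //.
rewrite (_ : [set t | A < `|t|] = (fun t : R => `|t|) @^-1` `]A, +oo[); last first.
  by apply/seteqP; split=> x /=; rewrite in_itv/= andbT.
apply: open_comp => // x _; exact: norm_continuous.
Qed.

Lemma compactly_supported_notin g : compactly_supported g ->
  exists A, forall x, x \notin `[- A, A] -> g x = 0.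
Proof. by move=> [A gA]; exists A => x; rewrite in_itv/= -ler_norml -ltNge; exact: gA. Qed.

Lemma rintegrable_compactly_supported a g M : measurable_fun [set: measurableTypeR R] a ->
  (forall t, `|a t| <= M) -> smooth_on setT g -> compactly_supported g ->
  rintegrable leb (fun t => a t * g t).
Proof.
move=> ma aM sg kg.
have [c gc] := compactly_supported_bounded (smooth_continuous sg) kg.
have [A gA] := compactly_supported_notin kg.
apply: (@rintegrable_itv_bounded _ (M * c) (- A) A).
- by apply: measurable_funM => //; exact: smooth_measurable.
- by move=> x; rewrite normrM ler_pM.
- by move=> x /gA ->; rewrite mulr0.
Qed.

(** A kernel of unit mass supported in [[t - h, t + h]]. Writing it as the derivative of a step
    makes the difference of two kernels the derivative of a compactly supported function, the form
    to which a weak Lipschitz bound applies. *)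
Definition mollifier (h t : R) : R -> R := 'D_1 (fun s => stepR (h^-1 * s + - (h^-1 * t))).

Let smooth_scaled (h t : R) : smooth_on setT (fun s : R => stepR (h^-1 * s + - (h^-1 * t))).
Proof. exact: smooth_affine (@smooth_stepR R). Qed.

Lemma mollifier_smooth h t : smooth_on setT (mollifier h t).
Proof. by apply: smooth_derive; exact: smooth_scaled. Qed.

Let scaled_eq0 h t s : 0 < h -> s <= t - h -> stepR (h^-1 * s + - (h^-1 * t)) = 0 :> R.
Proof.
by move=> h0 st; apply: stepR_eq0; rewrite -mulrBr mulrC ler_pdivrMr// mulN1r; lra.
Qed.

Let scaled_eq1 h t s : 0 < h -> t + h <= s -> stepR (h^-1 * s + - (h^-1 * t)) = 1 :> R.
Proof.
by move=> h0 st; apply: stepR_eq1; rewrite -mulrBr mulrC ler_pdivlMr// mul1r; lra.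
Qed.

Lemma mollifier_eq0 h t s : 0 < h -> s \notin `[t - h, t + h] -> mollifier h t s = 0.
Proof.
move=> h0; rewrite in_itv/= negb_and -!ltNge => /orP[st|st].
  apply: (@derive_eq0_outside _ _ 0 `]-oo, (t - h)[%classic) => //=.
  by move=> y; rewrite in_itv/= => /ltW; exact: scaled_eq0.
apply: (@derive_eq0_outside _ _ 1 `](t + h), +oo[%classic) => //=.
  by rewrite in_itv/= andbT.
by move=> y; rewrite in_itv/= andbT => /ltW; exact: scaled_eq1.
Qed.

Lemma mollifier_integral h t : 0 < h -> \int[leb]_s mollifier h t s = 1.
Proof.
move=> h0; rewrite (@Rintegral_derive _ (t - h) (t + h)).
- by rewrite (@scaled_eq1 h t (t + h))// (@scaled_eq0 h t (t - h))// subr0.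
- exact: smooth_scaled.
- lra.
- by move=> x; exact: mollifier_eq0.
Qed.

Lemma mollifier_bounded : exists B : R, forall h t s, 0 < h -> `|mollifier h t s| <= B / h.
Proof.
have s0 : smooth_on setT ('D_1 (@stepR R)) by apply: smooth_derive; exact: smooth_stepR.
have k0 : compactly_supported ('D_1 (@stepR R)).
  exists 1 => t; have [t0|t0] := leP 0 t.
    rewrite ger0_norm// => t1; apply: (@derive_eq0_outside _ _ 1 `]1, +oo[%classic) => //=.
      by rewrite in_itv/= andbT.
    by move=> y; rewrite in_itv/= andbT => /ltW; exact: stepR_eq1.
  rewrite ltr0_norm// => t1; apply: (@derive_eq0_outside _ _ 0 `]-oo, (-1)[%classic) => //=.
    by rewrite in_itv/=; lra.
  by move=> y; rewrite in_itv/= => /ltW; exact: stepR_eq0.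
have [B HB] := compactly_supported_bounded (smooth_continuous s0) k0.
exists B => h t s h0; rewrite /mollifier derive_affine; last exact: smooth_stepR.
by rewrite normrM gtr0_norm ?invr_gt0// mulrC; apply: ler_wpM2r => //; rewrite invr_ge0 ltW.
Qed.

Lemma mollifier_compact h t : 0 < h -> compactly_supported (mollifier h t).
Proof.
move=> h0; exists (`|t| + h) => s st; apply: mollifier_eq0 => //.
apply/negP; rewrite in_itv/= => /andP[a b]; move: st; apply/negP; rewrite -leNgt.
by have := ler_norm t; have := ler_norm (- t); rewrite ler_norml normrN; lra.
Qed.

Lemma locally_integrable_bounded a M : measurable_fun [set: measurableTypeR R] a ->
  (forall t, `|a t| <= M) -> locally_integrable setT a.
Proof.
move=> ma aM; split => //; first exact: openT.
move=> K _ cK; have mK := compact_measurable cK.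
apply: (@le_lt_trans _ _ (\int[leb]_(x in K) M%:E)%E).
  apply: ge0_le_integral => //=.
  - by apply/measurable_EFinP; apply: measurableT_comp => //; exact: measurable_funTS.
  - by move=> x _; rewrite lee_fin (le_trans _ (aM x)).
rewrite integral_cst// lte_mul_pinfty//.
- by rewrite lee_fin (le_trans _ (aM 0)).
- exact: compact_finite_measure.
Qed.

Lemma lebesgue_segment (t h : R) : 0 < h -> leb `[t - h, t + h] = (2 * h)%:E.
Proof.
move=> h0; have := @lebesgue_measure_itv R `[t - h, t + h].
rewrite /= lte_fin ltrD2l gtrN// => ->; rewrite -EFinB; congr EFin; lra.
Qed.

Lemma mollifier_lebesgue_pt a M t : measurable_fun [set: measurableTypeR R] a ->
  (forall s, `|a s| <= M) -> lebesgue_pt a t ->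
  \int[leb]_s (a s * mollifier h t s) @[h --> 0^'+] --> a t.
Proof.
move=> ma aM pt; have [B HB] := mollifier_bounded.
have B0 : 0 <= B.
  by have := HB 1 0 0 ltr01; rewrite divr1; apply: le_trans.
have ca h : 0 < h -> rintegrable leb (fun s => `|a s - a t| * `|mollifier h t s|).
  move=> h0; have [c Hc] := compactly_supported_bounded
    (smooth_continuous (mollifier_smooth h t)) (mollifier_compact t h0).
  apply: (@rintegrable_itv_bounded _ (2 * M * c) (t - h) (t + h)).
  - apply: measurable_funM; apply: measurableT_comp => //; first exact: measurable_funB.
    exact: smooth_measurable (mollifier_smooth h t).
  - move=> x; rewrite normrM !normr_id ler_pM//.
    by apply: le_trans (ler_normB _ _) _; have := aM x; have := aM t; lra.
  - by move=> x /(mollifier_eq0 h0) ->; rewrite normr0 mulr0.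
(* The kernel is at most [B / h] and lives in the ball of radius [2 h], whose length is [4 h]; their
   product is [4 * B]. *)
have key h : 0 < h -> `|\int[leb]_s (a s * mollifier h t s) - a t| <=
    4 * B * fine (davg a t (2 * h)).
  move=> h0.
  have i1 := rintegrable_compactly_supported ma aM (mollifier_smooth h t) (mollifier_compact t h0).
  have i2 : rintegrable leb (fun s => a t * mollifier h t s).
    apply: (rintegrable_compactly_supported (M := `|a t|) _ _ (mollifier_smooth h t) (mollifier_compact t h0)) => //.
  have i3 : rintegrable leb (mollifier h t).
    have := rintegrable_compactly_supported (a := fun=> 1) (M := 1) (measurable_cst _) _
      (mollifier_smooth h t) (mollifier_compact t h0).
    under [X in _.-integrable _ (EFin \o X)]eq_fun do rewrite mul1r.
    by apply => s; rewrite normr1.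
  have e : \int[leb]_s (a t * mollifier h t s) = a t.
    by rewrite RintegralZl ?mollifier_integral ?mulr1.
  rewrite -[X in _ - X]e -RintegralB//.
  have i4 := rintegrableB i1 i2.
  apply: le_trans (le_normr_Rintegral measurableT i4) _.
  have -> : \int[leb]_s `|a s * mollifier h t s - a t * mollifier h t s| =
      \int[leb]_(s in ball t (2 * h)) (`|a s - a t| * `|mollifier h t s|).
    rewrite [RHS]Rintegral_mkcond; apply: eq_Rintegral => s _; rewrite patchE -mulrBl normrM.
    case: ifP => // /negbT; rewrite notin_setE => sb.
    rewrite mollifier_eq0 ?normr0 ?mulr0//; apply/negP; rewrite in_itv/= => /andP[s1 s2].
    by apply: sb; rewrite /ball/= ltr_norml; apply/andP; split; lra.
  have mb : measurable (ball t (2 * h) : set (measurableTypeR R)) by exact: measurable_ball.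
  have ib : leb.-integrable (ball t (2 * h)) (EFin \o (fun s => `|a s - a t|)).
    apply: measurable_bounded_integrable => //.
    - have Lb : leb (ball t (2 * h)) = (2 * h *+ 2)%:E.
        by apply: lebesgue_measure_ball; rewrite mulr_ge0// ltW.
      apply: (@le_lt_trans _ _ (2 * h *+ 2)%:E); last exact: ltry.
      by rewrite le_eqVlt; apply/orP; left; apply/eqP; exact: Lb.
    - by apply: measurableT_comp => //; apply: measurable_funTS; exact: measurable_funB.
    - exists (M + M); split; first exact: num_real.
      move=> x Mx s _; rewrite /= normr_id; apply: le_trans (ltW Mx).
      by apply: le_trans (ler_normB _ _) _; exact: lerD.
  apply: (@le_trans _ _ (\int[leb]_(s in ball t (2 * h)) (`|a s - a t| * (B / h)))).
    apply: le_Rintegral => //.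
    - by apply: integrableS (ca _ h0).
    - exact: (integrableZr _ (B / h) ib).
    - by move=> s _; apply: ler_wpM2l => //; exact: HB.
  have dE : davg a t (2 * h) =
      (((2 * h *+ 2)^-1)%:E * (\int[leb]_(s in ball t (2 * h)) (`|a s - a t|)%:E))%E.
    rewrite /davg /iavg lebesgue_measure_ball; last by rewrite mulr_ge0// ltW.
    by rewrite inver mulrn_eq0/= mulf_eq0 pnatr_eq0/= gt_eqF.
  rewrite RintegralZr// dE -(fineK (integrable_fin_num mb ib)) -EFinM /=.
  rewrite -[fine _]/(\int[leb]_(s in ball t (2 * h)) `|a s - a t|).
  set J := Rintegral _ _ _; rewrite mulrA -mulr_natr.
  rewrite le_eqVlt; apply/orP; left; apply/eqP; field.
  by rewrite gt_eqF.
have dv : fine (davg a t (2 * h)) @[h --> 0^'+] --> (0 : R).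
  have H : davg a t (2 * h) @[h --> 0^'+] --> (0 : R)%:E.
    apply: (cvg_comp (fun h => 2 * h) (davg a t)) pt.
    move=> /= P [e e0 He]; exists (e / 2) => /=; first by rewrite divr_gt0.
    move=> x /=; rewrite sub0r normrN => xe x0; apply: He; last by rewrite mulr_gt0.
    by rewrite /= sub0r normrN normrM ger0_norm// -ltr_pdivlMl// mulrC.
  exact: fine_cvg H.
apply/cvgrPdist_le => e e0.
have : 4 * B * fine (davg a t (2 * h)) @[h --> 0^'+] --> 4 * B * 0 by apply: cvgMr.
rewrite mulr0 => /cvgrPdist_le/(_ _ e0) H.
near=> h; have h0 : 0 < h by near: h; exact: nbhs_right_gt.
rewrite distrC; apply: le_trans (key _ h0) _.
have : `|0 - 4 * B * fine (davg a t (2 * h))| <= e by near: h.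
by rewrite sub0r normrN => /(le_trans (ler_norm _)).
Unshelve. all: by end_near. Qed.

(* The difference of the mollifiers at scales [h' < h] is the derivative of a
   function of integral at most [2 h]; then [h'] tends to [0] at a Lebesgue point
   of [a]. *)
Lemma mollifier_error a M L : measurable_fun [set: measurableTypeR R] a ->
  (forall s, `|a s| <= M) -> 0 <= L ->
  (forall g, smooth_on setT g -> compactly_supported g ->
     `|\int[leb]_s (a s * 'D_1 g s)| <= L * \int[leb]_s `|g s|) ->
  {ae leb, forall t, forall h, 0 < h ->
     `|a t - \int[leb]_s (a s * mollifier h t s)| <= 2 * L * h}.
Proof.
move=> ma aM L0 H.
apply: (@filterS _ _ (ae_filter_ringOfSetsType leb) _ _ _ (lebesgue_differentiation (locally_integrable_bounded ma aM))).
move=> t /(mollifier_lebesgue_pt ma aM) cv h h0.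
pose I h := \int[leb]_s (a s * mollifier h t s).
have key h' : 0 < h' -> h' < h -> `|I h' - I h| <= 2 * L * h.
  move=> h'0 h'h.
  pose S k s : R := stepR (k^-1 * s + - (k^-1 * t)).
  pose g s : R := -1 * S h s + S h' s.
  have sg : smooth_on setT g by apply: smooth_comb; exact: smooth_scaled.
  have g0 s : s \notin `[t - h, t + h] -> g s = 0.
    rewrite in_itv/= negb_and -!ltNge => /orP[st|st]; rewrite /g /S.
      by rewrite !scaled_eq0 ?mulr0 ?addr0//; lra.
    by rewrite !scaled_eq1 ?mulr1 ?addNr//; lra.
  have g1 s : `|g s| <= 1.
    have := stepR_ge0 (h^-1 * s + - (h^-1 * t)); have := stepR_le1 (h^-1 * s + - (h^-1 * t)).
    have := stepR_ge0 (h'^-1 * s + - (h'^-1 * t)); have := stepR_le1 (h'^-1 * s + - (h'^-1 * t)).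
    by rewrite /g /S ler_norml => *; apply/andP; split; lra.
  have kg : compactly_supported g.
    exists (`|t| + h) => s st; apply: g0.
    apply/negP; rewrite in_itv/= => /andP[c b]; move: st; apply/negP; rewrite -leNgt.
    by have := ler_norm t; have := ler_norm (- t); rewrite ler_norml normrN; lra.
  have dg s : 'D_1 g s = mollifier h' t s - mollifier h t s.
    have d1 := smooth_is_derive (smooth_scaled h t) s 1.
    have d2 := smooth_is_derive (smooth_scaled h' t) s 1.
    have d3 := is_deriveD (is_deriveZ (-1) d1) d2.
    have -> : 'D_1 g s = -1 *: mollifier h t s + mollifier h' t s by exact: (@derive_val _ _ _ _ _ _ _ d3).
    by rewrite scaleN1r addrC.
  have := H _ sg kg.
  have i1 k : 0 < k -> rintegrable leb (fun s => a s * mollifier k t s).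
    by move=> k0; apply: (rintegrable_compactly_supported ma aM (mollifier_smooth k t) (mollifier_compact t k0)).
  have -> : \int[leb]_s (a s * 'D_1 g s) = I h' - I h.
    rewrite /I -RintegralB//; try exact: i1.
    by apply: eq_Rintegral => s _; rewrite dg mulrBr.
  move=> /le_trans; apply.
  rewrite -mulrA mulrCA; apply: ler_wpM2l => //.
  rewrite (@Rintegral_support _ (t - h) (t + h)); last first.
    by move=> x /g0 ->; rewrite normr0.
  have mD : measurable (`[t - h, t + h]%classic : set (measurableTypeR R)) by exact: measurable_itv.
  have fin := lebesgue_segment t h0.
  have ig : leb.-integrable `[t - h, t + h] (EFin \o (fun x => `|g x|)).
    apply: measurable_bounded_integrable => //.
    - by apply: (@le_lt_trans _ _ (2 * h)%:E); [rewrite le_eqVlt; apply/orP; left; apply/eqP; exact: fin|exact: ltry].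
    - apply: measurable_funTS; apply: measurableT_comp => //; exact: smooth_measurable.
    exists 1; split; first exact: num_real.
    by move=> N N1 x _; rewrite /= normr_id (le_trans (g1 x))// ltW.
  apply: (@le_trans _ _ (\int[leb]_(x in `[t - h, t + h]) (1 : R))).
    apply: le_Rintegral => //.
    apply: measurable_bounded_integrable => //.
      by apply: (@le_lt_trans _ _ (2 * h)%:E); [rewrite le_eqVlt; apply/orP; left; apply/eqP; exact: fin|exact: ltry].
    exists 1; split; first exact: num_real.
    by move=> N N1 x _; rewrite /= normr1 ltW.
  rewrite Rintegral_cst// mul1r.
  by rewrite -[X in _ <= X]/(fine (2 * h)%:E) -fin.
have : `|I h' - I h| @[h' --> 0^'+] --> `|a t - I h|.
  by apply: cvg_norm; apply: cvgB => //; exact: cvg_cst.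
move=> lim; have <- := cvg_lim _ lim; last exact: Rhausdorff.
apply: limr_le; first by apply/cvg_ex; eexists; exact: lim.
near=> h'; apply: key; first by near: h'; exact: nbhs_right_gt.
by near: h'; exact: nbhs_right_lt.
Unshelve. all: by end_near. Qed.

End line_integrals.

(** * The symbol *)

Section homogeneous.
Context {R : realType} {n : nat}.
Variable s : 'rV[R]_n -> R.
Hypothesis s_hom : forall (a : R) x, 0 < a -> x != 0 -> s (a *: x) = s x.
Hypothesis s_cont : forall x, x != 0 -> {for x, continuous s}.

Let sphere : set 'rV[R]_n := [set x | `|x| = 1].

Let sphere_neq0 x : sphere x -> x != 0.
Proof. by move=> /= x1; rewrite -normr_eq0 x1 oner_eq0. Qed.

Lemma compact_sphere : compact sphere.
Proof.
apply: bounded_closed_compact.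
  by exists 1; split; [exact: num_real|move=> M M1 x /= ->; exact: ltW].
rewrite (_ : sphere = (fun x => `|x|) @^-1` [set 1]); last by [].
by apply: closed_comp; [move=> x _; exact: norm_continuous|exact: closed_eq].
Qed.

Let normalize x : x != 0 -> sphere (`|x|^-1 *: x) /\ s (`|x|^-1 *: x) = s x.
Proof.
move=> x0; have n0 : 0 < `|x| by rewrite normr_gt0.
split; last by rewrite s_hom// invr_gt0.
by rewrite /sphere /= normrZ gtr0_norm ?invr_gt0// mulVf// gt_eqF.
Qed.

Lemma homogeneous_bounded : exists C : R, forall x, x != 0 -> `|s x| <= C.
Proof.
have cs : {within sphere, continuous s}.
  by apply: continuous_in_subspaceT => x /set_mem /sphere_neq0; exact: s_cont.
have [C [_ HC]] := compact_bounded (continuous_compact cs compact_sphere).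
exists (C + 1) => x x0; have [Sx <-] := normalize x0.
by apply: (HC (C + 1)); [rewrite ltrDl|exists (`|x|^-1 *: x)].
Qed.

(** Dividing by the norm of [x] moves [x] to the unit sphere and shrinks [eta] to size
    [|eta| / |x|]; homogeneity leaves both values of [s] unchanged, and [s] is uniformly continuous
    near the compact sphere. *)
Lemma homogeneous_slow (eta : 'rV[R]_n) e : 0 < e ->
  exists N : R, forall x, N <= `|x| -> [/\ x != 0, x + eta != 0 & `|s x - s (x + eta)| <= e].
Proof.
move=> e0; have e20 : 0 < e / 2 by rewrite divr_gt0.
(* [y] is not restricted to the sphere, because the rescaled [x + eta] need not lie on it. *)
pose P (d : R) (x : 'rV[R]_n) := forall y, `|x - y| < d -> `|s x - s y| <= e.
have /compact_near_coveringP/(_ R (0^'+) P _) := compact_sphere.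
case.
  move=> x /sphere_neq0 /s_cont /cvgrPdist_le /(_ _ e20).
  move=> /nbhs_ballP[r /= r0 Hr].
  have r20 : 0 < r / 2 by rewrite divr_gt0.
  exists (ball x (r / 2), [set d : R | d < r / 2]) => /=.
    by split; [exact: nbhsx_ballx|exact: nbhs_right_lt].
  move=> [x' d] /= [xx' dr] y xy.
  have h1 : `|s x - s x'| <= e / 2.
    by apply: Hr; apply: le_ball xx'; rewrite ler_pdivrMr// ler_peMr ?ler1n// ltW.
  have h2 : `|s x - s y| <= e / 2.
    apply: Hr; rewrite -ball_normE /= in xx' *; apply: (le_lt_trans (ler_distD x' _ _)).
    by rewrite [r]splitr ltrD// (lt_trans xy).
  rewrite [e]splitr; apply: le_trans (ler_distD (s x) _ _) _.
  by rewrite distrC lerD.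
move=> d0 /= d0p Hd.
(* Having [d <= 1] makes [eta] shorter than [x], so that [x + eta] is nonzero. *)
pose d := Num.min (d0 / 2) 1; have dp : 0 < d by rewrite lt_min divr_gt0//= ltr01.
have dd0 : d < d0 by rewrite gt_min ltr_pdivrMr// ltr_pMr// ltr1n.
have {}Hd : sphere `<=` P d.
  by apply: Hd => //=; rewrite sub0r normrN gtr0_norm.
exists ((`|eta| + 1) / d) => x Nx.
have n0 : 0 < `|x|.
  by apply: lt_le_trans Nx; rewrite divr_gt0// ltr_wpDl.
have x0 : x != 0 by rewrite -normr_gt0.
have ed : `|eta| < d * `|x|.
  by rewrite mulrC -ltr_pdivrMr//; apply: lt_le_trans Nx; rewrite ltr_pM2r ?invr_gt0// ltrDl.
have xe0 : x + eta != 0.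
  apply: contraTneq ed => /eqP; rewrite addr_eq0 => /eqP xe.
  have -> : `|eta| = `|x| by rewrite xe normrN.
  by rewrite -leNgt ler_piMl// ge_min lexx orbT.
split => //.
have [Sx <-] := normalize x0.
have <- : s (`|x|^-1 *: (x + eta)) = s (x + eta) by rewrite s_hom// invr_gt0.
apply: Hd => //; rewrite -scalerBr normrZ opprD addrA subrr sub0r normrN gtr0_norm ?invr_gt0//.
by rewrite mulrC ltr_pdivrMr.
Qed.

End homogeneous.

Section lattice.
Context {R : realType} {n : nat}.

Lemma coord_le_norm (x : 'rV[R]_n) i : `|x ord0 i| <= `|x|.
Proof.
have /mapP[j Hj ->] : `|x ord0 i| \in [seq `|x y.1 y.2| | y : 'I_1 * 'I_n].
  by apply/mapP; exists (ord0, i) => //=; rewrite mem_enum.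
by rewrite [leRHS]/Num.norm /= mx_normrE; apply/bigmax_geP; right => /=; exists j.
Qed.

Lemma freqD (k l : 'rV[int]_n) : freq (k + l) = freq k + freq l :> 'rV[R]_n.
Proof. exact: map_mxD. Qed.

Lemma freq_eq0 (k : 'rV[int]_n) : (freq k == 0 :> 'rV[R]_n) = (k == 0).
Proof.
apply/eqP/eqP => [H|->]; last exact: map_mx0.
by apply/rowP => i; have /rowP/(_ i) := H; rewrite !mxE => /eqP; rewrite intr_eq0 => /eqP.
Qed.

Lemma lattice_ball_finite (N : R) : exists2 F : seq 'rV[int]_n, uniq F &
  forall k, k \notin F -> N <= `|freq k : 'rV[R]_n|.
Proof.
pose B := (Num.truncn `|N|).+1.
(* All integer points of the cube of half-side [B], each coordinate being an ordinal shifted by [B].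
   The norm on row vectors is the maximum norm, so the cube contains every frequency of norm below
   [N]. *)
pose F := [seq \row_i ((f i : nat)%:Z - B%:Z) | f : {ffun 'I_n -> 'I_(2 * B).+1}].
exists (undup F); first exact: undup_uniq.
move=> k; rewrite mem_undup => kF; rewrite leNgt; apply/negP => kN.
case/negP: kF; apply/mapP.
have NB : N < B%:R.
  by apply: le_lt_trans (ler_norm N) _; have /andP[] := truncn_itv (normr_ge0 N).
have kB i : `|k ord0 i| <= B%:Z.
  rewrite -(ler_int R) intr_norm; apply: le_trans (ltW NB); apply: le_trans (ltW kN).
  by have := coord_le_norm (freq k) i; rewrite mxE.
exists [ffun i => inord (absz (k ord0 i + B%:Z))]; first by rewrite mem_enum.
apply/rowP => i; rewrite mxE ffunE.
have := kB i; rewrite ler_norml => /andP[k1 k2].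
have kp : 0 <= k ord0 i + B%:Z by lia.
rewrite inordK; first by rewrite gez0_abs// addrK.
by rewrite ltnS -lez_nat gez0_abs//; lia.
Qed.

End lattice.

(** * The symbol on the dual lattice *)

Section symbol.
Context {R : realType} {n : nat}.
Variable m : 'rV[R]_n -> 'rV[R[i]]_n.
Hypothesis hm : multiplier_symbol m.
Variable xi0 : 'rV[int]_n.
Hypothesis heven : forall xi : 'rV[R]_n, xi != 0 ->
  dotv (complexv (freq xi0)) (m xi + m (- xi)) = 0.

Definition symbol_re k l := complex.Re (lattice_symbol m k ord0 l).
Definition symbol_im k l := complex.Im (lattice_symbol m k ord0 l).

(* By evenness [xi0 . m] is purely imaginary: [xi0 . m(k) = i sigma(k)]. *)
Definition sigma k := \sum_l (xi0 ord0 l)%:~R * symbol_im k l.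

(** The homogeneous function on nonzero vectors of which [sigma] is the restriction; homogeneity and
    compactness arguments take place here, while [sigma 0 = 0] by convention. *)
Let sigma_cont xi := \sum_l (xi0 ord0 l)%:~R * complex.Im (m xi ord0 l).

Let sigmaE k : k != 0 -> sigma k = sigma_cont (freq k).
Proof. by move=> k0; rewrite /sigma /symbol_im /lattice_symbol (negbTE k0). Qed.

Lemma ReD (x y : R[i]) : complex.Re (x + y) = complex.Re x + complex.Re y.
Proof. by case: x; case: y. Qed.

(** Since [m(-xi)] is the conjugate of [m(xi)], the sum [m(xi) + m(-xi)] is twice the real part of
    [m(xi)]; the hyperplane hypothesis is exactly this identity. *)
Lemma dotv_symbol_re k : \sum_l (xi0 ord0 l)%:~R * symbol_re k l = 0.
Proof.
rewrite /symbol_re /lattice_symbol; case: eqVneq => [_|k0].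
  by apply: big1 => l _; rewrite mxE mulr0.
have f0 : freq k != 0 :> 'rV[R]_n by rewrite freq_eq0.
have := heven f0; rewrite /dotv => /(congr1 (@complex.Re _)).
rewrite (big_morph (@complex.Re R) ReD (erefl : complex.Re (0 : R[i]) = 0)) => H.
have [_ _ hc _] := hm.
have {}H : 2 * \sum_l (xi0 ord0 l)%:~R * complex.Re (m (freq k) ord0 l) = 0.
  rewrite -[RHS]H mulr_sumr; apply: eq_bigr => l _.
  rewrite !mxE hc//; case: (m (freq k) ord0 l) => a b /=.
  by rewrite mul0r subr0; lra.
by have /eqP := H; rewrite mulf_eq0 pnatr_eq0/= => /eqP.
Qed.

Lemma symbol_bounded : exists C : R, forall k l,
  symbol_re k l ^+ 2 + symbol_im k l ^+ 2 <= C ^+ 2.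
Proof.
have [hhom hs _ _] := hm.
pose s (f : R[i] -> R) l xi := f (m xi ord0 l).
have sh f l a xi : 0 < a -> xi != 0 -> s f l (a *: xi) = s f l xi.
  by move=> a0 x0; rewrite /s hhom.
have cr l xi : xi != 0 -> {for xi, continuous (s (@complex.Re R) l)}.
  by move=> x0; have [H _] := hs l; exact: (H [::] xi x0).1.
have ci l xi : xi != 0 -> {for xi, continuous (s (@complex.Im R) l)}.
  by move=> x0; have [_ H] := hs l; exact: (H [::] xi x0).1.
have br l : exists C, forall xi, xi != 0 -> `|s (@complex.Re R) l xi| <= C.
  exact: homogeneous_bounded (sh _ l) (cr l).
have bi l : exists C, forall xi, xi != 0 -> `|s (@complex.Im R) l xi| <= C.
  exact: homogeneous_bounded (sh _ l) (ci l).
have [Cr HCr] := boolp.choice br; have [Ci HCi] := boolp.choice bi.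
have le1 (C : 'I_n -> R) l : `|C l| <= \sum_j `|C j|.
  by rewrite (bigD1 l)//= lerDl sumr_ge0.
exists (\sum_j `|Cr j| + \sum_j `|Ci j|).
move=> k l; rewrite /symbol_re /symbol_im /lattice_symbol; case: eqVneq => [_|k0].
  by rewrite !mxE /= expr0n/= addr0 sqr_ge0.
have f0 : freq k != 0 :> 'rV[R]_n by rewrite freq_eq0.
have r1 := le_trans (HCr l _ f0) (le_trans (ler_norm _) (le1 Cr l)).
have i1 := le_trans (HCi l _ f0) (le_trans (ler_norm _) (le1 Ci l)).
rewrite /s in r1 i1.
have sq (x : R) c : `|x| <= c -> x ^+ 2 <= c ^+ 2.
  by move=> xc; rewrite -(real_normK (num_real x)) lerXn2r// nnegrE (le_trans _ xc).
have := sq _ _ r1; have := sq _ _ i1.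
have : 0 <= \sum_j `|Cr j| by rewrite sumr_ge0.
have : 0 <= \sum_j `|Ci j| by rewrite sumr_ge0.
move: (\sum_j `|Cr j|) (\sum_j `|Ci j|) => c1 c2; nra.
Qed.

Let sigma_hom (a : R) xi : 0 < a -> xi != 0 -> sigma_cont (a *: xi) = sigma_cont xi.
Proof. by move=> a0 x0; have [hhom _ _ _] := hm; rewrite /sigma_cont hhom. Qed.

Let sigma_continuous xi : xi != 0 -> {for xi, continuous sigma_cont}.
Proof.
move=> x0; have [_ hs _ _] := hm.
suff cr (r : seq 'I_n) : {for xi, continuous
    (fun xi : 'rV[R]_n => \sum_(l <- r) (xi0 ord0 l)%:~R * complex.Im (m xi ord0 l))}.
  exact: cr.
elim: r => [|l r IH].
  have -> : (fun xi : 'rV[R]_n => \sum_(l <- [::]) (xi0 ord0 l)%:~R *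
      complex.Im (m xi ord0 l)) = cst 0 by apply/funext => ?; rewrite big_nil.
  exact: cst_continuous.
have -> : (fun xi : 'rV[R]_n => \sum_(i <- l :: r) (xi0 ord0 i)%:~R *
    complex.Im (m xi ord0 i)) = (fun xi : 'rV[R]_n => (xi0 ord0 l)%:~R *
    complex.Im (m xi ord0 l) + \sum_(i <- r) (xi0 ord0 i)%:~R *
    complex.Im (m xi ord0 i)) by apply/funext => ?; rewrite big_cons.
apply: continuousD; last exact: IH.
apply: continuousM; first exact: cst_continuous.
by have [_ H] := hs l; exact: (H [::] xi x0).1.
Qed.

Lemma sigma_bounded : exists C : R, forall k, `|sigma k| <= C.
Proof.
have [C HC] := homogeneous_bounded sigma_hom sigma_continuous.
exists (Num.max C 0) => k; rewrite le_max.
have [->|k0] := eqVneq k 0.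
  rewrite /sigma /symbol_im /lattice_symbol eqxx big1 ?normr0 ?lexx ?orbT// => l _.
  by rewrite mxE mulr0.
by rewrite sigmaE// HC// freq_eq0.
Qed.

Lemma sigma_slow e : 0 < e -> exists2 F : seq 'rV[int]_n, uniq F &
  forall k, k \notin F -> `|sigma k - sigma (k + xi0)| <= e.
Proof.
move=> e0.
have [N HN] := homogeneous_slow sigma_hom sigma_continuous (freq xi0) e0.
have [F uF HF] := @lattice_ball_finite R n N; exists F => // k kF.
have [k0 kx0 H] := HN _ (HF _ kF).
by rewrite !sigmaE -?(freq_eq0 (R := R)) ?freqD.
Qed.

(** Real and imaginary parts of [cosc u - i sinc u = (p + i q) (cosc theta - i sinc theta)], with
    [p + i q] the symbol, once the common factor [(2 pi)^-n] is cancelled. *)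
Lemma fourier_multiplier (theta u : 'rV[R]_n -> R) k l :
  fourier u k = lattice_symbol m k ord0 l * fourier theta k ->
  cosc (torus_measure n) (@torus_phase R n) u k =
    symbol_re k l * cosc (torus_measure n) (@torus_phase R n) theta k +
    symbol_im k l * sinc (torus_measure n) (@torus_phase R n) theta k /\
  sinc (torus_measure n) (@torus_phase R n) u k =
    symbol_re k l * sinc (torus_measure n) (@torus_phase R n) theta k -
    symbol_im k l * cosc (torus_measure n) (@torus_phase R n) theta k.
Proof.
rewrite /fourier -/(cosc (torus_measure n) (@torus_phase R n) u k)
  -/(cosc (torus_measure n) (@torus_phase R n) theta k)
  -/(sinc (torus_measure n) (@torus_phase R n) u k)
  -/(sinc (torus_measure n) (@torus_phase R n) theta k).
rewrite /symbol_re /symbol_im mulrCA.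
have c0 : real_complex R ((2 * pi) ^- n) != 0.
  rewrite eq_complex /= eqxx andbT invr_eq0 expf_eq0 mulf_eq0 pnatr_eq0/=.
  by rewrite gt_eqF ?pi_gt0// andbF.
move=> /(mulfI c0); case: (lattice_symbol m k ord0 l) => p q /=.
by move=> [-> H]; split; lra.
Qed.

End symbol.

(** * Uniform boundedness *)

Section essentially_bounded.
Context {d} {T : measurableType d} {R : realType}.
Variable mu : {measure set T -> \bar R}.
Implicit Types (f g : T -> R) (M : R).

Definition ae_bounded f M := {ae mu, forall z, `|f z| <= M}.

Lemma ae_boundedW f M M' : M <= M' -> ae_bounded f M -> ae_bounded f M'.
Proof. by move=> MM; apply: filterS => z /le_trans; exact. Qed.

Lemma Lfun_measurable f p : f \in Lfun mu p -> measurable_fun setT f.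
Proof. by rewrite inE => /andP[/[!inE]]. Qed.

Lemma Lfun_ae_bounded f : f \in Lfun mu +oo%E -> exists2 M, 0 <= M & ae_bounded f M.
Proof.
rewrite inE => /andP[_]; rewrite inE /= /finite_norm unlock.
case: ifPn => [mu0|].
  move=> /ess_sup_inf.ess_supr_bounded[M HM].
  exists (Num.max M 0); first by rewrite le_max lexx orbT.
  by apply: filterS HM => z /= zM; rewrite le_max zM.
(* When the whole space is null, any bound holds almost everywhere. *)
rewrite -leNgt measure_le0 => /eqP mu0 _; exists 0 => //.
by exists setT; split => //.
Qed.

Lemma ae_bounded_integrable f g M : measurable_fun setT f -> ae_bounded f M ->
  0 <= M -> rintegrable mu g -> rintegrable mu (fun z => f z * g z).
Proof.
move=> mf fM M0 gi; have mg := rintegrable_measurable gi.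
have mfg : measurable_fun setT (fun z => f z * g z) by exact: measurable_funM.
have Mgi : rintegrable mu (fun z => M * `|g z|).
  by apply: rintegrableZ; exact: integrable_norm gi.
apply/integrableP; split; first exact/measurable_EFinP.
have /integrableP[_] := Mgi; apply: le_lt_trans.
apply: ae_ge0_le_integral => //.
- by apply: measurableT_comp => //; exact/measurable_EFinP.
- by apply: measurableT_comp => //; exact: measurable_int Mgi.
- apply: filterS fM => z fz _ /=.
  by rewrite lee_fin normrM (le_trans _ (ler_norm _))// ler_wpM2r.
Qed.

Lemma ae_bounded_Rintegral f g M : measurable_fun setT f -> ae_bounded f M ->
  0 <= M -> rintegrable mu g ->
  `|\int[mu]_z (f z * g z)| <= M * \int[mu]_z `|g z|.
Proof.
move=> mf fM M0 gi; have mg := rintegrable_measurable gi.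
have fgi := ae_bounded_integrable mf fM M0 gi.
have ngi : rintegrable mu (fun z => `|g z|) by exact: integrable_norm gi.
apply: (le_trans (le_normr_Rintegral measurableT fgi)).
rewrite -RintegralZl// /Rintegral; apply: fine_le.
- by apply: integrable_fin_num => //; exact: integrable_norm fgi.
- by apply: integrable_fin_num => //; exact: rintegrableZ.
apply: ae_ge0_le_integral => //.
- by have := measurable_int _ (integrable_norm fgi).
- by move=> z _; rewrite lee_fin mulr_ge0.
- exact: measurable_int (rintegrableZ M ngi).
- by apply: filterS fM => z fz _ /=; rewrite lee_fin normrM ler_wpM2r.
Qed.

End essentially_bounded.

Section uniform_boundedness.
Context {d} {T : measurableType d} {R : realType}.
Variable mu : {measure set T -> \bar R}.

(* [S] relates points with the same image in the torus: the limit function built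
   below has to be periodic. *)
Variable S : T -> T -> Prop.
Implicit Types (f g h theta : T -> R).

Definition invariant g := forall x y, S x y -> g x = g y.

(** [h] is the normalised indicator of [theta > K] cut by one of the sets [E p]: the cut keeps the
    measure finite, some [p] keeps it positive, and both sets are invariant. *)
Lemma hump_exists_pos theta (E : nat -> set T) N K : measurable_fun setT theta ->
  invariant theta -> (forall p, measurable (E p)) -> (forall p, (mu (E p) < +oo)%E) ->
  (forall p x y, S x y -> E p x <-> E p y) -> \bigcup_p E p = setT ->
  0 <= N -> ae_bounded mu theta N -> ~ {ae mu, forall z, theta z <= K} ->
  exists h, [/\ rintegrable mu h, invariant h, \int[mu]_z `|h z| <= 1 &
    K <= \int[mu]_z (theta z * h z)].
Proof.
move=> mt it mE fE iE ET N0 tN tK.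
pose D p := E p `&` [set z | K < theta z].
have mD p : measurable (D p).
  apply: measurableI => //; have := mt measurableT _ (measurable_itv `]K, +oo[).
  by congr measurable; apply/seteqP; split => z; rewrite /= in_itv/= andbT; [case|split].
have [p Dp] : exists p, mu (D p) != 0%E.
  apply: contra_notP tK => /forallNP H.
  have {}H p : mu (D p) = 0%E by apply/eqP/negPn/negP; exact: H.
  have : mu.-negligible (\bigcup_p D p).
    by apply: negligible_bigcup => p; apply/negligibleP => //; exact: H.
  apply: negligibleS => z /= /negP; rewrite -ltNge => zK.
  by have : [set: T] z by []; rewrite -ET => -[p _ Ez]; exists p.
have Dfin : (mu (D p) < +oo)%E.
  by apply: le_lt_trans (fE p); apply: le_measure; rewrite ?inE//; exact: subIsetl.
pose dl := fine (mu (D p)).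
have dl0 : 0 < dl by rewrite fine_gt0// Dfin andbT lt0e Dp measure_ge0.
have iD : \int[mu]_z (\1_(D p) z : R) = dl.
  by rewrite /Rintegral integral_indic// setIT.
have Di : rintegrable mu (\1_(D p) : T -> R).
  apply/integrableP; split; first by apply/measurable_EFinP; exact: measurable_indic.
  under eq_integral do rewrite /= ger0_norm ?indicE ?ler0n// -indicE.
  by rewrite integral_indic// setIT.
pose h z := dl^-1 * (\1_(D p) z : R).
have hi : rintegrable mu h by exact: rintegrableZ.
exists h; split => //.
- move=> x y xy; rewrite /h !indicE; congr (_ * (nat_of_bool _)%:R).
  by apply: asbool_equiv_eq; rewrite /D /= (it _ _ xy) (iE p _ _ xy).
- have h0 z : 0 <= h z by rewrite /h indicE mulr_ge0// invr_ge0 ltW.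
  under eq_Rintegral do rewrite ger0_norm//.
  by rewrite RintegralZl// iD mulVf// gt_eqF.
- have -> : K = \int[mu]_z (K * h z).
    by rewrite RintegralZl// RintegralZl// iD mulVf ?mulr1// gt_eqF.
  apply: le_Rintegral => //; first exact: rintegrableZ.
    exact: ae_bounded_integrable tN N0 hi.
  move=> z _; rewrite /h indicE; case: (boolP (z \in D p)) => [|_]; last by rewrite !mulr0.
  by rewrite inE => -[_ /= /ltW Kz]; rewrite ler_wpM2r// mulr_ge0 // invr_ge0 ltW.
Qed.

Lemma hump_exists theta (E : nat -> set T) N K : measurable_fun setT theta ->
  invariant theta -> (forall p, measurable (E p)) -> (forall p, (mu (E p) < +oo)%E) ->
  (forall p x y, S x y -> E p x <-> E p y) -> \bigcup_p E p = setT ->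
  0 <= N -> ae_bounded mu theta N -> ~ ae_bounded mu theta K ->
  exists h, [/\ rintegrable mu h, invariant h, \int[mu]_z `|h z| <= 1 &
    K <= \int[mu]_z (theta z * h z)].
Proof.
move=> mt it mE fE iE ET N0 tN tK.
have [H|H] := pselect {ae mu, forall z, theta z <= K}; last exact: hump_exists_pos tN H.
have [h [hi ih h1 hK]] : exists h, [/\ rintegrable mu h, invariant h,
    \int[mu]_z `|h z| <= 1 & K <= \int[mu]_z (- theta z * h z)].
  apply: (@hump_exists_pos _ E N) => //.
  - exact: measurable_funN.
  - by move=> x y xy; rewrite (it _ _ xy).
  - by apply: filterS tN => z; rewrite normrN.
  - apply: contra_not tK => H'; apply: filterS2 H H' => z h1 h2.
    by rewrite ler_norml h1 lerNl h2.
exists (fun z => -1 * h z); split.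
- exact: rintegrableZ.
- by move=> x y xy; rewrite (ih _ _ xy).
- by under eq_Rintegral do rewrite mulN1r normrN.
- by under eq_Rintegral do rewrite mulN1r mulrN -mulNr.
Qed.

(* Sokal's argument: in [x = sum_i +- 3^-i h_i] the signs are chosen one by one so
   that the partial sum up to [i] has a large integral against [theta i], and the
   tail is too small to cancel it. *)
Lemma gliding_hump (theta h : nat -> T -> R) (N : nat -> R) :
  (forall i, measurable_fun setT (theta i)) -> (forall i, ae_bounded mu (theta i) (N i)) ->
  (forall i, 0 <= N i) -> (forall i, rintegrable mu (h i)) -> (forall i, invariant (h i)) ->
  (forall i, \int[mu]_z `|h i z| <= 1) ->
  (forall i, 3 / 4 * N i <= \int[mu]_z (theta i z * h i z)) ->
  exists x, [/\ rintegrable mu x, invariant x &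
    forall i, 4^-1 * 3^-1 ^+ i * N i <= `|\int[mu]_z (theta i z * x z)|].
Proof.
move=> mt tN N0 hi ih h1 hN.
pose c i : R := 3^-1 ^+ i.
have c0 i : 0 <= c i by rewrite exprn_ge0.
(* An integrable majorant of every signed partial sum, whatever the signs. *)
pose F z : \bar R := (\sum_(i <oo) (c i * `|h i z|)%:E)%E.
have F0 i z : (0 <= (c i * `|h i z|)%:E)%E by rewrite lee_fin mulr_ge0.
have nhi i : rintegrable mu (fun z => c i * `|h i z|).
  by apply: rintegrableZ; exact: integrable_norm (hi i).
have mF : measurable_fun setT F.
  have := @ge0_emeasurable_sum _ T R setT (fun i z => (c i * `|h i z|)%:E) xpredT
    (fun i z _ _ => F0 i z) (fun i _ => measurable_int _ (nhi i)).
  by [].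
have Fge0 z : (0 <= F z)%E by exact: nneseries_ge0.
have Foo : (\int[mu]_z F z < +oo)%E.
  rewrite integral_nneseries//; last by move=> i; exact: measurable_int (nhi i).
  apply: (@le_lt_trans _ _ (1 / (1 - 3^-1))%:E); last exact: ltry.
  apply: lime_le; first by apply: is_cvg_nneseries => i _ _; exact: integral_ge0.
  apply: nearW => p.
  apply: (@le_trans _ _ (series (geometric 1 (3^-1 : R)) p)%:E); last first.
    rewrite lee_fin; apply: geometric_le_lim => //.
    by rewrite ger0_norm// invf_lt1// ltr1n.
  rewrite /series/= -sumEFin; apply: lee_sum => i _.
  rewrite mul1r -[leLHS]fineK; last by apply: integrable_fin_num => //; exact: nhi.
  rewrite lee_fin -/(Rintegral mu setT (fun z => c i * `|h i z|)) RintegralZl//; last first.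
    exact: integrable_norm (hi i).
  by rewrite -[leRHS]mulr1 ler_wpM2l.
have Fi : mu.-integrable setT F.
  apply/integrableP; split => //.
  by under eq_integral do rewrite gee0_abs//.
pose Fr z := fine (F z).
have Fri : rintegrable mu Fr.
  apply/integrableP; split.
    by apply/measurable_EFinP; apply: measurableT_comp mF; exact: fine_measurable.
  apply: le_lt_trans Foo; apply: ge0_le_integral => //.
  - apply: measurableT_comp => //; apply/measurable_EFinP.
    by apply: measurableT_comp mF; exact: fine_measurable.
  - move=> z _; rewrite /Fr /=; have := Fge0 z.
    by case: (F z) => [r||]//= r0; rewrite ger0_norm.
(* Cutting every term to the set where the majorant is finite makes the series converge at all
   points, so the limit is a genuine function and is invariant pointwise, not only almost
   everywhere. *)
pose G := [set z | (F z < +oo)%E].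
have mG : measurable G.
  have := mF measurableT _ (emeasurable_itv `]-oo, +oo%E[).
  by rewrite setTI; congr measurable.
have aG : {ae mu, forall z, \1_G z = 1 :> R}.
  have := integrable_ae measurableT Fi; apply: filterS => z /(_ I).
  by rewrite fin_numElt indicE => /andP[_ Gz]; rewrite mem_set.
pose t i z := c i * h i z * \1_G z.
have mG1 : measurable_fun setT (\1_G : T -> R) by exact: measurable_indic.
have mti i : measurable_fun setT (t i).
  apply: measurable_funM => //; apply: measurable_funM => //.
  exact: rintegrable_measurable (hi i).
have t_le i z : `|t i z| <= c i * `|h i z|.
  rewrite /t indicE !normrM (ger0_norm (c0 i)).
  by case: (z \in G); rewrite ?normr1 ?normr0 ?mulr1// mulr0 mulr_ge0.
have ti i : rintegrable mu (t i) by exact: rintegrable_le (t_le i) (nhi i).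
pose Tt i g := \int[mu]_z (theta i z * g z).
have tgi i g : rintegrable mu g -> rintegrable mu (fun z => theta i z * g z).
  by move=> gi; exact: ae_bounded_integrable (tN i) (N0 i) gi.
have TD i f g b : rintegrable mu f -> rintegrable mu g ->
    Tt i (fun z => f z + b * g z) = Tt i f + b * Tt i g.
  move=> fi gi; rewrite /Tt -RintegralZl//; last exact: tgi.
  rewrite -RintegralD//; [|exact: tgi|by apply: rintegrableZ; exact: tgi].
  by apply: eq_Rintegral => z _; rewrite mulrDr mulrCA.
have Tti i : 3 / 4 * c i * N i <= `|Tt i (t i)|.
  have -> : Tt i (t i) = c i * \int[mu]_z (theta i z * h i z).
    rewrite -RintegralZl//; last exact: tgi.
    apply: Rintegral_ae_eq; first exact: measurable_funM.
      by apply: measurable_funM => //; exact: rintegrable_measurable (tgi _ _ (hi i)).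
    by apply: filterS aG => z G1; rewrite /t G1 mulr1 mulrCA.
  rewrite normrM ger0_norm// -mulrA mulrCA ler_wpM2l//.
  exact: le_trans (hN i) (ler_norm _).
have Ttj i j : `|Tt i (t j)| <= c j * N i.
  apply: (le_trans (ae_bounded_Rintegral (mt i) (tN i) (N0 i) (ti j))).
  rewrite mulrC ler_wpM2r//.
  apply: (@le_trans _ _ (\int[mu]_z (c j * `|h j z|))).
    by apply: le_Rintegral => //; exact: integrable_norm (ti j).
  rewrite RintegralZl//; last exact: integrable_norm (hi j).
  by rewrite -[leRHS]mulr1 ler_wpM2l.
(* Of [|A + B|] and [|A - B|], at least one is no smaller than [|B|], because together they dominate
   [2 |B|]. *)
pose sg i g : R := if `|Tt i (t i)| <= `|Tt i (fun z => g z + 1 * t i z)| then 1 else -1.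
pose X := fix X i := if i is i'.+1 then (fun z => X i' z + sg i' (X i') * t i' z) else cst 0.
pose s i := sg i (X i).
have XE p z : X p z = series (fun i => s i * t i z) p.
  elim: p => [|p IH]; first by rewrite /series/= big_geq.
  by rewrite /series [RHS]/= big_nat_recr//= IH.
have s1 i : `|s i| = 1 by rewrite /s /sg; case: ifP; rewrite ?normrN normr1.
have Xi p : rintegrable mu (X p).
  elim: p => [|p IH] /=; first exact: integrable0.
  by apply: rintegrableD => //; exact: rintegrableZ.
have Xstep i : `|Tt i (t i)| <= `|Tt i (X i.+1)|.
  rewrite /= -/(s i) TD// /s /sg; case: ifPn; rewrite TD//.
  rewrite -ltNge mul1r mulN1r => H.
  have : `|Tt i (t i) + Tt i (t i)| <= `|Tt i (X i) + Tt i (t i)| + `|Tt i (X i) - Tt i (t i)|.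
    have -> : Tt i (t i) + Tt i (t i) = (Tt i (X i) + Tt i (t i)) - (Tt i (X i) - Tt i (t i)) by ring.
    exact: ler_normB.
  have -> : `|Tt i (t i) + Tt i (t i)| = 2 * `|Tt i (t i)|.
    have -> : Tt i (t i) + Tt i (t i) = 2 * Tt i (t i) by ring.
    by rewrite normrM ger0_norm.
  move: H; lra.
(* In units of [c i * N i], step [i] secures 3/4 and the next [p] terms remove at most
   [3^-1 + ... + 3^-p = (1 - 3^-p) / 2]; 1/4 survives in the limit. *)
have Xlow i p : c i * N i * (4^-1 + 2^-1 * c p) <= `|Tt i (X (i.+1 + p)%N)|.
  elim: p => [|p IH].
    rewrite addn0 (le_trans _ (Xstep i))// (le_trans _ (Tti i))//.
    by rewrite /c expr0; have := mulr_ge0 (c0 i) (N0 i); rewrite /c; lra.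
  have XS q : X q.+1 = (fun z => X q z + s q * t q z) by [].
  rewrite addnS XS TD//.
  have H1 := lerB_normD (Tt i (X (i.+1 + p)%N)) (s (i.+1 + p)%N * Tt i (t (i.+1 + p)%N)).
  rewrite [`|s _ * _|]normrM s1 mul1r in H1.
  have H2 := Ttj i (i.+1 + p)%N.
  apply: le_trans H1.
  apply: (@le_trans _ _ (c i * N i * (4^-1 + 2^-1 * c p) - c (i.+1 + p)%N * N i)); last exact: lerB.
  rewrite le_eqVlt; apply/orP; left; apply/eqP.
  by rewrite /c exprD !exprS; field.
have sumt p z : \sum_(0 <= i < p) `|s i * t i z| <= Fr z.
  have [zG|zG] := boolP (z \in G); last first.
    rewrite big1; first by rewrite fine_ge0.
    by move=> i _; rewrite /t indicE (negbTE zG) !mulr0 normr0.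
  have Fz : F z \is a fin_num by rewrite ge0_fin_numE//; rewrite inE in zG.
  rewrite -lee_fin /Fr fineK// -sumEFin.
  apply: (@le_trans _ _ (\sum_(0 <= i < p) (c i * `|h i z|)%:E)%E).
    by apply: lee_sum => i _; rewrite lee_fin normrM s1 mul1r.
  by apply: (nneseries_lim_ge p) => i _ _.
have Xle p z : `|X p z| <= Fr z.
  by rewrite XE (le_trans _ (sumt p z))// ler_norm_sum.
have Xcvg z : cvgn (X^~ z).
  have -> : X^~ z = series (fun i => s i * t i z) by apply/funext => p; exact: XE.
  apply: normed_cvg; apply: nondecreasing_is_cvgn.
    by apply: nondecreasing_series => i _ _; exact: normr_ge0.
  by exists (Fr z) => _ [p _ <-]; exact: sumt.
pose x z : R := limn (X^~ z).
have xc z : X p z @[p --> \oo] --> x z by exact: Xcvg.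
have mx : measurable_fun setT x.
  apply: (@measurable_fun_cvg _ _ _ setT X) => // p.
  exact: rintegrable_measurable (Xi p).
have x_le z : `|x z| <= Fr z.
  have nc : `|X p z| @[p --> \oo] --> `|x z| by apply: cvg_norm; exact: xc.
  rewrite -(cvg_lim (@Rhausdorff R) nc).
  by apply: limr_le; [apply/cvg_ex; eexists; exact: nc|exact: nearW].
exists x; split.
- exact: rintegrable_le x_le Fri.
- have iG : invariant (\1_G : T -> R).
    move=> y z yz; rewrite !indicE; congr (nat_of_bool _)%:R.
    apply: asbool_equiv_eq; rewrite /G /= /F.
    by under eq_eseriesr do rewrite (ih _ _ _ yz).
  have iX p : invariant (X p).
    elim: p => [|p IH] y z yz //=.
    by rewrite (IH _ _ yz) /t (ih _ _ _ yz) (iG _ _ yz).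
  move=> y z yz; rewrite /x; congr (limn _).
  by apply/funext => p; exact: iX.
- move=> i.
  have TX : Tt i (X p) @[p --> \oo] --> Tt i x.
    apply: (@Rintegral_dominated _ _ _ _ _ _ (fun z => N i * Fr z)).
    + by move=> p; apply: measurable_funM => //; exact: rintegrable_measurable (Xi p).
    + exact: measurable_funM.
    + by apply: nearW => z; apply: cvgM; [exact: cvg_cst|exact: xc].
    + exact: rintegrableZ.
    + by apply: filterS (tN i) => z tz p; rewrite normrM ler_pM.
  have nc : `|Tt i (X p)| @[p --> \oo] --> `|Tt i x| by exact: cvg_norm TX.
  rewrite -[leRHS](cvg_lim (@Rhausdorff R) nc).
  apply: limr_ge; first by apply/cvg_ex; eexists; exact: nc.
  exists i.+1 => // p /= ip; rewrite -(subnKC ip) (le_trans _ (Xlow i _))//.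
  by rewrite -/(c i) -mulrA mulrC ler_wpM2l ?mulr_ge0// lerDl mulr_ge0.
Qed.

(** Banach-Steinhaus for the functionals [theta j] on invariant integrable functions. If no common
    bound exists, indices with essential bounds [N >= 4^i] can be chosen, and the factor [3^-i] of
    the gliding hump still leaves growth like [(4 / 3)^i]. *)
Lemma uniform_boundedness (theta : nat -> T -> R) (E : nat -> set T) :
  (forall p, measurable (E p)) -> (forall p, (mu (E p) < +oo)%E) ->
  (forall p x y, S x y -> E p x <-> E p y) -> \bigcup_p E p = setT ->
  (forall j, measurable_fun setT (theta j)) -> (forall j, invariant (theta j)) ->
  (forall j, exists2 M, 0 <= M & ae_bounded mu (theta j) M) ->
  (forall g, rintegrable mu g -> invariant g ->
    exists B, forall j, `|\int[mu]_z (theta j z * g z)| <= B) ->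
  exists2 M, 0 <= M & forall j, ae_bounded mu (theta j) M.
Proof.
move=> mE fE iE ET mt it tM tB.
apply: contrapT => nM.
have step i : exists p : nat * (T -> R) * R, let: (j, h, N) := p in
  [/\ 4 ^+ i <= N, ae_bounded mu (theta j) N, rintegrable mu h, invariant h &
    \int[mu]_z `|h z| <= 1 /\ 3 / 4 * N <= \int[mu]_z (theta j z * h z)].
  have [j Hj] : exists j, ~ ae_bounded mu (theta j) (4 ^+ i).
    apply: contra_notP nM => /forallNP H; exists (4 ^+ i) => // j.
    by apply: contrapT; exact: H.
  pose A := [set M | 0 <= M /\ ae_bounded mu (theta j) M].
  have lA : lbound A (4 ^+ i).
    move=> M [_ HM]; rewrite leNgt; apply/negP => Mi.
    by apply: Hj; apply: ae_boundedW HM; exact: ltW.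
  have iA : has_inf A.
    by split; [have [M M0 HM] := tM j; exists M|exists (4 ^+ i)].
  have A4 : 4 ^+ i <= inf A by exact: lb_le_inf iA.1 lA.
  have A0 : 0 < inf A by rewrite (lt_le_trans _ A4)// exprn_gt0.
  (* [N] is below 4/3 of the best bound, so [3 / 4 * N] is no bound any more and a hump of that
     height exists. *)
  have [N [N0 HN] NA] := inf_adherent (divr_gt0 A0 (ltr0n R 3)) iA.
  have AN : inf A <= N by apply: ge_inf => //; exact: iA.2.
  have K : ~ ae_bounded mu (theta j) (3 / 4 * N).
    move=> H; have /(ge_inf iA.2) : A (3 / 4 * N) by split => //; rewrite mulr_ge0.
    by apply/negP; rewrite -ltNge; lra.
  have [h [hi ih h1 hK]] := hump_exists (mt j) (it j) mE fE iE ET N0 HN K.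
  by exists (j, h, N); split => //; exact: le_trans AN.
have [P HP] := boolp.choice step.
have {}HP i : [/\ 4 ^+ i <= (P i).2, ae_bounded mu (theta (P i).1.1) (P i).2,
    rintegrable mu (P i).1.2, invariant (P i).1.2 & \int[mu]_z `|(P i).1.2 z| <= 1 /\
    3 / 4 * (P i).2 <= \int[mu]_z (theta (P i).1.1 z * (P i).1.2 z)].
  by have := HP i; case: (P i) => -[].
have [x [xi ix xN]] := @gliding_hump (fun i => theta (P i).1.1) (fun i => (P i).1.2)
  (fun i => (P i).2) (fun i => mt _) (fun i => let: And5 _ h _ _ _ := HP i in h)
  (fun i => let: And5 h _ _ _ _ := HP i in le_trans (exprn_ge0 i (ler0n R 4)) h)
  (fun i => let: And5 _ _ h _ _ := HP i in h) (fun i => let: And5 _ _ _ h _ := HP i in h)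
  (fun i => let: And5 _ _ _ _ h := HP i in h.1) (fun i => let: And5 _ _ _ _ h := HP i in h.2).
have [B HB] := tB x xi ix.
have B0 i : 4^-1 * (4 / 3) ^+ i <= B.
  apply: le_trans (HB (P i).1.1); apply: le_trans (xN i).
  rewrite -mulrA ler_wpM2l// expr_div_n mulrC -exprVn ler_wpM2l ?exprn_ge0//.
  by case: (HP i).
have Bern i : 1 + i%:R / 3 <= (4 / 3 : R) ^+ i.
  elim: i => [|i IH]; first by rewrite mul0r addr0.
  rewrite exprS -natr1; have : (0 : R) <= i%:R by []; move: IH; lra.
have [i Hi] : exists i : nat, 12 * B < i%:R.
  by exists (Num.bound `|12 * B|); rewrite (le_lt_trans (ler_norm _))// archi_boundP.
by have := B0 i; have := Bern i; move: Hi; lra.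
Qed.

End uniform_boundedness.

Section spacetime_boundedness.
Context {R : realType} {n : nat}.
Local Notation mu := (spacetime_measure R n).
Local Notation E := (measurableTypeR R * 'rV[R]_n)%type.

Let slab (p : nat) : set E := (`[- p%:R, p%:R]%classic : set (measurableTypeR R)) `*` setT.

Let slab_lty p : (mu (slab p) < +oo)%E.
Proof.
have -> : mu (slab p) = ((@lebesgue_measure R) `[(- p%:R)%R, p%:R]%classic * torus_measure n setT)%E.
  by apply: product_measure1E => //; exact: measurable_itv.
apply: lte_mul_pinfty => //.
- rewrite ge0_fin_numE//; apply: compact_finite_measure; exact: segment_compact.
- by rewrite -ge0_fin_numE//; exact: fin_num_measure.
Qed.

(** Convergence is only known against periodic test functions, hence the invariant form of uniform
    boundedness. Slabs bounded in time are periodic sets of finite measure that exhaust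
    spacetime. *)
Lemma weak_star_bounded (theta : nat -> R * 'rV[R]_n -> R) f :
  (forall j, theta j \in Lfun mu +oo%E) -> (forall j, space_periodic (theta j)) ->
  weak_star_cvg theta f -> exists2 M, 0 <= M & forall j, ae_bounded mu (theta j) M.
Proof.
move=> tL tp tf.
pose S (y z : E) := exists k : 'rV[int]_n, y = (z.1, z.2 + (2 * pi) *: freq k).
have iS (g : E -> R) : space_periodic g <-> invariant S g.
  by split=> [gp y z [k ->]|gi z k]; [exact: gp|apply: gi; exists k].
apply: (@uniform_boundedness _ _ _ mu S theta slab).
- by move=> p; apply: measurableX => //; exact: measurable_itv.
- exact: slab_lty.
- by move=> p _ z [k ->].
- apply/seteqP; split => // z _; exists (Num.bound `|z.1|) => //; split => //=.
  by rewrite in_itv/= -ler_norml; apply/ltW; exact: archi_boundP.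
- by move=> j; exact: Lfun_measurable (tL j).
- by move=> j; apply/iS; exact: tp.
- by move=> j; exact: Lfun_ae_bounded (tL j).
- move=> g gi ig; have gL : g \in Lfun mu 1%E by exact/Lfun1_integrable.
  have /cvgP/cvg_seq_bounded/pinfty_ex_gt0[B B0 HB] := tf g gL (iffRL (iS g) ig).
  by exists B => j; exact: HB.
Qed.

End spacetime_boundedness.

(** * Weak solutions at fixed times *)

Section slices.
Context {d1 d2} {T1 : measurableType d1} {T2 : measurableType d2} {R : realType}.
Variables (m1 : {sigma_finite_measure set T1 -> \bar R})
  (m2 : {finite_measure set T2 -> \bar R}).
Local Notation mu := (m1 \x m2)%E.

Lemma ae_slices (P : T1 * T2 -> Prop) : {ae mu, forall z, P z} ->
  {ae m1, forall t, {ae m2, forall x, P (t, x)}}.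
Proof.
move=> [A [mA A0 PA]].
have : ae_eq m1 setT (m2 \o xsection A) (cst 0%E).
  apply/ae_eq_integral_abs => //; first exact: measurable_fun_xsection.
  by rewrite -[RHS]A0; apply: eq_integral => t _; rewrite gee0_abs.
apply: filterS => t /= /(_ I) At.
exists (xsection A t); split => //; first exact: measurable_xsection.
by move=> x Px; rewrite /xsection /= inE; exact: PA.
Qed.

Lemma ae_fst (P : T1 -> Prop) : {ae m1, forall t, P t} -> {ae mu, forall z, P z.1}.
Proof.
move=> [A [mA A0 PA]]; exists (A `*` setT); split.
- exact: measurableX.
- have -> : mu (A `*` setT) = (m1 A * m2 setT)%E by exact: product_measure1E.
  by rewrite A0 mul0e.
- by move=> z Pz; split => //; exact: PA.
Qed.

Lemma fubini_slices (F : T1 * T2 -> R) g : measurable_fun setT F ->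
  (forall t, rintegrable m2 (fun x => F (t, x))) ->
  (forall t, \int[m2]_x `|F (t, x)| <= g t) -> rintegrable m1 g ->
  [/\ rintegrable mu F, measurable_fun setT (fun t => \int[m2]_x F (t, x)) &
    \int[mu]_z F z = \int[m1]_t \int[m2]_x F (t, x)].
Proof.
move=> mF sF bF gi.
have mEF : measurable_fun setT (EFin \o F) by exact/measurable_EFinP.
have Fi : rintegrable mu F.
  apply/integrableP; split => //.
  rewrite fubini_tonelli1//; last exact: measurableT_comp.
  have /integrableP[_] := gi; apply: le_lt_trans.
  apply: ge0_le_integral => //.
  - by move=> t _; exact: integral_ge0.
  - apply: measurable_fun_fubini_tonelli_F => //; exact: measurableT_comp.
  - by apply: measurableT_comp => //; exact: measurable_int gi.
  - move=> t _; rewrite /fubini_F -[leLHS]fineK; last first.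
      by apply: integrable_fin_num => //; exact: integrable_norm (sF t).
    by rewrite lee_fin (le_trans (bF t))// ler_norm.
split => //.
- have := measurable_fubini_F Fi; apply: measurableT_comp; exact: fine_measurable.
- rewrite /Rintegral -integral12_prod_meas1//; congr fine; apply: eq_integral => t _.
  by rewrite /fubini_F fineK//; apply: integrable_fin_num => //; exact: sF.
Qed.

Lemma ae_slice_integral (F : T1 * T2 -> \bar R) (D : set T1) : measurable D ->
  measurable_fun setT F -> (forall z, (0 <= F z)%E) ->
  (\int[mu]_(z in D `*` setT) F z < +oo)%E ->
  {ae m1, forall t, D t -> (\int[m2]_x F (t, x) < +oo)%E}.
Proof.
move=> mD mF F0; have mDT : measurable (D `*` [set: T2]) by exact: measurableX.
rewrite integral_mkcond fubini_tonelli1.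
- set h := fubini_F _ _ => hoo.
  have mh : measurable_fun setT h.
    apply: measurable_fun_fubini_tonelli_F.
      by apply/(measurable_restrictT _ mDT); exact: measurable_funTS.
    by move=> z; exact: erestrict_ge0.
  have h0 t : (0 <= h t)%E by apply: integral_ge0 => x _; exact: erestrict_ge0.
  have hi : m1.-integrable setT h.
    by apply/integrableP; split=> //; under eq_integral do rewrite gee0_abs//.
  apply: filterS (integrable_ae measurableT hi) => t /(_ I).
  rewrite ge0_fin_numE// => ht Dt; apply: le_lt_trans ht.
  rewrite /h /fubini_F le_eqVlt; apply/orP; left; apply/eqP; apply: eq_integral => x _.
  by rewrite patchE mem_set.
- by apply/(measurable_restrictT _ mDT); exact: measurable_funTS.
- by move=> z; exact: erestrict_ge0.
Qed.

Lemma measurable_slice_integral (v : T1 * T2 -> R) : measurable_fun setT v ->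
  (forall t, rintegrable m2 (fun x => v (t, x))) ->
  measurable_fun setT (fun t => \int[m2]_x v (t, x)).
Proof.
move=> mv vi.
have pos (w : T1 * T2 -> R) : measurable_fun setT w -> (forall z, 0 <= w z) ->
    measurable_fun setT (fun t => \int[m2]_x w (t, x)).
  move=> mw w0; apply: measurableT_comp; first exact: fine_measurable.
  apply: (@measurable_fun_fubini_tonelli_F _ _ _ _ _ m2 (EFin \o w)).
    exact/measurable_EFinP.
  by move=> z; rewrite lee_fin.
have nvi t : rintegrable m2 (fun x => `|v (t, x)|) by exact: integrable_norm (vi t).
have mn : measurable_fun setT (fun z => `|v z|) by exact: measurableT_comp.
have -> : (fun t => \int[m2]_x v (t, x)) = (fun t =>
    \int[m2]_x (v (t, x) + `|v (t, x)|) - \int[m2]_x `|v (t, x)|).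
  by apply/funext => t; rewrite RintegralD// addrK.
apply: measurable_funB; last exact: (pos (fun z => `|v z|)).
apply: (pos (fun z => v z + `|v z|)); first exact: measurable_funD.
by move=> z; have := ler_norm (- v z); rewrite normrN; lra.
Qed.

Lemma fubini_weight (g : T1 -> R) (v : T1 * T2 -> R) B : rintegrable m1 g ->
  measurable_fun setT v -> (forall t, rintegrable m2 (fun x => v (t, x))) ->
  (forall t, \int[m2]_x `|v (t, x)| <= B) ->
  rintegrable mu (fun z => g z.1 * v z) /\
  \int[mu]_z (g z.1 * v z) = \int[m1]_t (g t * \int[m2]_x v (t, x)).
Proof.
move=> gi mv vi vB.
have [] := @fubini_slices (fun z => g z.1 * v z) (fun t => B * `|g t|).
- apply: measurable_funM => //; apply: measurableT_comp => //.
  exact: rintegrable_measurable gi.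
- by move=> t; exact: (rintegrableZ (g t) (vi t)).
- move=> t; under eq_Rintegral do rewrite normrM.
  rewrite /= RintegralZl//; last exact: integrable_norm (vi t).
  by rewrite mulrC ler_wpM2r.
- by apply: rintegrableZ; exact: integrable_norm gi.
move=> Fi _ ->; split => //.
by apply: eq_Rintegral => t _; rewrite /= RintegralZl.
Qed.

End slices.

Section regular_solutions.
Context {R : realType} {n : nat}.
Local Notation mu := (spacetime_measure R n).
Local Notation leb := (@lebesgue_measure R).
Local Notation tor := (@torus_measure R n).
Local Notation E := (measurableTypeR R * 'rV[R]_n)%type.
Local Notation ph := (@torus_phase R n).
Local Notation cosc := (cosc tor ph).
Local Notation sinc := (sinc tor ph).
Variable m : 'rV[R]_n -> 'rV[R[i]]_n.

(* A weak solution modified on a null set so that the bound and the Fourier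
   relations hold at every time. *)
Definition regular_solution M (theta : E -> R) (u : 'I_n -> E -> R) :=
  [/\ measurable_fun setT theta /\ (forall z, `|theta z| <= M),
      forall l, measurable_fun setT (u l),
      forall l t, sqint tor (fun x => u l (t, x)),
      forall l t k, let v := fun x => theta (t, x) in let w := fun x => u l (t, x) in
        cosc w k = symbol_re m k l * cosc v k + symbol_im m k l * sinc v k /\
        sinc w k = symbol_re m k l * sinc v k - symbol_im m k l * cosc v k &
      forall phi, test_function phi -> measurable_fun [set: E] (dt phi) ->
        (forall l, measurable_fun [set: E] (dx l phi)) ->
        \int[mu]_z (theta z * dt phi z + \sum_l theta z * u l z * dx l phi z) = 0].

Lemma slab_square_integrable u : locally_square_integrable u ->
  {ae leb, forall t, sqint tor (fun x => u (t, x))}.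
Proof.
move=> [mu_ ui].
have mu2 : measurable_fun [set: E] (fun z => (u z ^+ 2)%:E).
  by apply/measurable_EFinP; exact: measurable_funX.
have u20 z : (0 <= (u z ^+ 2)%:E)%E by rewrite lee_fin sqr_ge0.
(* Each bounded slab gives a null set of bad times; countably many slabs cover the line. *)
have H (p : nat) : {ae leb, forall t, t \in `[- p%:R, p%:R] ->
    (\int[tor]_x ((u (t, x)) ^+ 2)%:E < +oo)%E}.
  exact: (@ae_slice_integral _ _ _ _ _ leb tor _ `[- p%:R, p%:R]%classic
    (measurable_itv _) mu2 u20 (ui p%:R)).
apply: filterS (ae_foralln H) => t Ht; split.
  exact: (measurable_fun_pair2 (f := u) t).
apply/integrableP; split.
  apply/measurable_EFinP; apply: measurable_funX; exact: (measurable_fun_pair2 (f := u) t).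
under eq_integral do rewrite /= ger0_norm ?sqr_ge0//.
apply: (Ht (Num.bound `|t|)).
by rewrite in_itv/= -ler_norml; apply/ltW; exact: archi_boundP.
Qed.

Lemma regular_solution_exists M theta : 0 <= M -> bounded_weak_solution m theta ->
  ae_bounded mu theta M ->
  exists theta' u', regular_solution M theta' u' /\ {ae mu, forall z, theta z = theta' z}.
Proof.
move=> M0 [/Lfun_measurable mt _ [u [uT Hu _]]] tM.
have {}mt : measurable_fun [set: E] theta by exact: mt.
(* Truncation makes the essential bound valid everywhere and changes [theta] only on a null set. *)
pose clip (x : R) := Num.max (- M) (Num.min x M).
have clipM x : `|clip x| <= M.
  by rewrite /clip ler_norml le_max lexx/= ge_max ge_min lexx orbT andbT; lra.
have clip_id x : `|x| <= M -> clip x = x.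
  by rewrite ler_norml => /andP[xl xr]; rewrite /clip min_l// max_r.
have mu_ l : measurable_fun [set: E] (u l) by case: (uT l) => -[].
have sl : {ae leb, forall t, {ae tor, forall x, `|theta (t, x)| <= M}}.
  exact: (@ae_slices _ _ _ _ _ leb tor _ tM).
have sq : {ae leb, forall t, forall l, sqint tor (fun x => u l (t, x))}.
  by apply: filter_forall => l; apply: slab_square_integrable; case: (uT l).
have four : {ae leb, forall t, forall l k, fourier (fun x => u l (t, x)) k =
    lattice_symbol m k ord0 l * fourier (fun x => theta (t, x)) k}.
  by apply: filter_forall => l; case: (uT l).
have [N [mN N0 HN]] : {ae leb, forall t, [/\ {ae tor, forall x, `|theta (t, x)| <= M},
    forall l, sqint tor (fun x => u l (t, x)) & forall l k, fourier (fun x => u l (t, x)) k =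
    lattice_symbol m k ord0 l * fourier (fun x => theta (t, x)) k]}.
  by apply: (@filterS3 _ _ (ae_filter_ringOfSetsType leb)) sl sq four => t; split.
have good t : t \notin N -> [/\ {ae tor, forall x, `|theta (t, x)| <= M},
    forall l, sqint tor (fun x => u l (t, x)) & forall l k, fourier (fun x => u l (t, x)) k =
    lattice_symbol m k ord0 l * fourier (fun x => theta (t, x)) k].
  by move=> tN; apply: contrapT => H; move/negP: tN; apply; rewrite inE; exact: HN.
(* At the bad times both [theta] and [u] are replaced by 0, for which the Fourier relations hold
   trivially. *)
pose chi (t : measurableTypeR R) : R := \1_(~` N) t.
have mchi : measurable_fun [set: E] (fun z => chi z.1).
  by apply: measurableT_comp => //; apply: measurable_indic; exact: measurableC.
pose theta' (z : E) := chi z.1 * clip (theta z).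
pose u' l (z : E) := chi z.1 * u l z.
have chi1 : {ae mu, forall z, chi z.1 = 1}.
  have : {ae leb, forall t, chi t = 1}.
    exists N; split => // t /= Ht; apply: contrapT => tN; apply: Ht.
    by rewrite /chi indicE mem_set.
  exact: (@ae_fst _ _ _ _ _ leb tor).
have tt' : {ae mu, forall z, theta z = theta' z}.
  by apply: filterS2 chi1 tM => z z1 zM; rewrite /theta' z1 mul1r clip_id.
have mt' : measurable_fun [set: E] theta'.
  apply: measurable_funM => //; apply: measurable_maxr => //; exact: measurable_minr.
have mu' l : measurable_fun [set: E] (u' l) by exact: measurable_funM.
have chiE t : t \notin N /\ chi t = 1 \/ chi t = 0.
  rewrite /chi indicE; have [tN|tN] := boolP (t \in N); [right|left; split => //].
    by rewrite memNset// => /=; rewrite inE in tN.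
  by rewrite mem_set//= => Nt; move: tN; rewrite notin_setE.
have mph k : measurable_fun setT (ph k) by case: (torus_orthogonal R n).
have mcos (v : E -> R) t k : measurable_fun [set: E] v ->
    measurable_fun setT (fun x => v (t, x) * cos (ph k x)).
  move=> mv; apply: measurable_funM; first exact: (measurable_fun_pair2 (f := v) t).
  exact: measurable_cos.
have msin (v : E -> R) t k : measurable_fun [set: E] v ->
    measurable_fun setT (fun x => v (t, x) * sin (ph k x)).
  move=> mv; apply: measurable_funM; first exact: (measurable_fun_pair2 (f := v) t).
  exact: measurable_sin.
exists theta', u'; split => //; split => //.
- split => // z; rewrite /theta' /chi indicE.
  by case: (_ \in _); rewrite ?mul1r// mul0r normr0.
- move=> l t; case: (chiE t) => [[tN t1]|t0].
    have -> : (fun x => u' l (t, x)) = (fun x => u l (t, x)).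
      by apply/funext => x; rewrite /u' t1 mul1r.
    by have [_ sqt _] := good _ tN; exact: sqt.
  have -> : (fun x => u' l (t, x)) = (fun=> 0) by apply/funext => x; rewrite /u' t0 mul0r.
  exact: sqint_cst.
- move=> l t k; rewrite /=; case: (chiE t) => [[tN t1]|t0].
    have -> : (fun x => u' l (t, x)) = (fun x => u l (t, x)).
      by apply/funext => x; rewrite /u' t1 mul1r.
    have [tMt _ fo] := good _ tN.
    have [-> ->] := fourier_multiplier (fo l k).
    have te : {ae tor, forall x, theta' (t, x) = theta (t, x)}.
      by apply: filterS tMt => x tx; rewrite /theta' t1 mul1r clip_id.
    have -> : cosc (fun x => theta' (t, x)) k = cosc (fun x => theta (t, x)) k.
      apply: Rintegral_ae_eq; [exact: mcos|exact: mcos|].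
      by apply: filterS te => x ->.
    have -> // : sinc (fun x => theta' (t, x)) k = sinc (fun x => theta (t, x)) k.
    apply: Rintegral_ae_eq; [exact: msin|exact: msin|].
    by apply: filterS te => x ->.
  have -> : (fun x => u' l (t, x)) = (fun=> 0) by apply/funext => x; rewrite /u' t0 mul0r.
  have -> : (fun x => theta' (t, x)) = (fun=> 0) by apply/funext => x; rewrite /theta' t0 mul0r.
  have c0 : cosc (fun=> 0) k = 0.
    have := coscZ (torus_orthogonal R n) 0 k (sqint_cst tor 1).
    by rewrite !mul0r.
  have s0 : sinc (fun=> 0) k = 0.
    have := sincZ (torus_orthogonal R n) 0 k (sqint_cst tor 1).
    by rewrite !mul0r.
  by rewrite c0 s0 !mulr0 addr0 subr0.
- move=> phi tp mdt mdx; rewrite -[RHS](Hu phi tp).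
  have mW (a : E -> R) (b : 'I_n -> E -> R) : measurable_fun setT a ->
      (forall l, measurable_fun setT (b l)) -> measurable_fun setT
      (fun z => a z * dt phi z + \sum_l a z * b l z * dx l phi z).
    move=> ma mb; apply: (measurable_funD (measurable_funM ma mdt)).
    apply: measurable_sum => l.
    exact: (measurable_funM (measurable_funM ma (mb l)) (mdx l)).
  apply: Rintegral_ae_eq.
  + exact: mW.
  + exact: mW.
  + apply: (@filterS2 _ _ (ae_filter_ringOfSetsType mu)) tt' chi1 => z -> z1; congr (_ + _); apply: eq_bigr => l _.
    by rewrite /u' z1 mul1r.
Qed.

End regular_solutions.

Section bounded_slices.
Context {R : realType} {n : nat}.
Local Notation mu := (spacetime_measure R n).
Local Notation leb := (@lebesgue_measure R).
Local Notation tor := (@torus_measure R n).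
Local Notation E := (measurableTypeR R * 'rV[R]_n)%type.
Local Notation ph := (@torus_phase R n).
Local Notation V := (mass tor).

Lemma measurable_cos_phase k b : measurable_fun [set: E] (fun z => cos (ph k z.2 + b) : R).
Proof.
have mph : measurable_fun setT (ph k) by case: (torus_orthogonal R n).
by apply: measurable_cos; apply: measurable_funD => //; exact: measurableT_comp mph measurable_snd.
Qed.

Lemma measurable_sin_phase k b : measurable_fun [set: E] (fun z => sin (ph k z.2 + b) : R).
Proof.
have mph : measurable_fun setT (ph k) by case: (torus_orthogonal R n).
by apply: measurable_sin; apply: measurable_funD => //; exact: measurableT_comp mph measurable_snd.
Qed.

Lemma compactly_supported_rintegrable (g : R -> R) : smooth_on setT g ->
  compactly_supported g -> rintegrable leb g.
Proof.
move=> sg kg; have := @rintegrable_compactly_supported R (cst 1) g 1 (measurable_cst _)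
  (fun=> _) sg kg.
by under eq_fun do rewrite mul1r; apply => ?; rewrite normr1.
Qed.

Variables (M : R) (theta : E -> R).
Hypotheses (mt : measurable_fun [set: E] theta) (tM : forall z, `|theta z| <= M).

Let cos1 t : `|cos t| <= 1 :> R. Proof. exact: cos_max. Qed.

Lemma bounded_slice t : sqint tor (fun x => theta (t, x)).
Proof.
apply: (@sqint_bounded _ _ _ _ _ M); last by move=> x; exact: tM.
exact: (measurable_fun_pair2 (f := theta) t).
Qed.

Lemma bounded_slice_bound t : \int[tor]_x (theta (t, x) ^+ 2) <= M ^+ 2 * V.
Proof.
have [_ ti] := bounded_slice t.
rewrite -[leRHS](Rintegral_cst tor measurableT (M ^+ 2)).
apply: le_Rintegral => //; first exact: finite_measure_integrable_cst.
by move=> x _; rewrite -(real_normK (num_real _)) lerXn2r// nnegrE (le_trans _ (tM (t, x))).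
Qed.

Variables (k : 'rV[int]_n) (b : R).

Definition wave_coef t := \int[tor]_x (theta (t, x) * cos (ph k x + b)).

Lemma wave_coef_integrable t : rintegrable tor (fun x => theta (t, x) * cos (ph k x + b)).
Proof.
apply: (@rintegrable_bounded _ _ _ _ _ M).
  exact: (measurable_fun_pair2 (f := fun z : E => theta z * cos (ph k z.2 + b)) t
    (measurable_funM mt (measurable_cos_phase k b))).
by move=> x; rewrite normrM -[leRHS]mulr1 ler_pM.
Qed.

Lemma wave_coef_bound t : `|wave_coef t| <= M * V.
Proof.
apply: (le_trans (le_normr_Rintegral measurableT (wave_coef_integrable t))).
rewrite -[leRHS](Rintegral_cst tor measurableT M).
apply: le_Rintegral => //; first exact: integrable_norm (wave_coef_integrable t).
  exact: finite_measure_integrable_cst.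
by move=> x _; rewrite normrM -[leRHS]mulr1 ler_pM.
Qed.

Lemma wave_coef_measurable : measurable_fun [set: measurableTypeR R] wave_coef.
Proof.
exact: (@measurable_slice_integral _ _ (measurableTypeR R) _ _ tor
  (fun z => theta z * cos (ph k z.2 + b)) (measurable_funM mt (measurable_cos_phase k b)) wave_coef_integrable).
Qed.

Lemma wave_coefE g : smooth_on setT g -> compactly_supported g ->
  rintegrable mu (fun z => theta z * wave g k b z) /\
  \int[mu]_z (theta z * wave g k b z) = \int[leb]_t (g t * wave_coef t).
Proof.
move=> sg kg.
have gi : rintegrable leb g by exact: compactly_supported_rintegrable.
have E1 : (fun z => theta z * wave g k b z) =
    (fun z : E => g z.1 * (theta z * cos (ph k z.2 + b))).
  by apply/funext => z; rewrite /wave mulrCA.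
rewrite E1; apply: (@fubini_weight _ _ _ _ _ leb tor g
  (fun z => theta z * cos (ph k z.2 + b)) (M * V)) => //.
- exact: measurable_funM mt (measurable_cos_phase k b).
- exact: wave_coef_integrable.
- move=> t; rewrite -[leRHS](Rintegral_cst tor measurableT M).
  apply: le_Rintegral => //; first exact: integrable_norm (wave_coef_integrable t).
    exact: finite_measure_integrable_cst.
  by move=> x _; rewrite normrM -[leRHS]mulr1 ler_pM.
Qed.

End bounded_slices.

(** * Estimates depending on a solution only through its bound *)

Section solution_estimates.
Context {R : realType} {n : nat}.
Local Notation mu := (spacetime_measure R n).
Local Notation leb := (@lebesgue_measure R).
Local Notation tor := (@torus_measure R n).
Local Notation E := (measurableTypeR R * 'rV[R]_n)%type.
Local Notation ph := (@torus_phase R n).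
Local Notation V := (mass tor).
Variable m : 'rV[R]_n -> 'rV[R[i]]_n.
Variables (C M : R) (theta : E -> R) (u : 'I_n -> E -> R).
Hypothesis mC : forall k l, symbol_re m k l ^+ 2 + symbol_im m k l ^+ 2 <= C ^+ 2.
Hypothesis rs : regular_solution m M theta u.

Let mt : measurable_fun [set: E] theta. Proof. by case: rs => -[]. Qed.
Let tM z : `|theta z| <= M. Proof. by case: rs => -[_ H] _ _ _ _; exact: H. Qed.
Let mu_ l : measurable_fun [set: E] (u l). Proof. by case: rs. Qed.
Let su l t : sqint tor (fun x => u l (t, x)). Proof. by case: rs. Qed.

Let st := bounded_slice mt tM.
Let sb := bounded_slice_bound mt tM.
Local Notation wave_coef := (wave_coef theta).

Lemma velocity_slice_bound l t : \int[tor]_x (u l (t, x) ^+ 2) <= C ^+ 2 * (M ^+ 2 * V).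
Proof.
have [_ _ _ fo _] := rs.
apply: (@le_trans _ _ (C ^+ 2 * \int[tor]_x (theta (t, x) ^+ 2))); last first.
  by rewrite ler_wpM2l ?sqr_ge0//; exact: sb.
apply: multiplier_bound => // k; rewrite /energy; have /= [-> ->] := fo l t k.
set a := cosc _ _ _ _; set b := sinc _ _ _ _.
have := mC k l; set p := symbol_re _ _ _; set q := symbol_im _ _ _ => pq.
have -> : (p * a + q * b) ^+ 2 + (p * b - q * a) ^+ 2 = (p ^+ 2 + q ^+ 2) * (a ^+ 2 + b ^+ 2) by ring.
by rewrite ler_wpM2r// addr_ge0 ?sqr_ge0.
Qed.

(** The velocity is only square integrable on slices, so the product with [theta] is bounded in L^1
    by [u^2 + theta^2], whose integral is at most this constant. *)
Definition flux_bound := (C ^+ 2 + 1) * (M ^+ 2 * V).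

Lemma flux_slice l t : rintegrable tor (fun x => theta (t, x) * u l (t, x)) /\
  \int[tor]_x `|theta (t, x) * u l (t, x)| <= flux_bound.
Proof.
have tui := sqintM (st t) (su l t); split => //.
have [_ t2] := st t; have [_ u2] := su l t.
apply: (@le_trans _ _ (\int[tor]_x (u l (t, x) ^+ 2 + theta (t, x) ^+ 2))).
  apply: le_Rintegral => //; [exact: integrable_norm tui|exact: rintegrableD|].
  move=> x _; move: (theta (t, x)) (u l (t, x)) => a b.
  rewrite ler_norml; have := sqr_ge0 (a + b); have := sqr_ge0 (a - b).
  by have := sqr_ge0 a; have := sqr_ge0 b => *; apply/andP; split; nra.
rewrite RintegralD// /flux_bound mulrDl mul1r.
by apply: lerD; [exact: velocity_slice_bound|exact: sb].
Qed.

Section against_wave.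
Variables (k : 'rV[int]_n) (b : R).

Let msinE := measurable_sin_phase k b.
Let sin1 t : `|sin t| <= 1 :> R. Proof. exact: sin_max. Qed.
Definition wave_flux t := \int[tor]_x (\sum_l (k ord0 l)%:~R *
  (theta (t, x) * u l (t, x) * sin (ph k x + b))).

(** Independent of the phase [b], and of the solution except through [C] and [M]: one Lipschitz
    constant for a whole sequence with a common bound. *)
Definition wave_lip := \sum_l `|(k ord0 l)%:~R| * flux_bound.

Let flux_term l t : rintegrable tor (fun x => (k ord0 l)%:~R *
    (theta (t, x) * u l (t, x) * sin (ph k x + b))) /\
  \int[tor]_x `|(k ord0 l)%:~R * (theta (t, x) * u l (t, x) * sin (ph k x + b))|
    <= `|(k ord0 l)%:~R| * flux_bound.
Proof.
have [fi fb] := flux_slice l t.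
have mm : measurable_fun setT (fun x => (k ord0 l)%:~R *
    (theta (t, x) * u l (t, x) * sin (ph k x + b))).
  exact: (measurable_fun_pair2 (f := fun z : E => (k ord0 l)%:~R *
    (theta z * u l z * sin (ph k z.2 + b))) t (measurable_funM (measurable_cst _)
    (measurable_funM (measurable_funM mt (mu_ l)) msinE))).
have nfi : rintegrable tor (fun x => `|theta (t, x) * u l (t, x)|) by exact: integrable_norm fi.
have bd x : `|(k ord0 l)%:~R * (theta (t, x) * u l (t, x) * sin (ph k x + b))| <=
    `|(k ord0 l)%:~R| * `|theta (t, x) * u l (t, x)|.
  by rewrite normrM ler_wpM2l// normrM -[leRHS]mulr1 ler_wpM2l.
have Fi := rintegrable_le mm bd (rintegrableZ _ nfi).
split => //; apply: (@le_trans _ _ (\int[tor]_x (`|(k ord0 l)%:~R| *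
  `|theta (t, x) * u l (t, x)|))).
  by apply: le_Rintegral => //; [exact: integrable_norm Fi|exact: rintegrableZ].
by rewrite RintegralZl// ler_wpM2l.
Qed.

Lemma wave_flux_integrable t : rintegrable tor (fun x => \sum_l (k ord0 l)%:~R *
  (theta (t, x) * u l (t, x) * sin (ph k x + b))).
Proof. by apply: rintegrable_sum => l; case: (flux_term l t). Qed.

Let flux_norm t : \int[tor]_x `|\sum_l (k ord0 l)%:~R *
  (theta (t, x) * u l (t, x) * sin (ph k x + b))| <= wave_lip.
Proof.
have ni l : rintegrable tor (fun x => `|(k ord0 l)%:~R *
    (theta (t, x) * u l (t, x) * sin (ph k x + b))|).
  by have [Fi _] := flux_term l t; exact: integrable_norm Fi.
apply: (@le_trans _ _ (\int[tor]_x \sum_l `|(k ord0 l)%:~R *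
    (theta (t, x) * u l (t, x) * sin (ph k x + b))|)).
  apply: le_Rintegral => //; first exact: integrable_norm (wave_flux_integrable t).
    exact: rintegrable_sum.
  by move=> x _; exact: ler_norm_sum.
by rewrite Rintegral_sum//; apply: ler_sum => l _; case: (flux_term l t).
Qed.

Lemma wave_flux_bound t : `|wave_flux t| <= wave_lip.
Proof.
by apply: (le_trans (le_normr_Rintegral measurableT (wave_flux_integrable t))); exact: flux_norm.
Qed.

Lemma wave_lip_ge0 : 0 <= wave_lip.
Proof. exact: le_trans (normr_ge0 _) (wave_flux_bound 0). Qed.

Let mflux : measurable_fun [set: E] (fun z => \sum_l (k ord0 l)%:~R *
  (theta z * u l z * sin (ph k z.2 + b))).
Proof.
apply: measurable_sum => l.
exact: (measurable_funM (measurable_cst _) (measurable_funM (measurable_funM mt (mu_ l)) msinE)).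
Qed.

Lemma wave_flux_measurable : measurable_fun [set: measurableTypeR R] wave_flux.
Proof.
exact: (@measurable_slice_integral _ _ (measurableTypeR R) _ _ tor _ mflux wave_flux_integrable).
Qed.

(** The equation tested with [wave g k b]: in the weak sense, the time derivative of [wave_coef] is
    [- wave_flux]. *)
Lemma wave_balance g : smooth_on setT g -> compactly_supported g ->
  \int[leb]_t (wave_coef k b t * 'D_1 g t) = \int[leb]_t (g t * wave_flux t).
Proof.
move=> sg kg; have [A gA] := kg.
have gi : rintegrable leb g by exact: compactly_supported_rintegrable.
have tw := wave_test k b sg gA.
have [_ _ _ _ weq] := rs.
have mwave h : smooth_on setT h -> measurable_fun [set: E] (wave h k b).
  move=> sh; apply: measurable_funM; last exact: measurable_cos_phase.
  by apply: measurableT_comp => //; exact: smooth_measurable.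
have sg' : smooth_on setT ('D_1 g) by exact: smooth_derive.
have kg' := compactly_supported_derive kg.
have dxE l : dx l (wave g k b) = fun z => - (k ord0 l)%:~R * (g z.1 * sin (ph k z.2 + b)).
  by rewrite dx_wave.
have mdt : measurable_fun [set: E] (dt (wave g k b)) by rewrite dt_wave//; exact: mwave.
have mdx l : measurable_fun [set: E] (dx l (wave g k b)).
  rewrite dxE; apply: measurable_funM => //; apply: measurable_funM => //.
  by apply: measurableT_comp => //; exact: smooth_measurable.
have := weq _ tw mdt mdx.
have [i1 e1] := wave_coefE mt tM k b sg' kg'.
have [i2 e2] := @fubini_weight _ _ _ _ _ leb tor g _ wave_lip gi mflux wave_flux_integrable flux_norm.
have -> : (fun z => theta z * dt (wave g k b) z + \sum_l theta z * u l z * dx l (wave g k b) z)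
   = (fun z : E => theta z * wave ('D_1 g) k b z - g z.1 * (\sum_l (k ord0 l)%:~R *
  (theta z * u l z * sin (ph k z.2 + b)))).
  apply/funext => z; rewrite dt_wave//; congr (_ + _); rewrite mulr_sumr -sumrN.
  by apply: eq_bigr => l _; rewrite dxE; ring.
move=> e0; have := etrans (esym (RintegralB measurableT i1 i2)) e0.
rewrite e1 => /eqP; rewrite subr_eq0 => /eqP H.
transitivity (\int[leb]_t ('D_1 g t * wave_coef k b t)).
  by apply: eq_Rintegral => t _; rewrite mulrC.
by rewrite H; exact: e2.
Qed.

Lemma wave_coef_lip g : smooth_on setT g -> compactly_supported g ->
  `|\int[leb]_t (wave_coef k b t * 'D_1 g t)| <= wave_lip * \int[leb]_t `|g t|.
Proof.
move=> sg kg; rewrite wave_balance//.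
have gi : rintegrable leb (fun t => wave_flux t * g t).
  exact: (rintegrable_compactly_supported wave_flux_measurable wave_flux_bound sg kg).
have g1 : rintegrable leb g by exact: compactly_supported_rintegrable.
have ng1 : rintegrable leb (fun t => `|g t|) by exact: integrable_norm g1.
under eq_Rintegral do rewrite mulrC.
apply: (le_trans (le_normr_Rintegral measurableT gi)).
rewrite -RintegralZl//; apply: le_Rintegral => //; [exact: integrable_norm gi|exact: rintegrableZ|].
by move=> t _; rewrite normrM ler_wpM2r// wave_flux_bound.
Qed.

End against_wave.
End solution_estimates.

(** * Passing to the limit *)

Section weak_to_pointwise.
Context {R : realType}.
Local Notation leb := (@lebesgue_measure R).
Implicit Types (g a : R -> R).

(** A value at a good time differs from its mollification at scale [h] by at most [2 L h], uniformly
    in [j], and for fixed [h] the mollification is a weak pairing, hence converges. The limit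
    inherits the weak Lipschitz bound, so the same holds for it. *)
Lemma weak_cvg_lipschitz (a_ : nat -> R -> R) a M L :
  (forall j, measurable_fun [set: measurableTypeR R] (a_ j)) ->
  measurable_fun [set: measurableTypeR R] a ->
  (forall j s, `|a_ j s| <= M) -> (forall s, `|a s| <= M) -> 0 <= L ->
  (forall j g, smooth_on setT g -> compactly_supported g ->
     `|\int[leb]_s (a_ j s * 'D_1 g s)| <= L * \int[leb]_s `|g s|) ->
  (forall g, smooth_on setT g -> compactly_supported g ->
     \int[leb]_s (a_ j s * g s) @[j --> \oo] --> \int[leb]_s (a s * g s)) ->
  {ae leb, forall t, a_ j t @[j --> \oo] --> a t}.
Proof.
move=> ma_ ma aM_ aM L0 lip wc.
have lipa g : smooth_on setT g -> compactly_supported g ->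
    `|\int[leb]_s (a s * 'D_1 g s)| <= L * \int[leb]_s `|g s|.
  move=> sg kg.
  have sg' : smooth_on setT ('D_1 g) by exact: smooth_derive.
  have nc : `|\int[leb]_s (a_ j s * 'D_1 g s)| @[j --> \oo] --> `|\int[leb]_s (a s * 'D_1 g s)|.
    by apply: cvg_norm; apply: wc => //; exact: compactly_supported_derive.
  rewrite -(cvg_lim (@Rhausdorff R) nc); apply: limr_le; first by apply/cvg_ex; eexists; exact: nc.
  by apply: nearW => j; exact: lip.
have A := mollifier_error ma aM L0 lipa.
have A_ := ae_foralln (fun j => mollifier_error (ma_ j) (aM_ j) L0 (lip j)).
apply: (@filterS2 _ _ (ae_filter_ringOfSetsType leb)) A A_ => t At A_t.
apply/cvgrPdist_le => e e0.
(* The two mollification errors, together [4 L h], then take at most half of [e]. *)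
pose h := e / (8 * (L + 1)).
have h0 : 0 < h by rewrite divr_gt0// mulr_gt0// ltr_wpDl.
have hL : 4 * L * h <= e / 2.
  have -> : e / 2 = 4 * (L + 1) * h by rewrite /h; field; rewrite gt_eqF// ltr_wpDl.
  by rewrite ler_pM2r//; lra.
have := wc _ (mollifier_smooth h t) (mollifier_compact t h0).
move=> /cvgrPdist_le /(_ (e / 2) (divr_gt0 e0 (ltr0n _ 2))).
apply: filterS => j Hj.
have := A_t j h h0; have := At h h0; move: Hj hL.
set I := Rintegral _ _ _; set J := Rintegral _ _ _.
rewrite !ler_norml => /andP[? ?] ? /andP[? ?] /andP[? ?]; apply/andP; split; lra.
Qed.

Lemma Rintegral_continuous_gt0 g t : continuous g -> (forall s, 0 <= g s) ->
  rintegrable leb g -> 0 < g t -> 0 < \int[leb]_s g s.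
Proof.
move=> cg g0 gi gt0.
have /cvgrPdist_lt /(_ _ (divr_gt0 gt0 (ltr0n R 2))) := cg t.
move=> /nbhs_ballP[d /= d0 Hd].
pose D := `[t - d / 2, t + d / 2]%classic : set (measurableTypeR R).
have mD : measurable D by exact: measurable_itv.
have d20 : 0 < d / 2 by rewrite divr_gt0.
have lD : leb D = (2 * (d / 2))%:E by exact: lebesgue_segment.
have iD : (\int[leb]_s (\1_D s)%:E = (2 * (d / 2))%:E)%E.
  by rewrite integral_indic// setIT; exact: lD.
have iR : \int[leb]_s (\1_D s : R) = 2 * (d / 2) by exact: (congr1 fine iD).
have Di : rintegrable leb (\1_D : R -> R).
  apply/integrableP; split; first by apply/measurable_EFinP; exact: measurable_indic.
  under eq_integral do rewrite /= ger0_norm ?indicE ?ler0n// -indicE.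
  by apply: (@le_lt_trans _ _ (2 * (d / 2))%:E); [rewrite -iD|exact: ltry].
have := @le_Rintegral _ _ R leb setT (fun s => g t / 2 * \1_D s) g measurableT
  (rintegrableZ _ Di) gi.
rewrite RintegralZl// iR => H; apply: lt_le_trans (H _); first by rewrite !mulr_gt0// divr_gt0.
move=> s _; rewrite indicE; case: (boolP (s \in D)) => [sD|_]; last by rewrite mulr0.
rewrite mulr1; have : ball t d s.
  move: sD; rewrite inE /D /= in_itv/= => /andP[? ?].
  by rewrite /ball /= ltr_norml; apply/andP; split; lra.
by move=> /Hd /=; rewrite ltr_norml => /andP[? ?]; lra.
Qed.

Lemma Rintegral_sqr_derive_gt0 g : smooth_on setT g -> compactly_supported g ->
  g 0 != 0 -> 0 < \int[leb]_s ('D_1 g s ^+ 2).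
Proof.
move=> sg kg g0.
have sg' : smooth_on setT ('D_1 g) by exact: smooth_derive.
have kg' := compactly_supported_derive kg.
have [t gt] : exists t, 'D_1 g t != 0.
  apply: contrapT => /forallNP H; have [A gA] := kg.
  have d0 s : is_derive s (1 : R) g 0.
    have := smooth_is_derive sg s 1.
    by have -> : 'D_1 g s = 0 by apply/eqP/negPn/negP; exact: H.
  have := @is_derive_0_is_cst R g 0 (`|A| + 1) d0.
  rewrite [RHS]gA; last first.
    by rewrite ger0_norm ?addr_ge0// (le_lt_trans (ler_norm A))// ltrDl.
  by move/eqP; rewrite (negbTE g0).
have c' := smooth_continuous sg'.
have sqrE : (fun s => 'D_1 g s ^+ 2) = (fun s => 'D_1 g s * 'D_1 g s).
  by apply/funext => s; rewrite expr2.
apply: (@Rintegral_continuous_gt0 _ t).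
- by rewrite sqrE; exact: smooth_continuous (smoothM sg' sg').
- by move=> s; exact: sqr_ge0.
- have [B HB] := compactly_supported_bounded c' kg'.
  rewrite sqrE.
  exact: (rintegrable_compactly_supported (smooth_measurable sg') HB sg' kg').
- by rewrite lt0r sqrf_eq0 gt sqr_ge0.
Qed.

End weak_to_pointwise.

(** * Coefficients and correlations of a single cosine *)

Section torus_trigonometry.
Context {R : realType} {n : nat}.
Local Notation tor := (@torus_measure R n).
Local Notation ph := (@torus_phase R n).
Local Notation V := (mass tor).
Implicit Types k l : 'rV[int]_n.

Let mph k : measurable_fun setT (ph k). Proof. by case: (torus_orthogonal R n). Qed.

Let ci (g : 'rV[R]_n -> R) : measurable_fun setT g -> rintegrable tor (fun x => cos (g x)).
Proof. by move=> mg; apply: sqint_rintegrable; exact: sqint_cos. Qed.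

Let si (g : 'rV[R]_n -> R) : measurable_fun setT g -> rintegrable tor (fun x => sin (g x)).
Proof. by move=> mg; apply: sqint_rintegrable; exact: sqint_sin. Qed.

Lemma torus_phase0 x : ph 0 x = 0.
Proof. by have := torus_phaseD 0 0 x; rewrite addr0; lra. Qed.

Lemma torus_cos_mean a k : k != 0 -> \int[tor]_x (a * cos (ph k x)) = 0.
Proof.
have [_ _ c _] := torus_orthogonal R n; move=> k0.
rewrite RintegralZl//; last exact: ci (mph k).
rewrite -[RHS](mulr0 a); congr (_ * _).
rewrite -[RHS]/(if false then V else 0) -(negbTE k0) -c; apply: eq_Rintegral => x _.
by rewrite torus_phase0 subr0.
Qed.

Lemma torus_cos_cos k l : \int[tor]_x (cos (ph k x) * cos (ph l x)) =
  V / 2 * ((k == l)%:R + (k == - l)%:R).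
Proof.
have [_ _ c _] := torus_orthogonal R n.
have -> : \int[tor]_x (cos (ph k x) * cos (ph l x)) =
    \int[tor]_x (2^-1 * (cos (ph k x - ph l x) + cos (ph k x - ph (- l) x))).
  by apply: eq_Rintegral => x _; rewrite torus_phaseN opprK cosB cosD; field.
have m1 := measurable_funB (mph k) (mph l); have m2 := measurable_funB (mph k) (mph (- l)).
rewrite RintegralZl//; last by apply: rintegrableD; exact: ci.
rewrite RintegralD//; [|exact: ci|exact: ci].
by rewrite !c; case: eqP => _; case: eqP => _; rewrite ?mulr1n ?mulr0n; field.
Qed.

Lemma torus_cos_sin k l : \int[tor]_x (cos (ph k x) * sin (ph l x)) = 0.
Proof.
have [_ _ _ s] := torus_orthogonal R n.
have -> : \int[tor]_x (cos (ph k x) * sin (ph l x)) =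
    \int[tor]_x (2^-1 * (sin (ph l x - ph k x) + sin (ph l x - ph (- k) x))).
  by apply: eq_Rintegral => x _; rewrite torus_phaseN opprK sinB sinD; field.
have m1 := measurable_funB (mph l) (mph k); have m2 := measurable_funB (mph l) (mph (- k)).
rewrite RintegralZl//; last by apply: rintegrableD; exact: si.
rewrite RintegralD//; [|exact: si|exact: si].
by rewrite !s addr0 mulr0.
Qed.

Lemma cosc_cos a xi l : cosc tor ph (fun x => a * cos (ph xi x)) l =
  a * (V / 2 * ((xi == l)%:R + (xi == - l)%:R)).
Proof.
rewrite -torus_cos_cos; apply: etrans (coscZ (torus_orthogonal R n) a l _) _ => //.
exact: sqint_cos.
Qed.

(** The only frequencies are [xi] and [- xi]; they differ by [2 xi], so [k] and [k + xi] cannot both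
    be among them unless [xi = 0]. *)
Lemma correlation_cos a xi k : xi != 0 ->
  correlation (fun x => a * cos (ph xi x)) xi k = 0.
Proof.
move=> xi0; rewrite /correlation.
have sE l : sinc tor ph (fun x => a * cos (ph xi x)) l = 0.
  apply: etrans (sincZ (torus_orthogonal R n) a l _) _.
    exact: sqint_cos.
  by rewrite /sinc torus_cos_sin mulr0.
rewrite !sE mul0r addr0 !cosc_cos.
have [ek|nk] := eqVneq xi k.
  subst k; have -> : (xi == xi + xi) = false.
    by apply/negbTE; rewrite -subr_eq0 opprD addNKr oppr_eq0.
  have -> : (xi == - (xi + xi)) = false.
    apply/negbTE/eqP => H; move/eqP: xi0; apply; apply/rowP => i; rewrite mxE.
    by have /rowP/(_ i) := H; rewrite !mxE; lia.
  by rewrite addr0 !mulr0.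
have [ek|nk'] := eqVneq xi (- k); last by rewrite addr0 !mulr0 mul0r.
have -> : k + xi = 0 by rewrite ek addrN.
by rewrite oppr0 (negbTE xi0) addr0 !mulr0.
Qed.

End torus_trigonometry.

(** * The oscillating limit and the contradiction *)

Section oscillation.
Context {R : realType} {n : nat}.
Local Notation mu := (spacetime_measure R n).
Local Notation leb := (@lebesgue_measure R).
Local Notation tor := (@torus_measure R n).
Local Notation E := (measurableTypeR R * 'rV[R]_n)%type.
Local Notation ph := (@torus_phase R n).
Local Notation cosc := (cosc tor ph).
Local Notation sinc := (sinc tor ph).
Local Notation V := (mass tor).
Local Notation eta := (@bumpR R).

Lemma rintegrable_wave (g : R -> R) k b : smooth_on setT g -> compactly_supported g ->
  rintegrable mu (wave g k b : E -> R).
Proof.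
move=> sg kg.
have [] := @wave_coefE R n 1 (fun=> 1) (measurable_cst _) _ k b g sg kg.
  by move=> z; rewrite normr1.
by under eq_fun do rewrite mul1r.
Qed.

Lemma wave_coef_cosc (theta : E -> R) k t :
  wave_coef theta k 0 t = cosc (fun x => theta (t, x)) k.
Proof. by apply: eq_Rintegral => x _; rewrite addr0. Qed.

Lemma wave_coef_sinc (theta : E -> R) k t :
  wave_coef theta k (- (pi / 2)) t = sinc (fun x => theta (t, x)) k.
Proof.
apply: eq_Rintegral => x _.
by rewrite cosBpihalf.
Qed.

Let seta : smooth_on setT eta. Proof. exact: smooth_bumpR. Qed.
Let keta : compactly_supported eta.
Proof. by exists 1 => t /ltW; exact: bumpR_eq0. Qed.
Let seta' : smooth_on setT ('D_1 eta). Proof. exact: smooth_derive. Qed.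
Let keta' : compactly_supported ('D_1 eta).
Proof. exact: compactly_supported_derive. Qed.

Variable m : 'rV[R]_n -> 'rV[R[i]]_n.
Hypothesis hm : multiplier_symbol m.
Variable xi0 : 'rV[int]_n.
Hypothesis xi0_neq0 : xi0 != 0.
Hypothesis heven : forall xi : 'rV[R]_n, xi != 0 ->
  dotv (complexv (freq xi0)) (m xi + m (- xi)) = 0.

Local Notation f := (wave ('D_1 eta) xi0 0 : E -> R).

Lemma regular_flux_bound M theta u e Fe C t : regular_solution m M theta u ->
  (forall k, `|sigma m xi0 k| <= C) -> 0 <= e -> uniq Fe ->
  (forall k, k \notin Fe -> `|sigma m xi0 k - sigma m xi0 (k + xi0)| <= e) ->
  `|wave_flux theta u xi0 0 t| <= V^-1 * C *
     \sum_(k <- Fe) `|correlation (fun x => theta (t, x)) xi0 k| + e * (M ^+ 2 * V).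
Proof.
move=> rs sC e0 uF Fs.
have [[mt tM] _ su fo _] := rs.
(* The real parts of the symbol cancel in the coefficients of [w] by [dotv_symbol_re], leaving the
   multiplier [i sigma] of the commutator estimate. *)
pose w x := \sum_l (xi0 ord0 l)%:~R * u l (t, x).
have sw : sqint tor w by apply: sqint_sum => l; apply: sqintZ; exact: su.
have st := bounded_slice mt tM t.
have on := torus_orthogonal R n.
have wE (g : 'rV[R]_n -> R) : sqint tor g -> \int[tor]_x (w x * g x) =
    \sum_l (xi0 ord0 l)%:~R * \int[tor]_x (u l (t, x) * g x).
  move=> sg; have ug l := sqintM (su l t) sg.
  transitivity (\int[tor]_x (\sum_l (xi0 ord0 l)%:~R * (u l (t, x) * g x))).
    by apply: eq_Rintegral => x _; rewrite mulr_suml; apply: eq_bigr => l _; rewrite mulrA.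
  rewrite Rintegral_sum; last by move=> l; exact: rintegrableZ (ug l).
  by apply: eq_bigr => l _; rewrite RintegralZl.
have mph k : measurable_fun setT (ph k) by case: on.
have cw k : cosc w k = \sum_l (xi0 ord0 l)%:~R * cosc (fun x => u l (t, x)) k.
  by apply: wE; exact: sqint_cos.
have sw' k : sinc w k = \sum_l (xi0 ord0 l)%:~R * sinc (fun x => u l (t, x)) k.
  by apply: wE; exact: sqint_sin.
have -> : wave_flux theta u xi0 0 t =
    \int[tor]_x (theta (t, x) * w x * sin (ph xi0 x)).
  apply: eq_Rintegral => x _; rewrite /w mulr_sumr mulr_suml.
  by apply: eq_bigr => l _; rewrite addr0; ring.
apply: le_trans (lerD (lexx _) (ler_wpM2l e0 (bounded_slice_bound mt tM t))).
apply: (@commutator_bound R n _ w (sigma m xi0)) => //.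
- move=> k; rewrite cw.
  rewrite (eq_bigr (fun l => (xi0 ord0 l)%:~R * symbol_re m k l * cosc (fun x => theta (t, x)) k
    + (xi0 ord0 l)%:~R * symbol_im m k l * sinc (fun x => theta (t, x)) k)).
    by rewrite big_split/= -!mulr_suml (dotv_symbol_re hm heven) mul0r add0r.
  by move=> l _; have /= [-> _] := fo l t k; ring.
- move=> k; rewrite sw'.
  rewrite (eq_bigr (fun l => (xi0 ord0 l)%:~R * symbol_re m k l * sinc (fun x => theta (t, x)) k
    + (xi0 ord0 l)%:~R * symbol_im m k l * - cosc (fun x => theta (t, x)) k)).
    by rewrite big_split/= -!mulr_suml (dotv_symbol_re hm heven) mul0r add0r mulrN mulNr.
  by move=> l _; have /= [_ ->] := fo l t k; ring.
Qed.

Lemma wave_bounded (g : R -> R) k b B : (forall t, `|g t| <= B) ->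
  forall z : E, `|wave g k b z| <= B.
Proof.
move=> gB z; rewrite /wave normrM -[leRHS]mulr1 ler_pM//; exact: cos_max.
Qed.

(** Weak-* convergence is assumed for the original solutions, while coefficients at fixed times are
    taken on the modified [th]; both give the same spacetime integrals. *)
Lemma wave_coef_weak_star theta_ M f0 B k b g : weak_star_cvg theta_ f0 ->
  (forall j, measurable_fun [set: E] (theta_ j)) ->
  measurable_fun [set: E] f0 -> (forall z, `|f0 z| <= B) ->
  forall th : nat -> E -> R, (forall j, measurable_fun [set: E] (th j)) ->
  (forall j z, `|th j z| <= M) -> (forall j, {ae mu, forall z, theta_ j z = th j z}) ->
  smooth_on setT g -> compactly_supported g ->
  \int[leb]_t (g t * wave_coef (th j) k b t) @[j --> \oo] -->
    \int[leb]_t (g t * wave_coef f0 k b t).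
Proof.
move=> wsc mtheta mf fB th mth thM thE sg kg.
have wi := rintegrable_wave k b sg kg.
have [_ <-] := wave_coefE mf fB k b sg kg.
have -> : (fun j => \int[leb]_t (g t * wave_coef (th j) k b t)) =
    (fun j => \int[mu]_z (theta_ j z * wave g k b z)).
  apply/funext => j; have [_ <-] := wave_coefE (mth j) (thM j) k b sg kg.
  have mw := rintegrable_measurable wi.
  apply: Rintegral_ae_eq; [exact: measurable_funM (mth j) mw|
    exact: measurable_funM (mtheta j) mw|].
  by apply: (@filterS _ _ (ae_filter_ringOfSetsType mu)) (thE j) => z ->.
apply: wsc; last exact: wave_periodic.
exact/Lfun1_integrable.
Qed.

Lemma oscillation_not_weak_limit (theta_ : nat -> E -> R) :
  (forall j, bounded_weak_solution m (theta_ j)) -> ~ weak_star_cvg theta_ f.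
Proof.
move=> sol wsc.
have tL j : theta_ j \in Lfun mu +oo%E by case: (sol j).
have [M M0 tM] : exists2 M, 0 <= M & forall j, ae_bounded mu (theta_ j) M.
  by apply: weak_star_bounded wsc => j; case: (sol j).
have [P HP] := boolp.choice (fun j => regular_solution_exists M0 (sol j) (tM j)).
have [U HU] := boolp.choice HP.
have rs j : regular_solution m M (P j) (U j) by case: (HU j).
have mP j : measurable_fun [set: E] (P j) by case: (rs j) => -[].
have PM j z : `|P j z| <= M by case: (rs j) => -[_ H] _ _ _ _; exact: H.
have PE j : {ae mu, forall z, theta_ j z = P j z} by case: (HU j).
have [C mC] := symbol_bounded hm.
have [Cs HCs] := sigma_bounded hm xi0.
have [B HB] := compactly_supported_bounded (smooth_continuous seta') keta'.
have fB := wave_bounded xi0 0 HB.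
have mf : measurable_fun [set: E] f.
  exact: rintegrable_measurable (rintegrable_wave xi0 0 seta' keta').
have wcf k b g sg kg := @wave_coef_weak_star theta_ M f B k b g wsc
  (fun j => Lfun_measurable (tL j)) mf fB P mP PM PE sg kg.
have pw k b : {ae leb, forall t, wave_coef (P j) k b t @[j --> \oo] --> wave_coef f k b t}.
  apply: (@weak_cvg_lipschitz R (fun j => wave_coef (P j) k b) _ (Num.max (M * V) (B * V))
    (wave_lip C M k)).
  - by move=> j; exact: wave_coef_measurable (mP j) (PM j) k b.
  - exact: wave_coef_measurable mf fB k b.
  - by move=> j s; rewrite le_max (wave_coef_bound (mP j) (PM j)).
  - by move=> s; rewrite le_max (wave_coef_bound mf fB) orbT.
  - exact: (wave_lip_ge0 mC (rs 0%N) k 0).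
  - by move=> j g sg kg; exact: (wave_coef_lip mC (rs j)).
  - move=> g sg kg; have := wcf k b g sg kg.
    have swap (v : R -> R) : \int[leb]_s (g s * v s) = \int[leb]_s (v s * g s).
      by apply: eq_Rintegral => s _; rewrite mulrC.
    rewrite swap; have -> // : (fun j => \int[leb]_t (g t * wave_coef (P j) k b t)) =
      (fun j => \int[leb]_s (wave_coef (P j) k b s * g s)).
    by apply/funext => j; exact: swap.
have {}pw : {ae leb, forall t, forall k,
    cosc (fun x => P j (t, x)) k @[j --> \oo] --> cosc (fun x => f (t, x)) k /\
    sinc (fun x => P j (t, x)) k @[j --> \oo] --> sinc (fun x => f (t, x)) k}.
  (* The lattice is countable, so enumerating it through [unpickle] collects the exceptional times
     of all frequencies into one null set. *)
  have H i : {ae leb, forall t, forall k : 'rV[int]_n, unpickle i = Some k ->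
      wave_coef (P j) k 0 t @[j --> \oo] --> wave_coef f k 0 t /\
      wave_coef (P j) k (- (pi / 2)) t @[j --> \oo] --> wave_coef f k (- (pi / 2)) t}.
    case: (unpickle i) => [k|]; last by apply: nearW.
    apply: (@filterS2 _ _ (ae_filter_ringOfSetsType leb)) (pw k 0) (pw k (- (pi / 2))).
    by move=> t c s k' [<-].
  apply: (@filterS _ _ (ae_filter_ringOfSetsType leb)) (ae_foralln H) => t Ht k.
  have [c s] := Ht (pickle k) k (pickleK k).
  rewrite -wave_coef_cosc -wave_coef_sinc; split.
    by under eq_fun do rewrite -wave_coef_cosc.
  by under eq_fun do rewrite -wave_coef_sinc.
pose Q j := wave_flux (P j) (U j) xi0 0.
have Qlip j t : `|Q j t| <= wave_lip C M xi0 by exact: (wave_flux_bound mC (rs j)).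
have V0 : 0 < V by exact: torus_mass_gt0.
have Q0 : {ae leb, forall t, Q j t @[j --> \oo] --> 0}.
  apply: (@filterS _ _ (ae_filter_ringOfSetsType leb)) pw => t pt.
  have corr0 k : `|correlation (fun x => P j (t, x)) xi0 k| @[j --> \oo] --> 0.
    have <- : `|correlation (fun x => f (t, x)) xi0 k| = 0.
      apply/eqP; rewrite normr_eq0; apply/eqP.
      rewrite -[RHS](correlation_cos ('D_1 eta t) k xi0_neq0); congr correlation.
      by apply/funext => x; rewrite /wave /= addr0.
    apply: cvg_norm; have [c1 s1] := pt k; have [c2 s2] := pt (k + xi0).
    by apply: cvgD; apply: cvgM.
  have sum0 (F : seq 'rV[int]_n) :
      \sum_(k <- F) `|correlation (fun x => P j (t, x)) xi0 k| @[j --> \oo] --> 0.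
    elim: F => [|k F IH].
      have -> : (fun j => \sum_(k <- [::]) `|correlation (fun x => P j (t, x)) xi0 k|) = cst 0.
        by apply/funext => j; rewrite big_nil.
      exact: cvg_cst.
    have -> : (fun j => \sum_(k <- k :: F) `|correlation (fun x => P j (t, x)) xi0 k|) =
        (fun j => `|correlation (fun x => P j (t, x)) xi0 k| +
          \sum_(k <- F) `|correlation (fun x => P j (t, x)) xi0 k|).
      by apply/funext => j; rewrite big_cons.
    by rewrite -[X in _ --> X]addr0; exact: cvgD.
  apply/cvgrPdist_le => e e0.
  (* The tolerance on [sigma] is [e / (2 K)], so the slowly varying part costs at most [e / 2]; the
     finitely many remaining correlations share the other half. The added 1 keeps [K] positive when
     [M = 0]. *)
  pose K := M ^+ 2 * V + 1.
  have K0 : 0 < K by rewrite ltr_wpDl// mulr_ge0 ?sqr_ge0// ltW.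
  have eK : 0 < e / (2 * K) by rewrite divr_gt0// mulr_gt0.
  have [F uF HF] := sigma_slow hm xi0 eK.
  have : V^-1 * Cs * (\sum_(k <- F) `|correlation (fun x => P j (t, x)) xi0 k|)
      @[j --> \oo] --> 0.
    by rewrite -[X in _ --> X](mulr0 (V^-1 * Cs)); apply: cvgM; [exact: cvg_cst|exact: sum0].
  move=> /cvgrPdist_le /(_ (e / 2) (divr_gt0 e0 (ltr0n _ 2))).
  apply: filterS => j; rewrite !sub0r !normrN => Hj.
  apply: (le_trans (regular_flux_bound t (rs j) HCs (ltW eK) uF HF)).
  have := ler_norm (V^-1 * Cs * (\sum_(k <- F) `|correlation (fun x => P j (t, x)) xi0 k|)).
  have : e / (2 * K) * (M ^+ 2 * V) <= e / 2.
    have -> : e / 2 = e / (2 * K) * K by field; rewrite gt_eqF.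
    by rewrite ler_pM2l// /K lerDl.
  by move: Hj; lra.
have limQ : \int[leb]_t (eta t * Q j t) @[j --> \oo] --> (0 : R).
  have ei := compactly_supported_rintegrable seta keta.
  have -> : (0 : R) = \int[leb]_t (cst 0 t) by rewrite Rintegral_cst// mul0r.
  apply: (@Rintegral_dominated _ _ R leb (fun j t => eta t * Q j t) (cst 0)
    (fun t => wave_lip C M xi0 * `|eta t|)).
  - move=> j; apply: measurable_funM; first exact: rintegrable_measurable ei.
    exact: (wave_flux_measurable mC (rs j)).
  - exact: measurable_cst.
  - apply: (@filterS _ _ (ae_filter_ringOfSetsType leb)) Q0 => t Qt.
    by rewrite /cst -[X in _ --> X](mulr0 (eta t)); apply: cvgM; [exact: cvg_cst|exact: Qt].
  - by apply: rintegrableZ; exact: integrable_norm ei.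
  - by apply: nearW => t j; rewrite normrM mulrC ler_wpM2r.
have limP : \int[leb]_t (eta t * Q j t) @[j --> \oo] -->
    \int[leb]_t ('D_1 eta t * wave_coef f xi0 0 t).
  (* By the equation the flux integrals are linear in the solution, so their limit can be computed a
     second time, through weak-* convergence. *)
  have -> : (fun j => \int[leb]_t (eta t * Q j t)) =
      (fun j => \int[leb]_t ('D_1 eta t * wave_coef (P j) xi0 0 t)).
    apply/funext => j; rewrite -(wave_balance mC (rs j) xi0 0 seta keta).
    by apply: eq_Rintegral => t _; rewrite mulrC.
  exact: wcf.
have : \int[leb]_t ('D_1 eta t * wave_coef f xi0 0 t) = 0.
  exact: (cvg_unique (@Rhausdorff R) limP limQ).
(* The value produced by [cosc_cos]; only its positivity matters for the contradiction. *)
pose c : R := V / 2 * (1 + (xi0 == - xi0)%:R).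
have c0 : 0 < c by rewrite !mulr_gt0// ltr_wpDr.
have -> : \int[leb]_t ('D_1 eta t * wave_coef f xi0 0 t) = \int[leb]_t (c * ('D_1 eta t ^+ 2)).
  apply: eq_Rintegral => t _; rewrite wave_coef_cosc.
  have -> : (fun x => f (t, x)) = (fun x => 'D_1 eta t * cos (ph xi0 x)).
    by apply/funext => x; rewrite /wave /= addr0.
  by rewrite cosc_cos eqxx mulrCA mulrA mulrC.
have sqr_i : rintegrable leb (fun t => 'D_1 eta t ^+ 2).
  have -> : (fun t => 'D_1 eta t ^+ 2) = (fun t => 'D_1 eta t * 'D_1 eta t).
    by apply/funext => t; rewrite expr2.
  exact: (rintegrable_compactly_supported (smooth_measurable seta') HB seta' keta').
rewrite RintegralZl// => /eqP; apply/negP; rewrite gt_eqF// mulr_gt0//.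
by apply: Rintegral_sqr_derive_gt0 => //; rewrite gt_eqF// bumpR0_gt0.
Qed.

End oscillation.

Theorem theorem1p6 (R : realType) (n : nat) (hn : (1 <= n)%N)
    (m : 'rV[R]_n -> 'rV[R[i]]_n) (hm : multiplier_symbol m)
    (xi0 : 'rV[int]_n) (hxi0 : xi0 != 0)
    (heven : forall xi : 'rV[R]_n, xi != 0 ->
      dotv (complexv (freq xi0)) (m xi + m (- xi)) = 0) :
  exists f : R * 'rV[R]_n -> R,
    [/\ test_function f,
        forall t : R, \int[torus_measure n]_x f (t, x) = 0 &
        forall theta : nat -> R * 'rV[R]_n -> R,
          (forall j, bounded_weak_solution m (theta j)) ->
          ~ weak_star_cvg theta f].
Proof.
have kb : compactly_supported ('D_1 (@bumpR R)).
  by apply: compactly_supported_derive; exists 1 => t /ltW; exact: bumpR_eq0.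
have sb : smooth_on setT ('D_1 (@bumpR R)) by apply: smooth_derive; exact: smooth_bumpR.
exists (wave ('D_1 (@bumpR R)) xi0 0); split.
- by have [A bA] := kb; exact: wave_test sb bA.
- move=> t; rewrite -[RHS](torus_cos_mean ('D_1 (@bumpR R) t) hxi0).
  by apply: eq_Rintegral => x _; rewrite /wave /= addr0.
- by move=> theta sol; exact: (oscillation_not_weak_limit hm hxi0 heven sol).
Qed.
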